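(* Let $\Omega$ be either $\Omega_\infty:=\mathbb R\times(-1,1)$ or $\mathbb R^2_+:=\mathbb R\times(0,\infty)$. Let $\mathbf v=(v_1,v_2)\in C^1(\bar\Omega)$ be a solution of $$\mathbf v\cdot\nabla\mathbf v+\nabla P=0,\quad \operatorname{div}\mathbf v=0\quad\text{in }\Omega,\qquad v_2=0\quad\text{on }\partial\Omega .$$ Assume that there is a constant $C>0$ such that, for all $R>100$, $\sup_{[-R,R]\times[-1,1]}|\mathbf v|\le C\sqrt R$ if $\Omega=\Omega_\infty$, or $\sup_{\{x\in\mathbb R^2_+:|x|\le R\}}|\mathbf v|\le C\sqrt{\log R}$ if $\Omega=\mathbb R^2_+$. (i) If $\mathbf v$ has finite total curvature, i.e. $$\int_\Omega\frac{|v_1\nabla v_2-v_2\nabla v_1|^2}{|\mathbf v|^2}\,dx<\infty, \tag{F}$$ then the limit $$\mathcal J_\infty:=-\lim_{R\to+\infty}\int_{\partial\Omega}\phi_R|v_1|\,\partial_{\mathbf n}v_2\,dx_1$$ exists, where $\partial_{\mathbf n}$ is the outer normal derivative. Moreover, $$|\mathcal J_\infty|\le\frac2\pi\int_\Omega\frac{|v_1\nabla v_2-v_2\nabla v_1|^2}{|\mathbf v|^2}\,dx. \tag{L}$$ (ii) If $\mathbf v\in W^{2,1}_{loc}(\bar\Omega)$ and $v_1|_{\partial\Omega}\in L^\infty(\partial\Omega)$, then the following statements hold. (a) $\mathbf v$ satisfies (F) and equality in (L) holds if and only if one of the following three cases occurs: Case 1. $\Theta(\mathbf v;\bar\Omega)=S^1_+$.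 Case 2. $\Theta(\mathbf v;\bar\Omega)=S^1_-$. Case 3. $\mathbf v$ is a shear flow. (b) Let $\Omega=\mathbb R^2_+$. If $\Theta(\mathbf v;\bar\Omega)=S^1_+$, then $v_1(\cdot,0)$ is nonincreasing in $\mathbb R$, and it holds that $\underline v_{1,-}=-\underline v_{1,+}>0$ and $$\int_\Omega\frac{|v_1\nabla v_2-v_2\nabla v_1|^2}{|\mathbf v|^2}\,dx=\frac\pi2\,\underline v_{1,+}^2,$$ where $\underline v_{1,\pm}=\lim_{x_1\to\pm\infty}v_1(x_1,0)$. (c) Let $\Omega=\Omega_\infty$. If $\Theta(\mathbf v;\bar\Omega)=S^1_+$, then $v_1(\cdot,1)$ is nondecreasing in $\mathbb R$ and $v_1(\cdot,-1)$ is nonincreasing in $\mathbb R$, and it holds that $$\bar v_{1,+}^2-\bar v_{1,-}^2=\underline v_{1,+}^2-\underline v_{1,-}^2$$ and $$\int_\Omega\frac{|v_1\nabla v_2-v_2\nabla v_1|^2}{|\mathbf v|^2}\,dx=\frac\pi4\left\{\bar v_{1,+}|\bar v_{1,+}|-\bar v_{1,-}|\bar v_{1,-}|+\underline v_{1,-}|\underline v_{1,-}|-\underline v_{1,+}|\underline v_{1,+}|\right\},$$ where $\underline v_{1,\pm}=\lim_{x_1\to\pm\infty}v_1(x_1,-1)$ and $\bar v_{1,\pm}=\lim_{x_1\to\pm\infty}v_1(x_1,1)$.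
   Context: The integrand $|v_1\nabla v_2-v_2\nabla v_1|^2/|\mathbf v|^2$ is understood as $0$ where $\mathbf v=0$. $W^{2,1}_{loc}(\bar\Omega)$ means $W^{2,1}(\Omega\cap B)$ for every ball $B$. Cutoffs, for $R>100$. If $\Omega=\mathbb R^2_+$, $\phi_R=\phi_{log,R}$, where $\phi_{log,R}(x)=1$ if $|x|\le R$, $=2-\frac{\log|x|}{\log R}$ if $R<|x|<R^2$, $=0$ if $|x|\ge R^2$. If $\Omega=\Omega_\infty$, $\phi_R=\phi_{1,R}$, where $\phi_{1,R}(x_1)=1$ if $|x_1|\le R$, $=2-\frac{|x_1|}{R}$ if $R<|x_1|<2R$, $=0$ if $|x_1|\ge2R$. A shear flow in $\Omega$ with the slip condition is a flow of the form $\mathbf v=(v_1(x_2),0)$. The set of flow angles of $\mathbf u$ on a set $D$ is $$\Theta(\mathbf u;D)=\left\{\tfrac{\mathbf u(x)}{|\mathbf u(x)|}: x\in D,\ |\mathbf u(x)|>0\right\}\subset S^1,$$ and $S^1_+$, $S^1_-$ are the upper and lower closed semicircles $\{(\cos\theta,\sin\theta):0\le\theta\le\pi\}$ and $\{(\cos\theta,\sin\theta):-\pi\le\theta\le0\}$. *)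

(* Defs.v *)
From HB Require Import structures.
From mathcomp Require Import all_boot all_order all_algebra.
From mathcomp Require Import all_classical all_reals all_analysis.

Set Implicit Arguments.
Unset Strict Implicit.
Unset Printing Implicit Defensive.

Import Order.TTheory GRing.Theory Num.Theory numFieldNormedType.Exports.
Local Open Scope classical_set_scope.
Local Open Scope ring_scope.

(* The library norm on R * R is the sup norm; |x| is Euclidean throughout. *)
Definition enorm (R : realType) (x : R * R) : R :=
  Num.sqrt (x.1 ^+ 2 + x.2 ^+ 2).

Definition eball (R : realType) (c : R * R) (r : R) : set (R * R) :=
  [set x | enorm (x - c) < r].

Definition leb2 (R : realType) :
    {measure set (measurableTypeR R * measurableTypeR R) -> \bar R} :=
  (@lebesgue_measure R \x @lebesgue_measure R)%E.

(* pd false and pd true are the partial derivatives in x_1 and in x_2. *)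
Definition pd (R : realType) (i : bool) (f : R * R -> R) (x : R * R) : R :=
  'D_((if i then (0, 1) else (1, 0)) : R * R) f x.

Definition grad (R : realType) (f : R * R -> R) (x : R * R) : R * R :=
  (pd false f x, pd true f x).

Definition comp1 (R : realType) (v : R * R -> R * R) (x : R * R) : R := (v x).1.
Definition comp2 (R : realType) (v : R * R -> R * R) (x : R * R) : R := (v x).2.

(* Strip is R x (-1, 1), HalfPlane is R x (0, +oo). *)
Inductive flow_domain := Strip | HalfPlane.

Definition dom (R : realType) (D : flow_domain) : set (R * R) :=
  match D with
  | Strip => [set x | -1 < x.2 < 1]
  | HalfPlane => [set x | 0 < x.2]
  end.

Arguments dom R D : clear implicits.

(* The components of the boundary: (c, n) stands for the line x_2 = c, with
   outer unit normal (0, n). *)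
Definition walls (R : realType) (D : flow_domain) : seq (R * R) :=
  match D with
  | Strip => [:: (-1, -1); (1, 1)]
  | HalfPlane => [:: (0, -1)]
  end.

(* f is C^1 up to the boundary of the open set U: continuous on the closure,
   differentiable in U, with partial derivatives that extend continuously to
   the closure. *)
Definition C1_closure (R : realType) (U : set (R * R)) (f : R * R -> R) : Prop :=
  [/\ {within closure U, continuous f},
      forall x, U x -> differentiable f x &
      forall i, exists g : R * R -> R,
        {within closure U, continuous g} /\ (forall x, U x -> pd i f x = g x)].

Definition euler (R : realType) (U : set (R * R)) (v : R * R -> R * R)
    (P : R * R -> R) : Prop :=
  (forall x, U x -> differentiable P x) /\
  (forall x, U x ->
    [/\ (v x).1 * pd false (comp1 v) x + (v x).2 * pd true (comp1 v) x
          + pd false P x = 0,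
        (v x).1 * pd false (comp2 v) x + (v x).2 * pd true (comp2 v) x
          + pd true P x = 0 &
        pd false (comp1 v) x + pd true (comp2 v) x = 0]).

Definition slip (R : realType) (D : flow_domain) (v : R * R -> R * R) : Prop :=
  forall w x1, w \in walls R D -> (v (x1, w.1)).2 = 0.

Definition growth_region (R : realType) (D : flow_domain) (r : R) : set (R * R) :=
  match D with
  | Strip => `[- r, r] `*` `[-1, 1]
  | HalfPlane => dom R HalfPlane `&` [set x | enorm x <= r]
  end.

Definition growth_rate (R : realType) (D : flow_domain) (r : R) : R :=
  match D with Strip => Num.sqrt r | HalfPlane => Num.sqrt (ln r) end.

Definition growth (R : realType) (D : flow_domain) (v : R * R -> R * R) : Prop :=
  exists2 C : R, 0 < C & forall r : R, 100 < r ->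
    (ereal_sup [set (enorm (v x))%:E | x in growth_region D r]
      <= (C * growth_rate D r)%:E)%E.

(* Where v = 0 this is 0, since 0^-1 = 0. *)
Definition curvature_density (R : realType) (v : R * R -> R * R) (x : R * R) : R :=
  enorm ((v x).1 *: grad (comp2 v) x - (v x).2 *: grad (comp1 v) x) ^+ 2
    / enorm (v x) ^+ 2.

Definition total_curvature (R : realType) (D : flow_domain)
    (v : R * R -> R * R) : \bar R :=
  (\int[leb2 R]_(x in dom R D) (curvature_density v x)%:E)%E.

Definition cutoff_log (R : realType) (r : R) (x : R * R) : R :=
  if enorm x <= r then 1
  else if enorm x < r ^+ 2 then 2 - ln (enorm x) / ln r else 0.

Definition cutoff_lin (R : realType) (r : R) (x : R * R) : R :=
  if `|x.1| <= r then 1 else if `|x.1| < 2 * r then 2 - `|x.1| / r else 0.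

Definition cutoff (R : realType) (D : flow_domain) : R -> R * R -> R :=
  match D with Strip => @cutoff_lin R | HalfPlane => @cutoff_log R end.

(* One-sided derivative at a boundary point x along the outer normal n, using
   only the values of f at x - h n for h >= 0. *)
Definition dnormal (R : realType) (n : R * R) (f : R * R -> R) (x : R * R) : R :=
  lim ((f x - f (x - h *: n)) / h @[h --> 0^'+]).

Definition boundary_flux (R : realType) (D : flow_domain) (v : R * R -> R * R)
    (r : R) : R :=
  \sum_(w <- walls R D)
    \int[lebesgue_measure]_x1
      (cutoff D r (x1, w.1) * `|(v (x1, w.1)).1|
         * dnormal (0, w.2) (comp2 v) (x1, w.1)).

Definition J_infty (R : realType) (D : flow_domain) (v : R * R -> R * R) : R :=
  - lim (boundary_flux D v r @[r --> +oo]).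

Definition pds (R : realType) (s : seq bool) (f : R * R -> R) : R * R -> R :=
  foldr (@pd R) f s.

Definition test_function (R : realType) (U : set (R * R)) (f : R * R -> R) : Prop :=
  [/\ forall s x, differentiable (pds s f) x,
      compact (closure [set x | f x != 0]) &
      closure [set x | f x != 0] `<=` U].

Definition weak_derivative (R : realType) (U : set (R * R)) (s : seq bool)
    (f g : R * R -> R) : Prop :=
  forall phi, test_function U phi ->
    \int[leb2 R]_(x in U) (f x * pds s phi x)
    = (-1) ^+ size s * \int[leb2 R]_(x in U) (g x * phi x).

(* The Sobolev space W^{k,1}(U). *)
Definition sobolev1 (R : realType) (k : nat) (U : set (R * R))
    (f : R * R -> R) : Prop :=
  (leb2 R).-integrable U (EFin \o f) /\
  forall s, (size s <= k)%N -> exists g : R * R -> R,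
    (leb2 R).-integrable U (EFin \o g) /\ weak_derivative U s f g.

Definition W21_loc (R : realType) (U : set (R * R)) (v : R * R -> R * R) : Prop :=
  forall c r, 0 < r ->
    sobolev1 2 (U `&` eball c r) (comp1 v) /\
    sobolev1 2 (U `&` eball c r) (comp2 v).

Definition bounded_trace (R : realType) (D : flow_domain)
    (v : R * R -> R * R) : Prop :=
  forall w, w \in walls R D ->
    (fun x1 : R => (v (x1, w.1)).1) \in Lfun lebesgue_measure +oo%E.

Definition flow_angles (R : realType) (v : R * R -> R * R) (A : set (R * R))
    : set (R * R) :=
  [set (enorm (v x))^-1 *: v x | x in A `&` [set x | 0 < enorm (v x)]].

Definition upper_semicircle (R : realType) : set (R * R) :=
  [set (cos t, sin t) | t in `[0, pi]].

Definition lower_semicircle (R : realType) : set (R * R) :=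
  [set (cos t, sin t) | t in `[- pi, 0]].

Arguments upper_semicircle R : clear implicits.
Arguments lower_semicircle R : clear implicits.

Definition shear_flow (R : realType) (A : set (R * R)) (v : R * R -> R * R) : Prop :=
  exists f : R -> R, forall x, A x -> v x = (f x.2, 0).

(* Main.v *)
(** By the Euler equations, F = v_1 grad v_2 - v_2 grad v_1 is the gradient of the
    pressure rotated by a right angle, hence weakly divergence free; it is also
    |v|^2 times the gradient of the angle of v.  Testing div F = 0 with phi_R times
    a regularization of the unoriented angle of v shows that the flux of
    |v_1| d_n v_2 through the walls converges to -2/pi times the integral of
    sgn(v_2) |F|^2 / |v|^2: by Cauchy-Schwarz the error is controlled by the
    curvature outside a large ball and by the integral of |v|^2 |grad phi_R|^2,
    which the growth assumption bounds.  This gives (L).  In the equality case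
    F = 0 wherever v_2 has the wrong sign; there v is constant along the lines it
    spans, and these meet a wall, so that sign does not occur.  If the angles then
    missed a direction, cutting F off along it would make the flux vanish.  Once
    v_2 has a sign, v_1 is monotone on each wall, which bounds the flux and yields
    its limit explicitly. *)

Require Import Defs.
From HB Require Import structures.
From mathcomp Require Import all_boot all_order all_algebra.
From mathcomp Require Import all_classical all_reals all_analysis.
From mathcomp Require Import measurable_realfun.
From mathcomp Require Import ring lra.

Set Implicit Arguments.
Unset Strict Implicit.
Unset Printing Implicit Defensive.

Import Order.TTheory GRing.Theory Num.Theory numFieldNormedType.Exports.
Local Open Scope classical_set_scope.
Local Open Scope ring_scope.

(** Two obstacles shape the proof. The velocity is only C^1, so F is merely continuous and div F = 0
    is available only in integrated form; and the unoriented angle is undefined where v = 0 and has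
    a kink where v_2 = 0. Every function of v used for testing is therefore a limit of C^1 functions
    H_n, and [test_limit] asks only for a uniform bound on H_n, a domination of F . grad H_n and
    convergence on the walls. The factor 2/pi comes from the wall values of the folded angle,
    -(pi/2) sgn(v_1), which also turn v_1 into |v_1|. The growth rates are those for which the
    integral of |v|^2 |grad phi_R|^2 stays bounded; it need not tend to 0. Only the other factor of
    the error, the curvature beyond the core, does. Hence Young's inequality with a free weight k,
    which is fixed before R. When finite curvature is not given but v_2 has a sign, testing with
    phi_R^2 lets the curvature in the error be absorbed. The lower semicircle is reduced to the
    upper one by replacing v with -v, which leaves F and the pressure unchanged. *)

(** * Measurability, integration on boxes and difference quotients *)

(** The sigma-algebra on the plane is the product one, generated by rectangles; so the open preimage
    of a ray is written as a countable union of boxes with rational corners. *)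
Lemma continuous_measurable2 (R : realType) (f : R * R -> R) :
  continuous f ->
  measurable_fun [set: measurableTypeR R * measurableTypeR R] f.
Proof.
move=> cf; apply: (measurability _ (RGenOInfty.measurableE R)) => //.
move=> _ [_ [a ->] <-]; rewrite setTI.
pose I : Type := ((rat * rat) * (rat * rat))%type.
pose box (i : I) : set (R * R) :=
  `](ratr i.1.1 : R), (ratr i.1.2 : R)[%classic `*` `](ratr i.2.1 : R), (ratr i.2.2 : R)[%classic.
(* Boxes that stick out of the preimage are replaced by the empty set, so that the union runs over a
   whole countable type. *)
pose A i := if pselect (box i `<=` f @^-1` `]a, +oo[%classic) then box i else set0.
rewrite (_ : f @^-1` _ = \bigcup_(i in [set: I]) A i); last first.
  apply/seteqP; split=> [x fx|x [i _]]; last first.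
    by rewrite /A; case: pselect => // h; exact: h.
  have : nbhs x (f @^-1` `]a, +oo[%classic).
    apply: cf; apply: open_nbhs_nbhs; split => //; exact: interval_open.
  move=> [[U V] [/= /nbhs_ballP[e1 /= e10 hU] /nbhs_ballP[e2 /= e20 hV]] hUV].
  have [p1] : exists q : rat, x.1 - e1 < ratr q < x.1.
    by have [q] := @rat_in_itvoo R (x.1 - e1) x.1 ltac:(lra); rewrite in_itv/=; exists q.
  move=> /andP[p11 p12].
  have [q1] : exists q : rat, x.1 < ratr q < x.1 + e1.
    by have [q] := @rat_in_itvoo R x.1 (x.1 + e1) ltac:(lra); rewrite in_itv/=; exists q.
  move=> /andP[q11 q12].
  have [p2] : exists q : rat, x.2 - e2 < ratr q < x.2.
    by have [q] := @rat_in_itvoo R (x.2 - e2) x.2 ltac:(lra); rewrite in_itv/=; exists q.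
  move=> /andP[p21 p22].
  have [q2] : exists q : rat, x.2 < ratr q < x.2 + e2.
    by have [q] := @rat_in_itvoo R x.2 (x.2 + e2) ltac:(lra); rewrite in_itv/=; exists q.
  move=> /andP[q21 q22].
  exists ((p1, q1), (p2, q2)) => //; rewrite /A; case: pselect => [h|[]].
    by split; rewrite /= in_itv/=; apply/andP.
  move=> y [/=]; rewrite !in_itv/= => /andP[y1 y2] /andP[y3 y4]; apply: hUV.
  split; [apply: hU|apply: hV]; rewrite /ball /= ltr_norml; apply/andP; split; lra.
apply: countable_bigcupT_measurable => [|i]; first exact: countableP.
rewrite /A; case: pselect => _ /=; last exact: measurable0.
by apply: measurableX; exact: measurable_itv.
Qed.

Lemma continuous_compact_bound (R : realType) (T : topologicalType) (K : set T)
    (f : T -> R) : compact K -> continuous f ->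
  exists2 B : R, 0 < B & forall x, K x -> `|f x| <= B.
Proof.
move=> cK cf.
have /compact_bounded[M [Mr HM]] : compact (f @` K).
  by apply: continuous_compact => //; exact: continuous_subspaceT.
exists (`|M| + 1) => [|x Kx]; first by rewrite ltr_wpDl.
apply: HM; last by exists x.
by rewrite (le_lt_trans (ler_norm M)) // ltrDl.
Qed.

Lemma box_bound (R : realType) (a b c d : R) (f : R * R -> R) : continuous f ->
  exists2 B : R, 0 < B & forall x y, a <= x <= b -> c <= y <= d -> `|f (x, y)| <= B.
Proof.
move=> cf.
have cK : compact (`[a, b]%classic `*` `[c, d]%classic).
  by apply: compact_setX; exact: segment_compact.
have [B B0 HB] := @continuous_compact_bound R _ _ f cK cf.
by exists B => // x y xab ycd; apply: HB; split; rewrite /= in_itv.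
Qed.

Lemma measurable_itvX (R : realType) (I J : interval R) :
  measurable ([set` I] `*` [set` J] : set (measurableTypeR R * measurableTypeR R)).
Proof. by apply: measurableX; exact: measurable_itv. Qed.

Lemma leb2_box (R : realType) (a b c d : R) (b1 b2 b3 b4 : bool) :
  a <= b -> c <= d ->
  leb2 R ([set` Interval (BSide b1 a) (BSide b2 b)] `*`
          [set` Interval (BSide b3 c) (BSide b4 d)]) = ((b - a) * (d - c))%:E.
Proof.
move=> ab cd.
have leb2X : forall A B : set R, measurable A -> measurable B ->
    leb2 R (A `*` B) = (lebesgue_measure A * lebesgue_measure B)%E.
  by move=> A B mA mB; exact: product_measure1E.
have len (x y : R) (i j : bool) : x <= y ->
    lebesgue_measure [set` Interval (BSide i x) (BSide j y)] = (y - x)%:E.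
  move=> xy; rewrite lebesgue_measure_itv /= lte_fin EFinB.
  case: ltP => // yx; have -> : x = y by apply/le_anti; rewrite xy yx.
  by rewrite -EFinB subrr.
by rewrite leb2X; [rewrite !len|exact: measurable_itv..].
Qed.

Lemma box_integrable (R : realType) (a b c d : R) (b1 b2 b3 b4 : bool)
    (f : R * R -> R) : a <= b -> c <= d -> continuous f ->
  (leb2 R).-integrable ([set` Interval (BSide b1 a) (BSide b2 b)] `*`
                        [set` Interval (BSide b3 c) (BSide b4 d)]) (EFin \o f).
Proof.
move=> ab cd cf; apply: measurable_bounded_integrable.
- exact: measurable_itvX.
- by have := @leb2_box R a b c d b1 b2 b3 b4 ab cd; rewrite /= => ->; rewrite ltry.
- by apply: measurable_funTS; exact: continuous_measurable2.
- have [B B0 HB] := @box_bound R a b c d f cf.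
  exists B; split; first exact: gtr0_real.
  move=> M BM [x y] [/= xI yI]; apply: (le_trans (HB x y _ _)); last exact: ltW.
  + by have := @subset_itv_oo_cc; move: xI; case: b1; case: b2; rewrite in_itv/=; lra.
  + by move: yI; case: b3; case: b4; rewrite in_itv/=; lra.
Qed.

Lemma box_fubini (R : realType) (A B : set R) (f : R * R -> R) :
  measurable A -> measurable B -> (leb2 R).-integrable (A `*` B) (EFin \o f) ->
  (\int[leb2 R]_(z in A `*` B) (f z)%:E =
  \int[lebesgue_measure]_(y in B) \int[lebesgue_measure]_(x in A) (f (x, y))%:E)%E.
Proof.
move=> mA mB fi; rewrite integral_mkcond /leb2 -integral21_prod_meas1; last first.
  by move: fi => /integrable_mkcond; apply; exact: measurableX.
rewrite [RHS]integral_mkcond; apply: eq_integral => y _.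
rewrite /fubini_G /patch; case: ifPn => yB; last first.
  rewrite integral0_eq// => x _; rewrite ifF//.
  by apply/negbTE; apply: contra yB => /set_mem[_ /= ?]; exact/mem_set.
rewrite [RHS]integral_mkcond; apply: eq_integral => x _ /=; rewrite /patch.
congr (if _ then _ else _); apply/idP/idP => /set_mem h; apply/mem_set.
  by case: h.
by split => //; exact: set_mem yB.
Qed.

Lemma is_derive1P (R : realType) (f : R -> R) (y df : R) :
  is_derive y 1 f df <->
  (fun h => (f (y + h) - f y) / h) @ 0^' --> df.
Proof.
have E : (fun h : R => h^-1 *: (f (h *: (1 : R) + y) - f y)) =
    (fun h => (f (y + h) - f y) / h).
  by apply/funext => h; rewrite /GRing.scale /= mulr1 (addrC h) mulrC.
split=> [[dy <-]|fy].
  by move: dy; rewrite /derivable /derive E => /cvgP.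
by apply: DeriveDef; [apply/cvg_ex; exists df; rewrite E|apply/cvg_lim => //; rewrite E].
Qed.

(** The difference quotient as a function of the step, completed by [df] at step 0:
    differentiability becomes continuity at 0, the form needed for limits under an integral sign. *)
Definition diffq (R : realType) (f : R -> R) (df y k : R) : R :=
  if k == 0 then df else (f (y + k) - f y) / k.

Lemma diffq_cvg0 (R : realType) (f : R -> R) (df y : R) :
  is_derive y 1 f df -> {for 0, continuous (diffq f df y)}.
Proof.
move=> /is_derive1P dfy; apply/continuous_withinNx; rewrite {2}/diffq eqxx.
apply: cvg_trans dfy; apply: near_eq_cvg; near=> k.
rewrite /diffq ifF//; apply/negbTE; near: k; exact: nbhs_dnbhs_neq.
Unshelve. all: by end_near. Qed.

Lemma diffq_cvgN0 (R : realType) (f : R -> R) (df y k : R) : k != 0 ->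
  {for y + k, continuous f} -> {for k, continuous (diffq f df y)}.
Proof.
move=> k0 cf; rewrite /prop_for /continuous_at.
have -> : diffq f df y k = (f (y + k) - f y) / k by rewrite /diffq (negbTE k0).
have H : (fun k => (f (y + k) - f y) / k) @ k --> (f (y + k) - f y) / k.
  apply: cvgM; last exact: cvgV.
  apply: cvgB; last exact: cvg_cst.
  apply: (@continuous_comp _ _ _ (fun k => y + k) f); last exact: cf.
  by apply: cvgD; [exact: cvg_cst|exact: cvg_id].
apply: cvg_trans H; apply: near_eq_cvg; near=> h.
rewrite /diffq ifF//; apply/negbTE; near: h.
exact: (cvgr_neq0 _ cvg_id k0).
Unshelve. all: by end_near. Qed.

Lemma is_derive_cts (R : realType) (f : R -> R) (y df : R) :
  is_derive y 1 f df -> {for y, continuous f}.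
Proof. by move=> [d _]; apply: differentiable_continuous; apply/derivable1_diffP. Qed.

(** By the mean value theorem the bound is uniform in the step; it supplies the domination in
    [green_derive]. *)
Lemma diffq_bound (R : realType) (f df : R -> R) (c d y k B : R) :
  (forall t, c < t < d -> is_derive t 1 f (df t)) ->
  (forall t, c < t < d -> `|df t| <= B) ->
  c < y < d -> c < y + k < d -> `|diffq f (df y) y k| <= B.
Proof.
move=> fd fB yI ykI; rewrite /diffq; case: eqP => [_|/eqP k0]; first exact: fB.
have seg (a b : R) : c < a -> b < d -> a < b -> exists2 t, c < t < d & f b - f a = df t * (b - a).
  move=> ca bd ab; have [||t tab E] := @MVT R f df a b ab.
  - by move=> t; rewrite in_itv/= => /andP[? ?]; apply: fd; lra.
  - apply: derivable_within_continuous => t; rewrite in_itv/= => /andP[? ?].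
    by have [] : is_derive t 1 f (df t) by apply: fd; lra.
  by exists t => //; move: tab; rewrite in_itv/=; lra.
have [kp|kn|/eqP] := ltgtP 0 k; last by rewrite eq_sym (negbTE k0).
  have [||| t tI ->] := seg y (y + k); [lra..|].
  by rewrite (addrC y) addrK mulfK//; exact: fB.
have [||| t tI E] := seg (y + k) y; [lra..|].
rewrite (_ : _ / k = df t); first exact: fB.
by rewrite -opprB E opprD addrA subrr add0r mulrN opprK mulfK.
Qed.

Lemma derivable_oo_LRcontinuousT (R : realType) (F f : R -> R) (a b : R) :
  (forall x : R, is_derive x 1 F (f x)) -> derivable_oo_LRcontinuous F a b.
Proof.
move=> dF; have cF x : {for x, continuous F} by exact: is_derive_cts (dF x).
split; first by move=> x _; have [] := dF x.
- by apply: cvg_at_right_filter; exact: cF.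
- by apply: cvg_at_left_filter; exact: cF.
Qed.

Lemma continuous_itv_integrable (R : realType) (f : R -> R) (a b : R) :
  continuous f -> (@lebesgue_measure R).-integrable `[a, b] (EFin \o f).
Proof.
move=> cf; apply: continuous_compact_integrable; first exact: segment_compact.
exact: continuous_subspaceT.
Qed.

Lemma Rintegration_by_partsT (R : realType) (F G f g : R -> R) (a b : R) : a < b ->
  (forall x : R, is_derive x 1 F (f x)) -> continuous f ->
  (forall x : R, is_derive x 1 G (g x)) -> continuous g ->
  \int[lebesgue_measure]_(x in `[a, b]) (F x * g x) =
  (F b * G b - F a * G a) - \int[lebesgue_measure]_(x in `[a, b]) (f x * G x).
Proof.
move=> ab dF cf dG cg; apply: Rintegration_by_parts => //.
- exact: continuous_subspaceT.
- exact: derivable_oo_LRcontinuousT dF.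
- by move=> x _; rewrite derive1E; exact: derive_val.
- exact: continuous_subspaceT.
- exact: derivable_oo_LRcontinuousT dG.
- by move=> x _; rewrite derive1E; exact: derive_val.
Qed.

Lemma continuous_fst_slice (R : realType) (f : R * R -> R) (y : R) :
  continuous f -> continuous (fun x => f (x, y)).
Proof.
move=> cf x; apply: (@continuous_comp _ _ _ (fun x => (x, y)) f); last exact: cf.
exact: (cvg_pair cvg_id (cvg_cst y)).
Qed.

Lemma continuous_snd_slice (R : realType) (f : R * R -> R) (x : R) :
  continuous f -> continuous (fun y => f (x, y)).
Proof.
move=> cf y; apply: (@continuous_comp _ _ _ (fun y => (x, y)) f); last exact: cf.
exact: (cvg_pair (cvg_cst x) cvg_id).
Qed.

Lemma continuous_slice_integral (R : realType) (f : R * R -> R) (a b : R) :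
  continuous f ->
  continuous (fun y => \int[lebesgue_measure]_(x in `[a, b]) f (x, y)).
Proof.
move=> cf y; have [B B0 HB] := @box_bound R a b (y - 1) (y + 1) f cf.
have yI : y \in (`]y - 1, y + 1[%classic : set R).
  by apply/mem_set; rewrite /= in_itv/=; lra.
apply: (@continuity_under_integral R _ _ lebesgue_measure (fun y x => f (x, y))
  `[a, b]%classic _ (y - 1) (y + 1) _ _ (cst B)) => //.
- by move=> t _; apply: continuous_itv_integrable; exact: continuous_fst_slice.
- by apply: aeW => /= x _ t _; exact: continuous_snd_slice.
- by apply: continuous_itv_integrable; exact: cst_continuous.
- move=> t; rewrite /= in_itv/= => /andP[? ?]; apply: aeW => x.
  by rewrite /= in_itv/= => xab; apply: HB => //; lra.
Qed.

(** * Green's formula for a rotated gradient *)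

Section green.
Context (R : realType) (P p1 p2 psi psi1 psi2 : R * R -> R) (a b c d : R).
Hypothesis ab : a < b.
Hypotheses (cp1 : continuous p1) (cp2 : continuous p2).
Hypotheses (cpsi : continuous psi) (cpsi1 : continuous psi1).
Hypothesis cpsi2 : continuous psi2.
Hypothesis dP1 : forall x y : R, c < y < d -> is_derive x 1 (fun x => P (x, y)) (p1 (x, y)).
Hypothesis dP2 : forall x y : R, c < y < d -> is_derive y 1 (fun y => P (x, y)) (p2 (x, y)).
Hypothesis dpsi1 : forall x y : R, c < y < d ->
  is_derive x 1 (fun x => psi (x, y)) (psi1 (x, y)).
Hypothesis dpsi2 : forall x y : R, c < y < d ->
  is_derive y 1 (fun y => psi (x, y)) (psi2 (x, y)).
Hypothesis psi_a : forall y, c < y < d -> psi (a, y) = 0.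
Hypothesis psi_b : forall y, c < y < d -> psi (b, y) = 0.

Notation mu := (@lebesgue_measure R).

(* Only p1, not its y-derivative, is available: the increment of p1 in y is the
   x-derivative of the increment of P, and is integrated by parts in x. *)
Lemma green_increment (y k : R) : c < y < d -> c < y + k < d -> k != 0 ->
  \int[mu]_(x in `[a, b]) (p1 (x, y + k) * diffq (fun t => psi (x, t)) (psi2 (x, y)) y k
     - psi1 (x, y) * diffq (fun t => P (x, t)) (p2 (x, y)) y k) =
  (\int[mu]_(x in `[a, b]) (psi (x, y + k) * p1 (x, y + k))
   - \int[mu]_(x in `[a, b]) (psi (x, y) * p1 (x, y))) / k.
Proof.
move=> yI ykI k0.
have cP t : c < t < d -> continuous (fun x => P (x, t)).
  by move=> tI x; exact: is_derive_cts (dP1 x tI).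
have cs := continuous_fst_slice.
rewrite -RintegralB//; [|by apply: continuous_itv_integrable => x;
  apply: cvgM; apply: cs..].
have := @Rintegration_by_partsT R (fun x => psi (x, y))
  (fun x => P (x, y + k) - P (x, y)) (fun x => psi1 (x, y))
  (fun x => p1 (x, y + k) - p1 (x, y)) a b ab.
rewrite psi_a// psi_b// !mul0r subrr sub0r => IBP.
have {}IBP : \int[mu]_(x in `[a, b]) (psi (x, y) * (p1 (x, y + k) - p1 (x, y))) =
    - \int[mu]_(x in `[a, b]) (psi1 (x, y) * (P (x, y + k) - P (x, y))).
  apply: IBP => [x||x|x].
  - exact: dpsi1.
  - exact: cs.
  - by apply: is_deriveB; exact: dP1.
  - by apply: cvgB; exact: cs.
rewrite -RintegralZr//; last first.
  apply: continuous_itv_integrable => x.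
  by apply: cvgB; apply: cvgM; apply: cs.
have -> : \int[mu]_(x in `[a, b]) ((psi (x, y + k) * p1 (x, y + k) - psi (x, y) * p1 (x, y)) / k) =
   \int[mu]_(x in `[a, b]) (p1 (x, y + k) * ((psi (x, y + k) - psi (x, y)) / k)) +
   \int[mu]_(x in `[a, b]) (psi (x, y) * (p1 (x, y + k) - p1 (x, y)) / k).
  rewrite -RintegralD//; last 2 first.
  - apply: continuous_itv_integrable => x; apply: cvgM; first exact: cs.
    by apply: cvgM; [apply: cvgB; exact: cs|exact: cvg_cst].
  - apply: continuous_itv_integrable => x; apply: cvgM; last exact: cvg_cst.
    by apply: cvgM; [exact: cs|apply: cvgB; exact: cs].
  by apply: eq_Rintegral => x _; field.
rewrite [X in _ = _ + X]RintegralZr//; last first.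
  apply: continuous_itv_integrable => x.
  by apply: cvgM; [exact: cs|apply: cvgB; exact: cs].
rewrite IBP mulNr -RintegralZr//; last first.
  apply: continuous_itv_integrable => x.
  by apply: cvgM; [exact: cs|apply: cvgB; exact: cP].
rewrite -RintegralB//; last 2 first.
- apply: continuous_itv_integrable => x; apply: cvgM; first exact: cs.
  by apply: cvgM; [apply: cvgB; exact: cs|exact: cvg_cst].
- apply: continuous_itv_integrable => x; apply: cvgM; last exact: cvg_cst.
  by apply: cvgM; [exact: cs|apply: cvgB; exact: cP].
by apply: eq_Rintegral => x _; rewrite /diffq (negbTE k0); field.
Qed.

(** Limit of [green_increment] as k tends to 0. The mixed second derivatives of P never appear,
    since the integration by parts in x was done at fixed k. *)
Lemma green_derive (y : R) : c < y < d ->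
  is_derive y 1 (fun y => \int[mu]_(x in `[a, b]) (psi (x, y) * p1 (x, y)))
    (\int[mu]_(x in `[a, b]) (p1 (x, y) * psi2 (x, y) - p2 (x, y) * psi1 (x, y))).
Proof.
move=> yI; have [e e0 [ec ed]] : exists2 e : R, 0 < e & e <= y - c /\ e <= d - y.
  exists (Num.min (y - c) (d - y)); first by rewrite lt_min; lra.
  by split; rewrite ge_min lexx ?orbT.
have eI k : - e < k < e -> c < y + k < d by move=> ?; lra.
have cs := continuous_fst_slice.
have cP t : c < t < d -> continuous (fun x => P (x, t)).
  by move=> tI x; exact: is_derive_cts (dP1 x tI).
(* At k = 0 the completed quotients make this the integrand of the claimed derivative. *)
pose I k x := p1 (x, y + k) * diffq (fun t => psi (x, t)) (psi2 (x, y)) y k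
     - psi1 (x, y) * diffq (fun t => P (x, t)) (p2 (x, y)) y k.
have cI k : - e < k < e -> continuous (fun x => I k x).
  move=> /eI kI x; rewrite /I /diffq; case: eqP => _.
    by apply: cvgB; apply: cvgM; exact: cs.
  apply: cvgB; apply: cvgM; try exact: cs.
    by apply: cvgM; [apply: cvgB; exact: cs|exact: cvg_cst].
  by apply: cvgM; [apply: cvgB; exact: cP|exact: cvg_cst].
have [B1 B10 HB1] := @box_bound R a b c d p1 cp1.
have [B2 B20 HB2] := @box_bound R a b c d p2 cp2.
have [B3 B30 HB3] := @box_bound R a b c d psi1 cpsi1.
have [B4 B40 HB4] := @box_bound R a b c d psi2 cpsi2.
have : {for 0, continuous (fun k => \int[mu]_(x in `[a, b]) I k x)}.
  have : (0 : R) \in (`]- e, e[%classic : set R).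
    by apply/mem_set; rewrite /= in_itv/=; lra.
  move: (0 : R); apply: (@continuity_under_integral R _ _ mu I `[a, b]%classic _
    (- e) e _ _ (cst (B1 * B4 + B3 * B2))) => //.
  - move=> k; rewrite /= in_itv/= => kI.
    by apply: continuous_itv_integrable; exact: cI.
  - apply: aeW => /= x xab k /set_mem; rewrite /= in_itv/= => kI; rewrite /I.
    have dq f df : is_derive y 1 f df -> {for y + k, continuous f} ->
        {for k, continuous (diffq f df y)}.
      move=> fd cf; have [->|k0] := eqVneq k 0; first exact: diffq_cvg0.
      exact: diffq_cvgN0.
    apply: cvgB; apply: cvgM.
    + apply: (@continuous_comp _ _ _ (fun k => y + k) (fun t => p1 (x, t))).
        by apply: cvgD; [exact: cvg_cst|exact: cvg_id].
      exact: continuous_snd_slice.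
    + by apply: dq; [exact: dpsi2|exact: continuous_snd_slice].
    + exact: cvg_cst.
    + by apply: dq; [exact: dP2|apply: is_derive_cts; apply: dP2; exact: eI].
  - by apply: continuous_itv_integrable; exact: cst_continuous.
  - move=> k; rewrite /= in_itv/= => /eI kI; apply: aeW => x.
    rewrite /= in_itv/= => xab; rewrite /I (le_trans (ler_normB _ _))// lerD//.
      rewrite normrM ler_pM//; first by apply: HB1 => //; lra.
      apply: (@diffq_bound R _ (fun t => psi2 (x, t)) c d y k B4 (fun t => @dpsi2 x t)) => // t tI.
      by apply: HB4 => //; lra.
    rewrite normrM ler_pM//; first by apply: HB3 => //; lra.
    apply: (@diffq_bound R _ (fun t => p2 (x, t)) c d y k B2 (fun t => @dP2 x t)) => // t tI.
    by apply: HB2 => //; lra.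
move=> /continuous_withinNx I0.
apply/is_derive1P.
have -> : \int[mu]_(x in `[a, b]) (p1 (x, y) * psi2 (x, y) - p2 (x, y) * psi1 (x, y)) =
    \int[mu]_(x in `[a, b]) I 0 x.
  by apply: eq_Rintegral => x _; rewrite /I /diffq eqxx addr0 (mulrC (psi1 _)).
apply: cvg_trans I0; apply: near_eq_cvg; near=> k.
apply: green_increment => //.
  apply: eI; near: k; apply: nbhs_dnbhs.
  by have : \forall k \near (0 : R), k \in `]- e, e[; [apply: near_in_itvoo; rewrite in_itv/=; lra|apply: filterS => k; rewrite in_itv].
near: k; exact: nbhs_dnbhs_neq.
Unshelve. all: by end_near. Qed.

(** Fundamental theorem of calculus in y for the slice integral of psi p1. Derivatives are known
    only for c < y < d, but the slice integral is continuous up to both ends. The vertical sides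
    contribute nothing because psi vanishes on them. *)
Theorem green : c < d ->
  \int[leb2 R]_(z in `[a, b] `*` `]c, d[) (p1 z * psi2 z - p2 z * psi1 z) =
  \int[mu]_(x in `[a, b]) (psi (x, d) * p1 (x, d))
  - \int[mu]_(x in `[a, b]) (psi (x, c) * p1 (x, c)).
Proof.
move=> cd; have cG : continuous (fun z => p1 z * psi2 z - p2 z * psi1 z).
  by move=> z; apply: cvgB; apply: cvgM; [exact: cp1|exact: cpsi2|exact: cp2|exact: cpsi1].
rewrite {1}/Rintegral box_fubini//; [|exact: measurable_itv..|
  by apply: box_integrable => //; exact: ltW].
pose g y := \int[mu]_(x in `[a, b]) (psi (x, y) * p1 (x, y)).
pose G y := \int[mu]_(x in `[a, b]) (p1 (x, y) * psi2 (x, y) - p2 (x, y) * psi1 (x, y)).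
have cg : continuous g.
  apply: (@continuous_slice_integral R (fun z => psi z * p1 z)) => z.
  by apply: cvgM; [exact: cpsi|exact: cp1].
have cGs : continuous G by exact: (@continuous_slice_integral R _ a b cG).
have mG (D : set (measurableTypeR R)) : measurable_fun D (EFin \o G).
  apply/measurable_EFinP; apply: measurable_funTS; exact: continuous_measurable_fun.
transitivity (fine (\int[mu]_(y in `[c, d]) (G y)%:E)).
  rewrite -integral_itv_obnd_cbnd; last exact: mG.
  rewrite -integral_itv_bndo_bndc; last exact: mG.
  congr fine; apply: eq_integral => y _; rewrite /G /Rintegral fineK//.
  apply: integrable_fin_num => //; apply: continuous_itv_integrable.
  exact: (continuous_fst_slice cG).
rewrite (@continuous_FTC2 R G g c d cd) //.
- exact: continuous_subspaceT.
- split; last 2 first.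
  + by apply: cvg_at_right_filter; exact: cg.
  + by apply: cvg_at_left_filter; exact: cg.
  move=> y; rewrite in_itv/= => yI; by have [] := green_derive yI.
- move=> y; rewrite in_itv/= => yI; rewrite derive1E; have := green_derive yI.
  by move=> h; exact: derive_val.
Qed.

End green.

(** * Dominated convergence and the two domains *)

Lemma Rdominated_convergence (d : measure_display) (T : measurableType d)
    (R : realType) (mu : {measure set T -> \bar R}) (A : set T)
    (f_ : (T -> R)^nat) (f g : T -> R) :
  measurable A ->
  (forall n, measurable_fun A (f_ n)) ->
  (forall x, A x -> f_ ^~ x @ \oo --> f x) ->
  mu.-integrable A (EFin \o g) ->
  (forall n x, A x -> `|f_ n x| <= g x) ->
  mu.-integrable A (EFin \o f) /\
  \int[mu]_(x in A) f_ n x @[n --> \oo] --> \int[mu]_(x in A) f x.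
Proof.
move=> mA mf_ cvf ig fg.
have mf : measurable_fun A f.
  by apply: (measurable_fun_cvg mf_).
have ifn n : mu.-integrable A (EFin \o f_ n).
  apply: (le_integrable mA _ _ ig); first exact/measurable_EFinP.
  by move=> x Ax /=; rewrite lee_fin (le_trans (fg n x Ax))// ler_norm.
have [|||||fi _ cvg] := @dominated_convergence _ _ _ mu A mA
  (fun n => EFin \o f_ n) (EFin \o f) (EFin \o g).
- by move=> n; apply/measurable_EFinP.
- exact/measurable_EFinP.
- by apply: aeW => x Ax; apply/cvg_EFin; [exact: nearW|exact: cvf].
- exact: ig.
- by apply: aeW => x n Ax; rewrite /= lee_fin; exact: fg.
by split=> //; apply: fine_cvg; rewrite fineK//; exact: integrable_fin_num.
Qed.

Section domains.
Context (R : realType).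
Implicit Types (D : flow_domain) (M : R).

Definition cdom D : set (R * R) :=
  match D with
  | Strip => [set z | -1 <= z.2 <= 1]
  | HalfPlane => [set z | 0 <= z.2]
  end.

Definition floor_of D : R := if D is Strip then -1 else 0.
(** The half-plane is truncated at height M, where test functions vanish; both domains then reduce
    to a rectangle. *)
Definition ceil_of D M : R := if D is Strip then 1 else M.

Definition box D M : set (R * R) := `[- M, M] `*` `]floor_of D, ceil_of D M[.

(** One condition serves both domains: in the strip the alternative [M <= z.2] is void once 1 < M.
    Nothing is asked on the walls. *)
Definition supp_in D M (g : R * R -> R) :=
  forall z, cdom D z -> M <= `|z.1| \/ M <= z.2 -> g z = 0.

Lemma floor_lt_ceil D M : 1 < M -> floor_of D < ceil_of D M.
Proof. by case: D => /= M1; lra. Qed.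

Lemma dom_cdom D : dom R D `<=` cdom D.
Proof. by case: D => -[x y] /=; lra. Qed.

Lemma wall_cdom D w x : w \in walls R D -> cdom D (x, w.1).
Proof.
by case: D => /=; rewrite !inE; [move=> /orP[]/eqP -> /=; lra|move=> /eqP -> /=; lra].
Qed.

Lemma box_dom D M : box D M `<=` dom R D.
Proof. by case: D => /= z [_]; rewrite /= in_itv/= => // /andP[]. Qed.

Lemma dom_notbox D M z : 1 < M -> dom R D z -> ~ box D M z ->
  M <= `|z.1| \/ M <= z.2.
Proof.
move=> M1 Dz nb; apply: contrapT => /not_orP[/negP + /negP]; rewrite -!ltNge => z1 z2.
apply: nb; move: z1; rewrite ltr_norml => z1; split; rewrite /= in_itv/=; first lra.
by case: D Dz => //= ->.
Qed.

Lemma measurable_dom D :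
  measurable (dom R D : set (measurableTypeR R * measurableTypeR R)).
Proof.
have mX (I : interval R) : measurable ([set z | z.2 \in I] :
    set (measurableTypeR R * measurableTypeR R)).
  rewrite (_ : [set _ | _] = setT `*` [set` I]); last by apply/seteqP; split=> z //= [].
  by apply: measurableX => //; exact: measurable_itv.
case: D => /=.
  by rewrite (_ : mkset _ = [set z | z.2 \in `]-1, 1[%R]).
rewrite (_ : mkset _ = [set z | z.2 \in `]0, +oo[%R])//.
by apply/seteqP; split => z; rewrite /= in_itv/= andbT.
Qed.

Lemma measurable_box D M :
  measurable (box D M : set (measurableTypeR R * measurableTypeR R)).
Proof. exact: measurable_itvX. Qed.

Lemma supp_box D M g : 1 < M -> supp_in D M g -> g \_ (dom R D) = g \_ (box D M).
Proof.
move=> M1 sg; apply/funext => z; rewrite /patch.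
case: ifPn => [/set_mem zD|/negP zD]; case: ifPn => [/set_mem zB|/negP zB]//.
  apply: sg; first exact: dom_cdom.
  by apply: (dom_notbox M1 zD) => zB'; apply: zB; exact/mem_set.
by exfalso; apply: zD; apply/mem_set/(box_dom zB).
Qed.

Lemma supp_Rintegral D M g : 1 < M -> supp_in D M g ->
  \int[leb2 R]_(z in dom R D) g z = \int[leb2 R]_(z in box D M) g z.
Proof.
by move=> M1 sg; rewrite Rintegral_mkcond [RHS]Rintegral_mkcond (supp_box M1 sg).
Qed.

Lemma supp_integrable D M g : 1 < M -> supp_in D M g ->
  (leb2 R).-integrable (box D M) (EFin \o g) ->
  (leb2 R).-integrable (dom R D) (EFin \o g).
Proof.
move=> M1 sg /(integrable_mkcond _ (measurable_box _ _)) h.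
apply/(integrable_mkcond _ (measurable_dom _)); move: h.
by rewrite !restrict_EFin (supp_box M1 sg).
Qed.

Lemma supp_cts_integrable D M g : 1 < M -> supp_in D M g -> continuous g ->
  (leb2 R).-integrable (dom R D) (EFin \o g).
Proof.
move=> M1 sg cg; apply: (supp_integrable M1 sg); apply: box_integrable => //; first lra.
by apply: ltW; exact: floor_lt_ceil.
Qed.

End domains.

(* The components of v together with their partial derivatives, all extended
   continuously to the whole plane: a_i, b_i are the i-th partials of v_1, v_2.
   By v_cdom the extension of v takes no new values. *)
Record flow (R : realType) (D : flow_domain) := Flow {
  v1 : R * R -> R; v2 : R * R -> R;
  a1 : R * R -> R; a2 : R * R -> R; b1 : R * R -> R; b2 : R * R -> R;
  pr : R * R -> R;
  cv1 : continuous v1; cv2 : continuous v2;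
  ca1 : continuous a1; ca2 : continuous a2;
  cb1 : continuous b1; cb2 : continuous b2;
  dv11 : forall x y : R, dom R D (x, y) -> is_derive x 1 (fun x => v1 (x, y)) (a1 (x, y));
  dv12 : forall x y : R, dom R D (x, y) -> is_derive y 1 (fun y => v1 (x, y)) (a2 (x, y));
  dv21 : forall x y : R, dom R D (x, y) -> is_derive x 1 (fun x => v2 (x, y)) (b1 (x, y));
  dv22 : forall x y : R, dom R D (x, y) -> is_derive y 1 (fun y => v2 (x, y)) (b2 (x, y));
  dpr1 : forall x y : R, dom R D (x, y) -> is_derive x 1 (fun x => pr (x, y))
    (v1 (x, y) * b2 (x, y) - v2 (x, y) * a2 (x, y));
  dpr2 : forall x y : R, dom R D (x, y) -> is_derive y 1 (fun y => pr (x, y))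
    (- (v1 (x, y) * b1 (x, y) - v2 (x, y) * a1 (x, y)));
  divfree : forall z, b2 z = - a1 z;
  v2_wall : forall w x, w \in walls R D -> v2 (x, w.1) = 0;
  v_cdom : forall z, exists2 z', cdom D z' & v1 z = v1 z' /\ v2 z = v2 z'
}.

Lemma cvg_sum_seq (R : realType) (I : eqType) (s : seq I) (T : Type)
    (F : set_system T) (f : I -> T -> R) (l : I -> R) : Filter F ->
  (forall i, i \in s -> f i @ F --> l i) ->
  (fun t => \sum_(i <- s) f i t) @ F --> \sum_(i <- s) l i.
Proof.
move=> FF; elim: s => [_|i s IH fl].
  by under eq_fun do rewrite big_nil; rewrite big_nil; exact: cvg_cst.
under eq_fun do rewrite big_cons; rewrite big_cons.
apply: cvgD; first by apply: fl; rewrite mem_head.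
by apply: IH => j js; apply: fl; rewrite inE js orbT.
Qed.

(** The outer normals are the signs of top minus bottom in Green's formula. For the half-plane the
    top edge is artificial, hence the assumption that its term vanishes. *)
Lemma sum_walls (R : realType) (D : flow_domain) (M : R) (J : R -> R) :
  (D = HalfPlane -> J M = 0) ->
  \sum_(w <- walls R D) w.2 * J w.1 = J (ceil_of D M) - J (floor_of R D).
Proof.
case: D => [_|/(_ erefl) JM] /=; first by rewrite big_cons big_seq1 /= mul1r mulN1r addrC.
by rewrite big_seq1 /= JM mulN1r sub0r.
Qed.

(** * Testing the divergence-free field *)

Section flow_green.
Context (R : realType) (D : flow_domain) (f : flow R D).

Notation mu := (@lebesgue_measure R).

(* F = v_1 grad v_2 - v_2 grad v_1, which is grad^perp of the pressure. *)
Definition F1 z := v1 f z * b1 f z - v2 f z * a1 f z.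
Definition F2 z := v1 f z * b2 f z - v2 f z * a2 f z.

Lemma cF1 : continuous F1.
Proof.
by move=> z; apply: cvgB; apply: cvgM; [exact: cv1|exact: cb1|exact: cv2|exact: ca1].
Qed.

Lemma cF2 : continuous F2.
Proof.
by move=> z; apply: cvgB; apply: cvgM; [exact: cv1|exact: cb2|exact: cv2|exact: ca2].
Qed.

(** C^1 functions supported away from the lateral sides and the artificial top, but free on the
    walls, whose contributions are the object of study. *)
Record test_fun (M : R) := TestFun {
  tf : R * R -> R; tf1 : R * R -> R; tf2 : R * R -> R;
  ctf : continuous tf; ctf1 : continuous tf1; ctf2 : continuous tf2;
  dtf1 : forall x y : R, dom R D (x, y) -> is_derive x 1 (fun x => tf (x, y)) (tf1 (x, y));
  dtf2 : forall x y : R, dom R D (x, y) -> is_derive y 1 (fun y => tf (x, y)) (tf2 (x, y));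
  tf_supp : supp_in D M tf; tf1_supp : supp_in D M tf1; tf2_supp : supp_in D M tf2
}.

Lemma slice_setT (M : R) (g : R -> R) :
  (forall x, M <= `|x| -> g x = 0) ->
  \int[mu]_x g x = \int[mu]_(x in `[- M, M]) g x.
Proof.
move=> g0; rewrite [RHS]Rintegral_mkcond; apply: eq_Rintegral => x _.
rewrite /patch; case: ifPn => // /negP xM; apply: g0.
by rewrite leNgt ltr_norml; apply/negP => xM'; apply: xM; apply/mem_set; rewrite /= in_itv/=; lra.
Qed.

(** The pressure has gradient (F2, -F1), so [green] applies with [p1] = F2 and [p2] = -F1; only the
    horizontal edges that are walls survive. *)
Lemma flow_green (M : R) (t : test_fun M) : 1 < M ->
  \int[leb2 R]_(z in dom R D) (F1 z * tf1 t z + F2 z * tf2 t z) =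
  \sum_(w <- walls R D) \int[mu]_x (tf t (x, w.1) * (w.2 * F2 (x, w.1))).
Proof.
move=> M1.
rewrite (@supp_Rintegral R D M)//; last first.
  by move=> z Dz h; rewrite (tf1_supp _ Dz h) (tf2_supp _ Dz h) !mulr0 addr0.
have cd := @floor_lt_ceil R D M M1.
have Dy (x y : R) : floor_of R D < y < ceil_of D M -> dom R D (x, y).
  by case: D => //= /andP[].
have MM : - M < M by lra.
have nM : `|- M| = M by rewrite normrN gtr0_norm//; lra.
have pM : `|M| = M by rewrite gtr0_norm//; lra.
have := @green R (pr f) F2 (fun z => - F1 z) (tf t) (tf1 t) (tf2 t) (- M) M
  (floor_of R D) (ceil_of D M) MM cF2 _ (@ctf _ t) (@ctf1 _ t) (@ctf2 _ t)
  (fun x y h => dpr1 f (Dy x y h)) (fun x y h => dpr2 f (Dy x y h))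
  (fun x y h => dtf1 t (Dy x y h)) (fun x y h => dtf2 t (Dy x y h)) _ _ cd.
under eq_Rintegral do rewrite mulNr opprK addrC.
move=> ->; last 3 first.
- by move=> z; apply: cvgN; exact: cF1.
- by move=> y h; apply: (tf_supp t (dom_cdom (Dy _ y h))); left; rewrite /= nM.
- by move=> y h; apply: (tf_supp t (dom_cdom (Dy _ y h))); left; rewrite /= pM.
have t0 w x : w \in walls R D -> M <= `|x| -> tf t (x, w.1) * (w.2 * F2 (x, w.1)) = 0.
  by move=> wD xM; rewrite (tf_supp t (wall_cdom x wD)) ?mul0r//; left.
have iwall (y k : R) : \int[mu]_(x in `[- M, M]) (tf t (x, y) * (k * F2 (x, y))) =
   k * \int[mu]_(x in `[- M, M]) (tf t (x, y) * F2 (x, y)).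
  rewrite -RintegralZl//; first by apply: eq_Rintegral => x _; rewrite mulrCA.
  apply: continuous_itv_integrable.
  apply: (@continuous_fst_slice R (fun z => tf t z * F2 z)) => z.
  by apply: cvgM; [exact: ctf|exact: cF2].
pose J y := \int[mu]_(x in `[- M, M]) (tf t (x, y) * F2 (x, y)).
rewrite -/(J (ceil_of D M)) -/(J (floor_of R D)) -(@sum_walls R D M J).
  by apply: eq_big_seq => w wD; rewrite (@slice_setT M) ?iwall// => x; exact: t0.
move=> DH; rewrite /J; under eq_Rintegral.
  move=> x _; rewrite (tf_supp t) ?mul0r.
  - over.
  - by rewrite DH /=; lra.
  - by right.
by rewrite Rintegral_cst// mul0r.
Qed.

(** The product rule separates the main term, with the gradient of H, from the error, with the
    gradient of the cutoff. H need not have compact support. *)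
Lemma test_mul_green (M : R) (t : test_fun M) (H H1 H2 : R * R -> R) : 1 < M ->
  continuous H -> continuous H1 -> continuous H2 ->
  (forall x y : R, dom R D (x, y) -> is_derive x 1 (fun x => H (x, y)) (H1 (x, y))) ->
  (forall x y : R, dom R D (x, y) -> is_derive y 1 (fun y => H (x, y)) (H2 (x, y))) ->
  \int[leb2 R]_(z in dom R D) (tf t z * (F1 z * H1 z + F2 z * H2 z))
  + \int[leb2 R]_(z in dom R D) ((F1 z * tf1 t z + F2 z * tf2 t z) * H z) =
  \sum_(w <- walls R D) \int[mu]_x (tf t (x, w.1) * (w.2 * (H (x, w.1) * F2 (x, w.1)))).
Proof.
move=> M1 cH cH1 cH2 dH1 dH2.
have ct z : {for z, continuous (tf t)} := @ctf M t z.
have ct1 z : {for z, continuous (tf1 t)} := @ctf1 M t z.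
have ct2 z : {for z, continuous (tf2 t)} := @ctf2 M t z.
have s := tf_supp t; have s1 := tf1_supp t; have s2 := tf2_supp t.
pose tH := @TestFun M (fun z => tf t z * H z)
  (fun z => tf t z * H1 z + tf1 t z * H z) (fun z => tf t z * H2 z + tf2 t z * H z).
have {}tH : {u : test_fun M | [/\ tf u = (fun z => tf t z * H z),
    tf1 u = (fun z => tf t z * H1 z + tf1 t z * H z) &
    tf2 u = (fun z => tf t z * H2 z + tf2 t z * H z)]}.
  unshelve eexists; first apply: tH.
  - by move=> z; apply: cvgM; [exact: ct|exact: cH].
  - by move=> z; apply: cvgD; apply: cvgM; [exact: ct|exact: cH1|exact: ct1|exact: cH].
  - by move=> z; apply: cvgD; apply: cvgM; [exact: ct|exact: cH2|exact: ct2|exact: cH].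
  - move=> x y xy; have := is_deriveM (dtf1 t xy) (dH1 x y xy).
    by rewrite /GRing.scale /= (mulrC (H _)).
  - move=> x y xy; have := is_deriveM (dtf2 t xy) (dH2 x y xy).
    by rewrite /GRing.scale /= (mulrC (H _)).
  - by move=> z Dz h; rewrite s// mul0r.
  - by move=> z Dz h; rewrite s// s1// !mul0r addr0.
  - by move=> z Dz h; rewrite s// s2// !mul0r addr0.
  - by [].
have [u [u0 u1 u2]] := tH.
have := flow_green u M1; rewrite u0 u1 u2 => E.
rewrite -RintegralD; last 3 first.
- exact: measurable_dom.
- apply: (supp_cts_integrable M1) => z; first by move=> Dz h; rewrite s// mul0r.
  apply: cvgM; first exact: ct.
  by apply: cvgD; apply: cvgM; [exact: cF1|exact: cH1|exact: cF2|exact: cH2].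
- apply: (supp_cts_integrable M1) => z.
    by move=> Dz h; rewrite s1// s2// !mulr0 addr0 mul0r.
  apply: cvgM; last exact: cH.
  by apply: cvgD; apply: cvgM; [exact: cF1|exact: ct1|exact: cF2|exact: ct2].
transitivity (\sum_(w <- walls R D)
  \int[mu]_x (tf t (x, w.1) * H (x, w.1) * (w.2 * F2 (x, w.1)))).
  by rewrite -E; apply: eq_Rintegral => z _; ring.
by apply: eq_bigr => w _; apply: eq_Rintegral => x _; ring.
Qed.

Lemma integrable_dot (M : R) (t : test_fun M) : 1 < M ->
  (leb2 R).-integrable (dom R D) (EFin \o (fun z => `|F1 z * tf1 t z + F2 z * tf2 t z|)).
Proof.
move=> M1; apply: (supp_cts_integrable M1) => z.
  by move=> Dz h; rewrite (tf1_supp _ Dz h) (tf2_supp _ Dz h) !mulr0 addr0 normr0.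
apply: cvg_norm.
by apply: cvgD; apply: cvgM; [exact: cF1|exact: ctf1|exact: cF2|exact: ctf2].
Qed.

(** The H_n may approximate a discontinuous function: the error is bounded by K times the integral
    of |F . grad phi| for every n, while the interior and wall terms pass to the limit by dominated
    convergence. The bound [G] need only be continuous, since the cutoff confines everything to a
    box. *)
Lemma test_limit (M : R) (t : test_fun M) (H H1 H2 : nat -> R * R -> R) (K : R)
    (L G : R * R -> R) (Bd : R -> R -> R) : 1 < M ->
  (forall n, continuous (H n)) -> (forall n, continuous (H1 n)) ->
  (forall n, continuous (H2 n)) ->
  (forall n (x y : R), dom R D (x, y) ->
    is_derive x 1 (fun x => H n (x, y)) (H1 n (x, y))) ->
  (forall n (x y : R), dom R D (x, y) ->
    is_derive y 1 (fun y => H n (x, y)) (H2 n (x, y))) ->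
  (forall n z, cdom D z -> `|H n z| <= K) ->
  (forall z, dom R D z -> (F1 z * H1 n z + F2 z * H2 n z) @[n --> \oo] --> L z) ->
  continuous G ->
  (forall n z, dom R D z -> `|F1 z * H1 n z + F2 z * H2 n z| <= G z) ->
  (forall w x, w \in walls R D ->
    (H n (x, w.1) * F2 (x, w.1)) @[n --> \oo] --> Bd w.1 x) ->
  (leb2 R).-integrable (dom R D) (EFin \o (fun z => tf t z * L z)) /\
  `|\int[leb2 R]_(z in dom R D) (tf t z * L z)
    - \sum_(w <- walls R D) \int[mu]_x (tf t (x, w.1) * (w.2 * Bd w.1 x))|
  <= K * \int[leb2 R]_(z in dom R D) `|F1 z * tf1 t z + F2 z * tf2 t z|.
Proof.
move=> M1 cH cH1 cH2 dH1 dH2 HK HL cG HG HB.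
have ct z : {for z, continuous (tf t)} := @ctf M t z.
have ct1 z : {for z, continuous (tf1 t)} := @ctf1 M t z.
have ct2 z : {for z, continuous (tf2 t)} := @ctf2 M t z.
have s := tf_supp t; have s1 := tf1_supp t; have s2 := tf2_supp t.
pose Ld n z := F1 z * H1 n z + F2 z * H2 n z.
have cLd n : continuous (Ld n).
  by move=> z; apply: cvgD; apply: cvgM; [exact: cF1|exact: cH1|exact: cF2|exact: cH2].
have [||||| iL cvL] := @Rdominated_convergence _ _ R (leb2 R) (dom R D)
  (fun n z => tf t z * Ld n z) (fun z => tf t z * L z) (fun z => `|tf t z| * G z).
- exact: measurable_dom.
- move=> n; apply: measurable_funTS; apply: continuous_measurable2 => z.
  by apply: cvgM; [exact: ct|exact: cLd].
- by move=> z Dz; apply: cvgM; [exact: cvg_cst|exact: HL].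
- apply: (supp_cts_integrable M1) => z; first by move=> Dz h; rewrite s// normr0 mul0r.
  by apply: cvgM; [apply: cvg_norm; exact: ct|exact: cG].
- by move=> n z Dz; rewrite normrM ler_wpM2l// HG.
split=> //.
have cvB : \sum_(w <- walls R D) \int[mu]_x (tf t (x, w.1) * (w.2 * (H n (x, w.1) * F2 (x, w.1))))
   @[n --> \oo] --> \sum_(w <- walls R D) \int[mu]_x (tf t (x, w.1) * (w.2 * Bd w.1 x)).
  apply: cvg_sum_seq => w wD.
  have sw x : M <= `|x| -> tf t (x, w.1) = 0.
    by move=> h; apply: s; [exact: wall_cdom|left].
  rewrite (@slice_setT M); last by move=> x h; rewrite sw// mul0r.
  rewrite [X in X @ _](_ : _ = fun n => \int[mu]_(x in `[- M, M])
      (tf t (x, w.1) * (w.2 * (H n (x, w.1) * F2 (x, w.1))))); last first.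
    by apply/funext => n; rewrite (@slice_setT M)// => x h; rewrite sw// mul0r.
  have cs := continuous_fst_slice.
  have [] := @Rdominated_convergence _ _ R mu `[- M, M]%classic
    (fun n x => tf t (x, w.1) * (w.2 * (H n (x, w.1) * F2 (x, w.1))))
    (fun x => tf t (x, w.1) * (w.2 * Bd w.1 x))
    (fun x => `|tf t (x, w.1)| * (`|w.2| * (K * `|F2 (x, w.1)|))) => //.
  - move=> n; apply: measurable_funTS; apply: continuous_measurable_fun.
    apply: (cs _ (fun z => tf t z * (w.2 * (H n z * F2 z)))) => z.
    apply: cvgM; first exact: ct.
    by apply: cvgM; [exact: cvg_cst|apply: cvgM; [exact: cH|exact: cF2]].
  - move=> x _; apply: cvgM; first exact: cvg_cst.
    by apply: cvgM; [exact: cvg_cst|exact: HB].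
  - apply: continuous_itv_integrable.
    apply: (cs _ (fun z => `|tf t z| * (`|w.2| * (K * `|F2 z|)))) => z.
    apply: cvgM; first by apply: cvg_norm; exact: ct.
    apply: cvgM; first exact: cvg_cst.
    by apply: cvgM; [exact: cvg_cst|apply: cvg_norm; exact: cF2].
  - move=> n x _; rewrite !normrM; do 2 apply: ler_wpM2l => //.
    by apply: ler_wpM2r => //; apply: HK; exact: wall_cdom.
apply: (cvgr_to_le (cvg_norm (cvgB cvL cvB))); apply: nearW => n /=.
have := test_mul_green t M1 (cH n) (cH1 n) (cH2 n) (dH1 n) (dH2 n).
move=> E; rewrite !fctE -E opprD addrA addrN add0r normrN.
have cE : continuous (fun z => F1 z * tf1 t z + F2 z * tf2 t z).
  by move=> z; apply: cvgD; apply: cvgM; [exact: cF1|exact: ct1|exact: cF2|exact: ct2].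
have sE : supp_in D M (fun z => F1 z * tf1 t z + F2 z * tf2 t z).
  by move=> z Dz h; rewrite s1// s2// !mulr0 addr0.
rewrite (le_trans (le_normr_Rintegral _ _))//; [exact: measurable_dom| |].
  apply: (supp_cts_integrable M1); first by move=> z Dz h; rewrite sE// mul0r.
  by move=> z; apply: cvgM; [exact: cE|exact: cH].
rewrite -RintegralZl; [|exact: measurable_dom|]; last first.
  exact: integrable_dot.
apply: le_Rintegral; [exact: measurable_dom| | |].
- apply: (supp_cts_integrable M1); first by move=> z Dz h; rewrite sE// mul0r normr0.
  by move=> z; apply: cvg_norm; apply: cvgM; [exact: cE|exact: cH].
- apply: (supp_cts_integrable M1); first by move=> z Dz h; rewrite sE// normr0 mulr0.
  by move=> z; apply: cvgM; [exact: cvg_cst|apply: cvg_norm; exact: cE].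
- by move=> z Dz; rewrite normrM mulrC ler_wpM2r// HK//; exact: dom_cdom.
Qed.

End flow_green.

(** * The regularized unoriented angle *)

Section angle.
Context (R : realType).
Implicit Types (u w e : R).

Definition reg (e w : R) : R := Num.sqrt (w ^+ 2 + e ^+ 2).

Lemma reg_gt0 e w : 0 < e -> 0 < reg e w.
Proof. by move=> e0; rewrite sqrtr_gt0 ltr_wpDl ?sqr_ge0// exprn_gt0. Qed.

Lemma sqr_reg e w : (reg e w) ^+ 2 = w ^+ 2 + e ^+ 2.
Proof. by rewrite sqr_sqrtr// addr_ge0// sqr_ge0. Qed.

Lemma ler_reg e w : `|w| <= reg e w.
Proof. by rewrite -sqrtr_sqr; apply: ler_wsqrtr; rewrite lerDl sqr_ge0. Qed.

Lemma ler_eps_reg e w : 0 < e -> e <= reg e w.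
Proof.
move=> e0; rewrite -[leLHS]gtr0_norm// -sqrtr_sqr.
by apply: ler_wsqrtr; rewrite lerDr sqr_ge0.
Qed.

(* A smoothing of theta - pi/2 for the unoriented angle theta in [0, pi] between
   (u, w) and the positive first axis. *)
Definition fold_angle e u w : R := - atan (u / reg e w).

Definition dfold_angle e u w du dw : R :=
  (u * w * dw - (w ^+ 2 + e ^+ 2) * du) / (reg e w * (u ^+ 2 + w ^+ 2 + e ^+ 2)).

Lemma is_derive_fold_angle e (u w : R -> R) (t du dw : R) : 0 < e ->
  is_derive t 1 u du -> is_derive t 1 w dw ->
  is_derive t 1 (fun t => fold_angle e (u t) (w t)) (dfold_angle e (u t) (w t) du dw).
Proof.
move=> e0 du' dw'; have s0 := reg_gt0 (w t) e0; have s2 := sqr_reg e (w t).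
have H1 : is_derive t 1 (fun t => w t ^+ 2 + e ^+ 2) (2 * w t * dw).
  have -> : (fun t => w t ^+ 2 + e ^+ 2) = (w \* w \+ cst (e ^+ 2)).
    by apply/funext => x /=; rewrite expr2.
  have := is_deriveD (is_deriveM dw' dw') (is_derive_cst (e ^+ 2) t 1).
  by move/is_derive_eq; apply; rewrite /GRing.scale /=; ring.
have p0 : 0 < w t ^+ 2 + e ^+ 2 by rewrite -s2 exprn_gt0.
have H2 := @is_derive1_comp R Num.sqrt (fun t => w t ^+ 2 + e ^+ 2) t _ _
  (is_derive1_sqrt p0) H1.
have H3 := @is_deriveV R (fun t => reg e (w t)) t _ _ (lt0r_neq0 s0) H2.
have H4 := is_deriveN (@is_derive1_comp R atan (fun t => u t * (reg e (w t))^-1) t _ _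
  (is_derive1_atan _) (is_deriveM du' H3)).
apply: (is_derive_eq H4); rewrite /dfold_angle /GRing.scale /= -/(reg e (w t)) -s2.
have m0 : u t ^+ 2 + w t ^+ 2 + e ^+ 2 != 0.
  by rewrite -addrA -s2 lt0r_neq0// ltr_wpDl ?sqr_ge0// exprn_gt0.
have m1 : reg e (w t) ^+ 2 + u t ^+ 2 != 0.
  by rewrite lt0r_neq0// ltr_wpDr ?sqr_ge0// exprn_gt0.
have -> : u t ^+ 2 + w t ^+ 2 + e ^+ 2 = reg e (w t) ^+ 2 + u t ^+ 2 by rewrite s2; ring.
by field; rewrite m1 lt0r_neq0.
Qed.

Lemma fold_angle_le e u w : `|fold_angle e u w| <= pi / 2.
Proof.
by rewrite normrN ler_norml ltW ?atan_gtNpi2//= ltW// atan_ltpi2.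
Qed.

Lemma eps_cvg0 : (fun n => n.+1%:R^-1 : R) @ \oo --> 0.
Proof. exact: cvg_harmonic. Qed.

Lemma eps2_cvg0 : (fun n => n.+1%:R^-1 ^+ 2 : R) @ \oo --> 0.
Proof.
have := cvgM eps_cvg0 eps_cvg0; rewrite mulr0 => h.
by under eq_fun do rewrite expr2; exact: h.
Qed.

Lemma eps_gt0 n : 0 < n.+1%:R^-1 :> R.
Proof. by rewrite invr_gt0 ltr0n. Qed.

(** Lagrange's identity: what is missing on the left is the square of half the gradient of |v|^2. *)
Lemma flux_sqr_le (u w a1 a2 b1 b2 : R) :
  (u * b1 - w * a1) ^+ 2 + (u * b2 - w * a2) ^+ 2 <=
  (u ^+ 2 + w ^+ 2) * (a1 ^+ 2 + a2 ^+ 2 + b1 ^+ 2 + b2 ^+ 2).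
Proof.
rewrite -subr_ge0 (_ : _ - _ = (u * a1 + w * b1) ^+ 2 + (u * a2 + w * b2) ^+ 2); last by ring.
by rewrite addr_ge0// sqr_ge0.
Qed.

(** The factor e pays for growth that is only linear in |v|: (e - 2|u|)^2 >= 0 gives e|u| <= u^2 +
    e^2/4, and likewise for w. *)
Lemma flux_dot_le (e u w x y z g : R) : 0 < e -> 0 <= g -> `|x| <= g -> `|y| <= g ->
  `|z| <= 1 -> e * `|(u * x - w * y) * z| <= (u ^+ 2 + w ^+ 2 + e ^+ 2) * g.
Proof.
move=> e0 g0 xg yg z1.
have H : `|(u * x - w * y) * z| <= (`|u| + `|w|) * g.
  rewrite normrM -[leRHS]mulr1 ler_pM// (le_trans (ler_normB _ _))// mulrDl.
  by rewrite !normrM lerD// ler_wpM2l.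
apply: (@le_trans _ _ (e * ((`|u| + `|w|) * g))); first by rewrite ler_wpM2l// ltW.
rewrite mulrA ler_wpM2r// -(real_normK (num_real u)) -(real_normK (num_real w)).
have := normr_ge0 u; have := normr_ge0 w; move: `|u| `|w| => U W ? ?.
have : 0 <= (e - 2 * U) ^+ 2 by exact: sqr_ge0.
have : 0 <= (e - 2 * W) ^+ 2 by exact: sqr_ge0.
nra.
Qed.

(** The numerator of [dfold_angle] is w f_i - e^2 a_i. Formally, as e tends to 0, the gradient of
    the folded angle is sgn(w) F / |v|^2. *)
Lemma dfold_dot (e u w a1 a2 b1 b2 : R) : 0 < e ->
  let f1 := u * b1 - w * a1 in let f2 := u * b2 - w * a2 in
  f1 * dfold_angle e u w a1 b1 + f2 * dfold_angle e u w a2 b2 =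
  (w * (f1 ^+ 2 + f2 ^+ 2) - e ^+ 2 * (f1 * a1 + f2 * a2)) /
    (reg e w * (u ^+ 2 + w ^+ 2 + e ^+ 2)).
Proof.
move=> e0 f1 f2; rewrite /dfold_angle /f1 /f2.
have s0 : reg e w != 0 by rewrite lt0r_neq0// reg_gt0.
have m0 : u ^+ 2 + w ^+ 2 + e ^+ 2 != 0.
  by rewrite lt0r_neq0// ltr_wpDl ?exprn_gt0// addr_ge0// sqr_ge0.
by field; rewrite m0.
Qed.

(** A domination uniform in e. The term w |F|^2 costs |grad v|^2 once, by [flux_sqr_le] and |w| <=
    [reg]; the term with e^2 costs it twice, by e <= [reg] and [flux_dot_le] applied to each of the
    two partial derivatives. *)
Lemma dfold_dot_le (e u w a1 a2 b1 b2 : R) : 0 < e ->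
  `|(u * b1 - w * a1) * dfold_angle e u w a1 b1 + (u * b2 - w * a2) * dfold_angle e u w a2 b2|
  <= 3 * (a1 ^+ 2 + a2 ^+ 2 + b1 ^+ 2 + b2 ^+ 2).
Proof.
move=> e0; rewrite dfold_dot//; set g := (X in _ <= _ * X).
set FF := _ ^+ 2 + _ ^+ 2; set Fa := _ * a1 + _ * a2.
have s0 := reg_gt0 w e0; set s := reg e w in s0 *.
set m := u ^+ 2 + w ^+ 2.
have g0 : 0 <= g by rewrite !addr_ge0// sqr_ge0.
have m0 : 0 <= m by rewrite addr_ge0// sqr_ge0.
have FF0 : 0 <= FF by rewrite addr_ge0// sqr_ge0.
have FFg : FF <= m * g by exact: flux_sqr_le.
have me : 0 < m + e ^+ 2 by rewrite ltr_wpDl// exprn_gt0.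
rewrite normrM normfV (gtr0_norm (mulr_gt0 s0 me)) ler_pdivrMr ?mulr_gt0//.
have ws : `|w| <= s by exact: ler_reg.
have es : e <= s by exact: ler_eps_reg.
have E1 : `|w * FF| <= s * ((m + e ^+ 2) * g).
  rewrite normrM (ger0_norm FF0) ler_pM// (le_trans FFg)// ler_wpM2r// lerDl sqr_ge0//.
have E2 : `|e ^+ 2 * Fa| <= s * (2 * ((m + e ^+ 2) * g)).
  rewrite expr2 -mulrA normrM gtr0_norm// ler_pM//; first exact: ltW.
  rewrite normrM gtr0_norm//.
  have H (i j : R) : j ^+ 2 <= g -> i ^+ 2 + j ^+ 2 <= g -> `|i * j| <= g.
    move=> jg ijg; rewrite ler_norml; apply/andP; split.
      have : 0 <= (i + j) ^+ 2 by exact: sqr_ge0.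
      by have := sqr_ge0 i; have := sqr_ge0 j; nra.
    have : 0 <= (i - j) ^+ 2 by exact: sqr_ge0.
    by have := sqr_ge0 i; have := sqr_ge0 j; nra.
  have [A1 A2 A3 A4] := And4 (sqr_ge0 a1) (sqr_ge0 a2) (sqr_ge0 b1) (sqr_ge0 b2).
  apply: (@le_trans _ _ (e * `|(u * (b1 * a1) - w * (a1 * a1)) * 1| +
                         e * `|(u * (b2 * a2) - w * (a2 * a2)) * 1|)).
    rewrite -mulrDr ler_wpM2l//; first exact: ltW.
    apply: le_trans (ler_normD _ _).
    by rewrite le_eqVlt; apply/orP; left; apply/eqP; congr `|_|; rewrite /Fa; ring.
  rewrite mulr_natl mulr2n lerD// flux_dot_le// ?normr1//.
  - by apply: H; rewrite /g; lra.
  - by rewrite -expr2 ger0_norm ?sqr_ge0// /g; lra.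
  - by apply: H; rewrite /g; lra.
  - by rewrite -expr2 ger0_norm ?sqr_ge0// /g; lra.
apply: (le_trans (ler_normB _ _)); apply: (le_trans (lerD E1 E2)).
by rewrite le_eqVlt; apply/orP; left; apply/eqP; ring.
Qed.

(** For w = 0 the limit must be 0, in accordance with sgn(0) = 0: there [reg] equals e, so the
    remaining term is of order e when u is nonzero, and F vanishes when u = 0 too. *)
Lemma dfold_dot_cvg (u w a1 a2 b1 b2 : R) :
  let f1 := u * b1 - w * a1 in let f2 := u * b2 - w * a2 in
  (fun n : nat => f1 * dfold_angle n.+1%:R^-1 u w a1 b1 + f2 * dfold_angle n.+1%:R^-1 u w a2 b2)
    @ \oo --> Num.sg w * ((f1 ^+ 2 + f2 ^+ 2) / (u ^+ 2 + w ^+ 2)).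
Proof.
move=> f1 f2; have E n := @dfold_dot n.+1%:R^-1 u w a1 a2 b1 b2 (eps_gt0 n).
under eq_fun do rewrite E; rewrite -/f1 -/f2 {E}.
set FF := _ ^+ 2 + _ ^+ 2; set Fa := _ * a1 + _ * a2; set m := u ^+ 2 + w ^+ 2.
have cvE2 := eps2_cvg0.
have cvS (c : R) : (fun n : nat => c + n.+1%:R^-1 ^+ 2 : R) @ \oo --> c.
  by rewrite -[X in _ --> X]addr0; apply: cvgD; [exact: cvg_cst|].
have [w0|w0] := eqVneq w 0; last first.
  have m0 : m != 0 by rewrite /m lt0r_neq0// ltr_wpDl ?sqr_ge0// exprn_even_gt0.
  have -> : Num.sg w * (FF / m) = (w * FF - 0 * Fa) / (Num.sqrt (w ^+ 2) * m).
    rewrite sqrtr_sqr mul0r subr0.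
    have nw : `|w| != 0 by rewrite normr_eq0.
    rewrite {2}(numEsg w); field; exact/andP.
  apply: cvgM; first by apply: cvgB; [exact: cvg_cst|apply: cvgM; [|exact: cvg_cst]].
  apply: cvgV; first by rewrite mulf_neq0// sqrtr_sqr normr_eq0.
  apply: cvgM; last exact: cvS.
  by apply: continuous_cvg; [exact: sqrt_continuous|exact: cvS].
rewrite w0 sgr0 mul0r.
have [u0|u0] := eqVneq u 0.
  have F10 : f1 = 0 by rewrite /f1 u0 w0 !mul0r subrr.
  have F20 : f2 = 0 by rewrite /f2 u0 w0 !mul0r subrr.
  rewrite (_ : (fun n : nat => _) = fun=> 0); first exact: cvg_cst.
  by apply/funext => n; rewrite /Fa F10 F20 !mul0r addr0 mulr0 subr0 mul0r.
have m0 : m != 0 by rewrite /m lt0r_neq0// ltr_wpDr ?sqr_ge0// exprn_even_gt0.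
have H : (fun n : nat => - (n.+1%:R^-1 * Fa) / (m + n.+1%:R^-1 ^+ 2) : R) @ \oo -->
    - (0 * Fa) / m.
  apply: cvgM; last by apply: cvgV => //; exact: cvS.
  by apply: cvgN; apply: cvgM; [exact: eps_cvg0|exact: cvg_cst].
move: H; rewrite mul0r oppr0 mul0r; apply: cvg_trans; apply: near_eq_cvg.
apply: nearW => n; rewrite /reg mul0r sub0r expr0n /= add0r sqrtr_sqr gtr0_norm ?eps_gt0//.
set e := n.+1%:R^-1; have e0 : e != 0 by rewrite lt0r_neq0// eps_gt0.
have : m + e ^+ 2 != 0 by rewrite lt0r_neq0// ltr_wpDl ?exprn_gt0 ?eps_gt0// addr_ge0 ?sqr_ge0.
by rewrite {2}/m w0 expr0n /= addr0 /m w0 expr0n /= addr0 => me; field; rewrite e0 me.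
Qed.

(** On a wall w = 0, so the folded angle is -atan(u/e) and tends to -(pi/2) sgn(u). At u = 0 the
    factor u makes the product vanish identically. *)
Lemma fold_angle_wall_cvg (u x : R) :
  (fun n : nat => fold_angle n.+1%:R^-1 u 0 * (u * x)) @ \oo --> - (pi / 2) * (`|u| * x).
Proof.
have E n : fold_angle n.+1%:R^-1 u 0 = - atan (u * n.+1%:R).
  by rewrite /fold_angle /reg expr0n /= add0r sqrtr_sqr gtr0_norm ?eps_gt0// invrK.
under eq_fun do rewrite E {E}.
have T (c : R) : 0 < c -> (fun n : nat => atan (c * n.+1%:R)) @ \oo --> (pi / 2 : R).
  move=> c0; apply: (@cvg_comp _ _ _ (fun n : nat => c * n.+1%:R) atan); last exact: cvgy_atan.
  apply/cvgryPgt => A; near=> n; rewrite mulrC -ltr_pdivrMr//.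
  apply: (@lt_trans _ _ n%:R); last by rewrite ltr_nat.
  by near: n; exact: nbhs_infty_gtr.
have [u0|u0|->] := ltgtP u 0.
- rewrite ltr0_norm// (_ : - (pi / 2) * (- u * x) = - (- (pi / 2)) * (u * x)); last by ring.
  apply: cvgM; last exact: cvg_cst.
  apply: cvgN; rewrite (_ : (fun n : nat => _) = fun n : nat => - atan (- u * n.+1%:R)).
    by apply: cvgN; apply: T; rewrite oppr_gt0.
  by apply/funext => n; rewrite mulNr atanN opprK.
- rewrite gtr0_norm//; apply: cvgM; last exact: cvg_cst.
  by apply: cvgN; exact: T.
- under eq_fun do rewrite (mul0r x) mulr0; rewrite normr0 mul0r mulr0; exact: cvg_cst.
Unshelve. all: by end_near. Qed.

End angle.

(** * Cutting a function off along a zero set *)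

Section glue.
Context (R : realType).

Lemma continuous_glue (T : topologicalType) (w k : T -> R) :
  continuous w -> continuous k -> (forall z, w z = 0 -> k z = 0) ->
  continuous (fun z => if 0 < w z then k z else 0).
Proof.
move=> cw ck k0 z; rewrite /continuous_at.
have [w0|w0|w0] := ltgtP 0 (w z).
- apply: cvg_trans (ck z); apply: near_eq_cvg; near=> y.
  by rewrite ifT//; near: y; exact: (cvgr_gt (w z) (cw z)).
- apply: cvg_near_cst; near=> y.
  rewrite ifF//; apply/negbTE; rewrite -leNgt ltW//.
  by near: y; exact: (cvgr_lt (w z) (cw z)).
- apply/norm_cvg0P; apply: (@squeeze_cvgr _ _ _ _ (fun=> 0) (fun y => `|k y|)).
  + by apply: nearW => y; case: ifP; rewrite ?normr0 !normr_ge0 ?lexx.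
  + exact: cvg_cst.
  + by have := cvg_norm (ck z); rewrite (k0 z (esym w0)) normr0; apply.
Unshelve. all: by end_near. Qed.

(** However complicated the set where w > 0 is near t, where w t = 0 the quotients of the glued
    function are either 0 or those of k, and the latter tend to 0. *)
Lemma is_derive_glue (w k : R -> R) (t dk : R) : {for t, continuous w} ->
  is_derive t 1 k dk -> (w t = 0 -> k t = 0) -> (w t = 0 -> dk = 0) ->
  is_derive t 1 (fun s => if 0 < w s then k s else 0) (if 0 < w t then dk else 0).
Proof.
move=> cw dk' kt dkt; have [w0|w0|w0] := ltgtP 0 (w t).
- apply: near_eq_is_derive dk'; near=> h.
  by rewrite ifT//; near: h; exact: (cvgr_gt (w t) cw).
- apply: near_eq_is_derive (is_derive_cst (0 : R) t 1); near=> h.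
  rewrite ifF//; apply/negbTE; rewrite -leNgt ltW//.
  by near: h; exact: (cvgr_lt (w t) cw).
- apply/is_derive1P; rewrite -w0 ltxx; move: dk' => /is_derive1P dk'.
  apply/norm_cvg0P; apply: (@squeeze_cvgr _ _ _ _ (fun=> 0) (fun h => `|(k (t + h) - k t) / h|)).
  + apply: nearW => h; rewrite normr_ge0 /= kt// subr0 subr0.
    by case: ifP => // _; rewrite mul0r normr0.
  + exact: cvg_cst.
  + by have := cvg_norm dk'; rewrite (dkt (esym w0)) normr0; apply.
Unshelve. all: by end_near. Qed.

End glue.

(** * Testing with the angle and with constants cut off along a direction *)

Section estimates.
Context (R : realType) (D : flow_domain) (f : flow R D).
Notation mu := (@lebesgue_measure R).

Definition speed2 z := v1 f z ^+ 2 + v2 f z ^+ 2.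
Definition curv z := (F1 f z ^+ 2 + F2 f z ^+ 2) / speed2 z.
Definition grad2 z := a1 f z ^+ 2 + a2 f z ^+ 2 + b1 f z ^+ 2 + b2 f z ^+ 2.

Lemma continuous_sqr (T : topologicalType) (g : T -> R) :
  continuous g -> continuous (fun z => g z ^+ 2).
Proof.
by move=> cg z; rewrite /continuous_at expr2; under eq_fun do rewrite expr2; apply: cvgM; exact: cg.
Qed.

Lemma cspeed2 : continuous speed2.
Proof. by move=> z; apply: cvgD; apply: continuous_sqr; [exact: cv1|exact: cv2]. Qed.

Lemma cgrad2 : continuous grad2.
Proof.
move=> z; apply: cvgD; last by apply: continuous_sqr; exact: cb2.
apply: cvgD; last by apply: continuous_sqr; exact: cb1.
by apply: cvgD; apply: continuous_sqr; [exact: ca1|exact: ca2].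
Qed.

Lemma speed2_ge0 z : 0 <= speed2 z.
Proof. by rewrite addr_ge0// sqr_ge0. Qed.

Lemma curv_ge0 z : 0 <= curv z.
Proof. by rewrite divr_ge0 ?speed2_ge0// addr_ge0// sqr_ge0. Qed.

Lemma speed2_eq0 z : speed2 z = 0 -> v1 f z = 0 /\ v2 f z = 0.
Proof.
move=> /eqP; rewrite paddr_eq0 ?sqr_ge0// !sqrf_eq0 => /andP[/eqP-> /eqP->] //.
Qed.

Lemma F_speed2_eq0 z : speed2 z = 0 -> F1 f z = 0 /\ F2 f z = 0.
Proof. by rewrite /F1 /F2 => /speed2_eq0[-> ->]; rewrite !mul0r subrr. Qed.

Lemma creg e : continuous (fun z => reg e (v2 f z)).
Proof.
move=> z; apply: (@continuous_comp _ _ _ (fun z => v2 f z ^+ 2 + e ^+ 2) Num.sqrt);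
  last exact: sqrt_continuous.
by apply: cvgD; [apply: continuous_sqr; exact: cv2|exact: cvg_cst].
Qed.

(** [test_limit] for the regularized folded angle: pi/2 bounds the angle, and v_2 = 0 on the walls
    leaves F2 = v_1 d_2 v_2 there. *)
Lemma fold_estimate (M : R) (t : test_fun D M) : 1 < M ->
  (leb2 R).-integrable (dom R D) (EFin \o (fun z => tf t z * (Num.sg (v2 f z) * curv z))) /\
  `|\int[leb2 R]_(z in dom R D) (tf t z * (Num.sg (v2 f z) * curv z))
    - \sum_(w <- walls R D) \int[mu]_x
        (tf t (x, w.1) * (w.2 * (- (pi / 2) * (`|v1 f (x, w.1)| * b2 f (x, w.1)))))|
  <= pi / 2 * \int[leb2 R]_(z in dom R D) `|F1 f z * tf1 t z + F2 f z * tf2 t z|.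
Proof.
move=> M1; pose e (n : nat) : R := n.+1%:R^-1.
have e0 n : 0 < e n by exact: eps_gt0.
have cdf n (d1 d2 : R * R -> R) : continuous d1 -> continuous d2 ->
    continuous (fun z => dfold_angle (e n) (v1 f z) (v2 f z) (d1 z) (d2 z)).
  move=> c1 c2 z; apply: cvgM.
    apply: cvgB; apply: cvgM.
    - by apply: cvgM; [exact: cv1|exact: cv2].
    - exact: c2.
    - by apply: cvgD; [apply: continuous_sqr; exact: cv2|exact: cvg_cst].
    - exact: c1.
  apply: cvgV.
    rewrite mulf_neq0//; first by rewrite lt0r_neq0// reg_gt0.
    by rewrite lt0r_neq0// ltr_wpDl ?exprn_gt0 ?e0// speed2_ge0.
  by apply: cvgM; [exact: creg|apply: cvgD; [exact: cspeed2|exact: cvg_cst]].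
apply: (@test_limit R D f M t (fun n z => fold_angle (e n) (v1 f z) (v2 f z))
  (fun n z => dfold_angle (e n) (v1 f z) (v2 f z) (a1 f z) (b1 f z))
  (fun n z => dfold_angle (e n) (v1 f z) (v2 f z) (a2 f z) (b2 f z)) (pi / 2)
  (fun z => Num.sg (v2 f z) * curv z) (fun z => 3 * grad2 z)
  (fun y x => - (pi / 2) * (`|v1 f (x, y)| * b2 f (x, y)))) => //.
- move=> n z; apply: cvgN.
  apply: (@continuous_comp _ _ _ (fun z => v1 f z / reg (e n) (v2 f z)) atan);
    last exact: continuous_atan.
  apply: cvgM; first exact: cv1.
  by apply: cvgV; [rewrite lt0r_neq0// reg_gt0|exact: creg].
- by move=> n; apply: cdf; [exact: ca1|exact: cb1].
- by move=> n; apply: cdf; [exact: ca2|exact: cb2].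
- by move=> n x y xy; apply: is_derive_fold_angle; [exact: e0|exact: dv11|exact: dv21].
- by move=> n x y xy; apply: is_derive_fold_angle; [exact: e0|exact: dv12|exact: dv22].
- by move=> n z _; exact: fold_angle_le.
- by move=> z _; exact: dfold_dot_cvg.
- by move=> z; apply: cvgM; [exact: cvg_cst|exact: cgrad2].
- by move=> n z _; exact: dfold_dot_le.
- move=> w x wD; rewrite /F2 (v2_wall f x wD) mul0r subr0; exact: fold_angle_wall_cvg.
Qed.

(** The limit function is the indicator of [w0] > 0. It jumps only where [w0] = 0, that is at zeros
    of v, where F vanishes too; so no interior term is left in the limit. *)
Lemma glue_estimate (M : R) (t : test_fun D M) (w0 : R * R -> R) : 1 < M ->
  continuous w0 -> (forall z, w0 z = 0 -> speed2 z = 0) ->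
  `|\sum_(w <- walls R D) \int[mu]_x
        (tf t (x, w.1) * (w.2 * (if 0 < w0 (x, w.1) then F2 f (x, w.1) else 0)))|
  <= \int[leb2 R]_(z in dom R D) `|F1 f z * tf1 t z + F2 f z * tf2 t z|.
Proof.
move=> M1 cw0 w0m; pose e (n : nat) : R := n.+1%:R^-1.
have e0 n : 0 < e n by exact: eps_gt0.
have m_gt0 n z : 0 < speed2 z + e n ^+ 2 by rewrite ltr_wpDl ?speed2_ge0// exprn_gt0 ?e0.
pose dm (d1 d2 : R * R -> R) z := 2 * (v1 f z * d1 z + v2 f z * d2 z).
(* This factor vanishes to second order where v = 0, which makes its product with the indicator C^1;
   it tends to 1 elsewhere. *)
pose k n z := speed2 z / (speed2 z + e n ^+ 2).
pose dk d1 d2 n z := e n ^+ 2 * dm d1 d2 z / (speed2 z + e n ^+ 2) ^+ 2.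
have ck n : continuous (k n).
  move=> z; apply: cvgM; first exact: cspeed2.
  by apply: cvgV; [exact: lt0r_neq0|apply: cvgD; [exact: cspeed2|exact: cvg_cst]].
have cdk d1 d2 n : continuous d1 -> continuous d2 -> continuous (dk d1 d2 n).
  move=> c1 c2 z; apply: cvgM.
    apply: cvgM; first exact: cvg_cst.
    apply: cvgM; first exact: cvg_cst.
    by apply: cvgD; apply: cvgM; [exact: cv1|exact: c1|exact: cv2|exact: c2].
  apply: cvgV; first by rewrite expf_neq0// lt0r_neq0.
  by apply: (@continuous_sqr _ (fun z => speed2 z + e n ^+ 2)) => y; apply: cvgD; [exact: cspeed2|exact: cvg_cst].
have k0 n z : w0 z = 0 -> k n z = 0 by move=> /w0m mz; rewrite /k mz mul0r.
have dk0 d1 d2 n z : w0 z = 0 -> dk d1 d2 n z = 0.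
  by move=> /w0m /speed2_eq0[u0 v0]; rewrite /dk /dm u0 v0 !mul0r addr0 !mulr0 mul0r.
have dkP (u v : R -> R) (s du dv : R) n : is_derive s 1 u du -> is_derive s 1 v dv ->
   0 < u s ^+ 2 + v s ^+ 2 + e n ^+ 2 ->
   is_derive s 1 (fun s => (u s ^+ 2 + v s ^+ 2) / (u s ^+ 2 + v s ^+ 2 + e n ^+ 2))
     (e n ^+ 2 * (2 * (u s * du + v s * dv)) / (u s ^+ 2 + v s ^+ 2 + e n ^+ 2) ^+ 2).
  move=> du' dv' p0.
  have H1 : is_derive s 1 (fun s => u s ^+ 2 + v s ^+ 2) (2 * (u s * du + v s * dv)).
    have -> : (fun s => u s ^+ 2 + v s ^+ 2) = (u \* u \+ v \* v).
      by apply/funext => x /=; rewrite !expr2.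
    have := is_deriveD (is_deriveM du' du') (is_deriveM dv' dv').
    by move/is_derive_eq; apply; rewrite /GRing.scale /=; ring.
  have H2 := is_deriveD H1 (is_derive_cst (e n ^+ 2) s 1).
  have H3 := is_deriveM H1 (@is_deriveV R (fun s => u s ^+ 2 + v s ^+ 2 + e n ^+ 2) s _ _
     (lt0r_neq0 p0) H2).
  apply: (is_derive_eq H3); rewrite /GRing.scale /= addr0; field; exact: lt0r_neq0.
have [||||||||||| _ H] := @test_limit R D f M t (fun n z => if 0 < w0 z then k n z else 0)
  (fun n z => if 0 < w0 z then dk (a1 f) (b1 f) n z else 0)
  (fun n z => if 0 < w0 z then dk (a2 f) (b2 f) n z else 0) 1
  (fun z => 0) (fun z => 8 * grad2 z)
  (fun y x => if 0 < w0 (x, y) then F2 f (x, y) else 0) => //.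
- by move=> n; apply: continuous_glue => // z; exact: k0.
- move=> n; apply: continuous_glue => // [|z]; last exact: dk0.
  by apply: cdk; [exact: ca1|exact: cb1].
- move=> n; apply: continuous_glue => // [|z]; last exact: dk0.
  by apply: cdk; [exact: ca2|exact: cb2].
- move=> n x y xy.
  apply: (@is_derive_glue R (fun x => w0 (x, y)) (fun x => k n (x, y))).
  + exact: (continuous_fst_slice cw0).
  + by apply: dkP; [exact: dv11|exact: dv21|exact: m_gt0].
  + exact: k0.
  + exact: dk0.
- move=> n x y xy.
  apply: (@is_derive_glue R (fun y => w0 (x, y)) (fun y => k n (x, y))).
  + exact: (continuous_snd_slice cw0).
  + by apply: dkP; [exact: dv12|exact: dv22|exact: m_gt0].
  + exact: k0.
  + exact: dk0.
- move=> n z _; case: ifP => _; last by rewrite normr0.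
  rewrite ger0_norm /k; first by rewrite ler_pdivrMr// mul1r lerDl sqr_ge0.
  by rewrite divr_ge0 ?speed2_ge0// ltW.
- move=> z _; case: (0 < w0 z); last first.
    by under eq_fun do rewrite !mulr0 addr0; exact: cvg_cst.
  have [/F_speed2_eq0[-> ->]|m0] := eqVneq (speed2 z) 0.
    by under eq_fun do rewrite !mul0r addr0; exact: cvg_cst.
  have cvm : (fun n => speed2 z + e n ^+ 2) @ \oo --> speed2 z + 0.
    by apply: cvgD; [exact: cvg_cst|exact: eps2_cvg0].
  have cvk d1 d2 : (fun n => dk d1 d2 n z) @ \oo --> 0 * dm d1 d2 z / (speed2 z + 0) ^+ 2.
    apply: cvgM; first by apply: cvgM; [exact: eps2_cvg0|exact: cvg_cst].
    apply: cvgV; first by rewrite addr0 expf_neq0.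
    by under eq_fun do rewrite expr2; rewrite expr2; apply: cvgM.
  have := cvgD (cvgM (cvg_cst (F1 f z)) (cvk (a1 f) (b1 f))) (cvgM (cvg_cst (F2 f z)) (cvk (a2 f) (b2 f))).
  by rewrite !mul0r !mulr0 addr0; apply.
- by move=> z; apply: cvgM; [exact: cvg_cst|exact: cgrad2].
- move=> n z _; case: ifP => _; last first.
    by rewrite !mulr0 addr0 normr0 mulr_ge0// /grad2 !addr_ge0// sqr_ge0.
  have g0 : 0 <= grad2 z by rewrite /grad2 !addr_ge0// sqr_ge0.
  set m := speed2 z; set p := m + e n ^+ 2.
  have p0 : 0 < p by exact: m_gt0.
  set X := v1 f z * a1 f z + v2 f z * b1 f z.
  set Y := v1 f z * a2 f z + v2 f z * b2 f z.
  have -> : F1 f z * dk (a1 f) (b1 f) n z + F2 f z * dk (a2 f) (b2 f) n z =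
      e n ^+ 2 * (2 * (F1 f z * X + F2 f z * Y)) / p ^+ 2.
    by rewrite /dk /dm -/X -/Y -/p; ring.
  rewrite normrM normfV (ger0_norm (sqr_ge0 p)) ler_pdivrMr ?exprn_gt0//.
  rewrite normrM (ger0_norm (sqr_ge0 (e n))) normrM ger0_norm//.
  (* Lagrange's identity again: (X, Y) is half the gradient of |v|^2, so its product with F is at
     most |v|^2 |grad v|^2. *)
  have E : F1 f z ^+ 2 + F2 f z ^+ 2 + X ^+ 2 + Y ^+ 2 = m * grad2 z.
    by rewrite /F1 /F2 /X /Y /m /speed2 /grad2; ring.
  have B : `|F1 f z * X + F2 f z * Y| <= m * grad2 z.
    rewrite -E ler_norml; apply/andP; split.
      have := sqr_ge0 (F1 f z + X); have := sqr_ge0 (F2 f z + Y).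
      by have := sqr_ge0 (F1 f z); have := sqr_ge0 (F2 f z); have := sqr_ge0 X; have := sqr_ge0 Y; nra.
    have := sqr_ge0 (F1 f z - X); have := sqr_ge0 (F2 f z - Y).
    by have := sqr_ge0 (F1 f z); have := sqr_ge0 (F2 f z); have := sqr_ge0 X; have := sqr_ge0 Y; nra.
  have em : e n ^+ 2 * m <= p ^+ 2.
    have := sqr_ge0 (e n); have : 0 <= m by exact: speed2_ge0.
    by rewrite /p; move: (e n ^+ 2) => E2; nra.
  apply: (@le_trans _ _ (e n ^+ 2 * (2 * (m * grad2 z)))).
    by rewrite ler_wpM2l ?sqr_ge0// ler_wpM2l.
  rewrite (_ : e n ^+ 2 * _ = 2 * grad2 z * (e n ^+ 2 * m)); last by ring.
  apply: (@le_trans _ _ (2 * grad2 z * p ^+ 2)); first by rewrite ler_wpM2l// mulr_ge0.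
  by rewrite ler_wpM2r ?sqr_ge0// ler_wpM2r//; lra.
- move=> w x wD; case: (0 < w0 (x, w.1)); last first.
    by under eq_fun do rewrite mul0r; exact: cvg_cst.
  have [/F_speed2_eq0[_ ->]|m0] := eqVneq (speed2 (x, w.1)) 0.
    by under eq_fun do rewrite mulr0; exact: cvg_cst.
  rewrite -[X in _ --> X]mul1r; apply: cvgM; last exact: cvg_cst.
  rewrite -(divff m0); apply: cvgM; first exact: cvg_cst.
  apply: cvgV => //; rewrite -[X in _ --> X]addr0.
  by apply: cvgD; [exact: cvg_cst|exact: eps2_cvg0].
move: H; have -> : \int[leb2 R]_(z in dom R D) (tf t z * 0) = 0.
  under eq_Rintegral do rewrite mulr0.
  by rewrite Rintegral_cst ?mul0r//; exact: measurable_dom.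
by rewrite sub0r normrN mul1r.
Qed.

End estimates.

(** * Smooth approximations of the cutoffs *)

Section ramp.
Context (R : realType).
Implicit Types (s t d : R).

Definition posp t : R := Num.max t 0.

Lemma cposp : continuous posp.
Proof. by move=> t; apply: continuous_max; [exact: cvg_id|exact: cvg_cst]. Qed.

Lemma posp_ge0 t : 0 <= posp t. Proof. by rewrite le_max lexx orbT. Qed.
Lemma posp_id t : 0 <= t -> posp t = t. Proof. by move=> t0; apply/max_idPl. Qed.
Lemma posp_eq0 t : t <= 0 -> posp t = 0. Proof. by move=> t0; apply/max_idPr. Qed.

Lemma is_derive_posp2 t : is_derive t 1 (fun t => posp t ^+ 2) (2 * posp t).
Proof.
have sq : is_derive t 1 (fun t : R => t * t) (2 * t).
  have := is_deriveM (is_derive_id t 1) (is_derive_id t 1).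
  by move/is_derive_eq; apply; rewrite /GRing.scale /=; ring.
have := @is_derive_glue R id (fun t => t * t) t (2 * t) cvg_id sq.
have -> : (fun s => if 0 < s then s * s else 0) = (fun t => posp t ^+ 2).
  apply/funext => s; case: ltP => s0; first by rewrite posp_id ?ltW// expr2.
  by rewrite posp_eq0// expr0n.
have -> : (if 0 < t then 2 * t else 0) = 2 * posp t.
  by case: ltP => t0; [rewrite posp_id// ltW|rewrite posp_eq0// mulr0].
by apply => /= ->; rewrite mulr0.
Qed.

(* A C^1 function at distance at most d of the positive part. *)
Definition ramp d t : R := (posp t ^+ 2 - posp (t - d) ^+ 2) / (2 * d).
Definition dramp d t : R := (posp t - posp (t - d)) / d.

Lemma is_derive_ramp d t : 0 < d -> is_derive t 1 (ramp d) (dramp d t).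
Proof.
move=> d0.
have H := @is_derive1_comp R (fun t => posp t ^+ 2) (fun t => t - d) t _ _
  (is_derive_posp2 (t - d)) (is_deriveB (is_derive_id t 1) (is_derive_cst d t 1)).
have := is_deriveM (is_deriveB (is_derive_posp2 t) H) (is_derive_cst (2 * d)^-1 t 1).
move/is_derive_eq; apply; rewrite /GRing.scale /dramp /=; field; exact: lt0r_neq0.
Qed.

Lemma cdramp d : continuous (dramp d).
Proof.
move=> t; apply: cvgM; last exact: cvg_cst; apply: cvgB; first exact: cposp.
apply: (@continuous_comp _ _ _ (fun t => t - d) posp); last exact: cposp.
by apply: cvgB; [exact: cvg_id|exact: cvg_cst].
Qed.

Lemma ramp_eq0 d t : 0 < d -> t <= 0 -> ramp d t = 0.
Proof. by move=> d0 t0; rewrite /ramp !posp_eq0 ?expr0n ?subrr ?mul0r//; lra. Qed.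

Lemma ramp_large d t : 0 < d -> d <= t -> ramp d t = t - d / 2.
Proof.
move=> d0 dt; rewrite /ramp !posp_id; [|lra..]; field; exact: lt0r_neq0.
Qed.

Lemma dramp_ge0 d t : 0 < d -> 0 <= dramp d t.
Proof.
move=> d0; apply: divr_ge0; last exact: ltW.
rewrite subr_ge0.
by rewrite /posp ge_max !le_max lexx orbT andbT; apply/orP; left; lra.
Qed.

Lemma dramp_le1 d t : 0 < d -> dramp d t <= 1.
Proof.
move=> d0; rewrite ler_pdivrMr// mul1r lerBlDl.
have := posp_ge0 (t - d); have [t0|t0] := leP 0 t.
  rewrite (posp_id t0) => _; rewrite -lerBlDr; exact: le_max_l || by rewrite le_max lexx.
by rewrite (posp_eq0 (ltW t0)); lra.
Qed.

Lemma dramp_eq0 d t : 0 < d -> t <= 0 -> dramp d t = 0.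
Proof. by move=> d0 t0; rewrite /dramp !posp_eq0 ?subrr ?mul0r//; lra. Qed.

Lemma dramp_large d t : 0 < d -> d <= t -> dramp d t = 1.
Proof.
by move=> d0 dt; rewrite /dramp !posp_id; [|lra..]; field; exact: lt0r_neq0.
Qed.

Lemma ramp_approx d t : 0 < d -> 0 <= posp t - ramp d t <= d / 2.
Proof.
move=> d0; have [t0|t0] := leP t 0; first by rewrite ramp_eq0// posp_eq0//; lra.
rewrite posp_id; last lra.
have [dt|dt] := leP d t; first by rewrite ramp_large//; lra.
rewrite /ramp (@posp_eq0 (t - d)) ?posp_id ?expr0n/= ?subr0; [|lra..].
have -> : t - t ^+ 2 / (2 * d) = t * (2 * d - t) / (2 * d) by field; exact: lt0r_neq0.
rewrite divr_ge0 ?mulr_ge0//=; [|lra..].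
by rewrite ler_pdivrMr ?mulr_gt0//; have := sqr_ge0 (d - t); nra.
Qed.

(** The profile shared by both cutoffs, in the variable |x_1|/r or ln|x| / ln r. [tau] is its C^1
    version, which reaches 0 at 2 + d, hence by 3 when d <= 1. *)
Definition trap t : R := 1 - posp (t - 1) + posp (t - 2).
Definition tau d t : R := 1 - ramp d (t - 1) + ramp d (t - 2).
Definition dtau d t : R := dramp d (t - 2) - dramp d (t - 1).

Lemma is_derive_tau d t : 0 < d -> is_derive t 1 (tau d) (dtau d t).
Proof.
move=> d0.
have H c := @is_derive1_comp R (ramp d) (fun t => t - c) t _ _
  (is_derive_ramp (t - c) d0) (is_deriveB (is_derive_id t 1) (is_derive_cst c t 1)).
have := is_deriveD (is_deriveB (is_derive_cst (1 : R) t 1) (H 1)) (H 2).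
by move/is_derive_eq; apply; rewrite /dtau; ring.
Qed.

Lemma cdtau d : continuous (dtau d).
Proof.
have H c : continuous (fun t => dramp d (t - c)).
  move=> t; apply: (@continuous_comp _ _ _ (fun t => t - c) (dramp d)); last exact: cdramp.
  by apply: cvgB; [exact: cvg_id|exact: cvg_cst].
by move=> t; apply: cvgB; exact: H.
Qed.

Lemma tau1 d t : 0 < d -> t <= 1 -> tau d t = 1.
Proof. by move=> d0 t1; rewrite /tau !ramp_eq0//; lra. Qed.

Lemma tau0 d t : 0 < d -> 2 + d <= t -> tau d t = 0.
Proof. by move=> d0 t1; rewrite /tau !ramp_large//; lra. Qed.

Lemma dtau1 d t : 0 < d -> t <= 1 -> dtau d t = 0.
Proof. by move=> d0 t1; rewrite /dtau !dramp_eq0//; lra. Qed.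

Lemma dtau0 d t : 0 < d -> 2 + d <= t -> dtau d t = 0.
Proof. by move=> d0 t1; rewrite /dtau !dramp_large//; lra. Qed.

Lemma dtau_le1 d t : 0 < d -> `|dtau d t| <= 1.
Proof.
move=> d0; rewrite ler_norml /dtau.
have := dramp_ge0 (t - 1) d0; have := dramp_ge0 (t - 2) d0.
have := dramp_le1 (t - 1) d0; have := dramp_le1 (t - 2) d0; lra.
Qed.

(** [tau] is 1 minus an increment of [ramp] over an interval of length 1, hence 1 minus a value of
    [dramp], which lies in [0, 1]. *)
Lemma tau_bounds d t : 0 < d -> 0 <= tau d t <= 1.
Proof.
move=> d0; have [||c _ E] := @MVT R (ramp d) (dramp d) (t - 2) (t - 1) ltac:(lra).
- by move=> x _; exact: is_derive_ramp.
- by apply: continuous_subspaceT => x; exact: is_derive_cts (is_derive_ramp x d0).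
rewrite /tau; have -> : 1 - ramp d (t - 1) + ramp d (t - 2) = 1 - dramp d c.
  have : ramp d (t - 1) - ramp d (t - 2) = dramp d c by rewrite E; ring.
  by lra.
have := dramp_ge0 c d0; have := dramp_le1 c d0; lra.
Qed.

Lemma tau_trap d t : 0 < d -> `|tau d t - trap t| <= d.
Proof.
move=> d0; rewrite /tau /trap ler_norml.
have := ramp_approx (t - 1) d0; have := ramp_approx (t - 2) d0; lra.
Qed.

Lemma trapE t : trap t = if t <= 1 then 1 else if t < 2 then 2 - t else 0.
Proof.
rewrite /trap; have [t1|t1] := leP t 1; first by rewrite !posp_eq0; lra.
rewrite (@posp_id (t - 1)); last by lra.
by have [t2|t2] := ltP t 2; [rewrite posp_eq0|rewrite posp_id]; lra.
Qed.

End ramp.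

Section log_profile.
Context (R : realType) (r d : R).
Hypotheses (r1 : 1 < r) (d0 : 0 < d).

(* The logarithmic cutoff as a function of rho = |x|^2. *)
Definition logtau (rho : R) : R := tau d (ln rho / (2 * ln r)).
Definition dlogtau (rho : R) : R := dtau d (ln rho / (2 * ln r)) / (2 * ln r * rho).

Let r0 : 0 < r. Proof. exact: lt_trans ltr01 r1. Qed.

Let r2 : 1 < r ^+ 2. Proof. by rewrite exprn_egt1. Qed.

Let l0 : 0 < 2 * ln r. Proof. by rewrite mulr_gt0// ln_gt0. Qed.

Lemma log_le1 rho : rho <= r ^+ 2 -> ln rho / (2 * ln r) <= 1.
Proof.
have [r1' d0' r2'] := And3 r1 d0 r2.
move=> h; rewrite ler_pdivrMr// mul1r mulr_natl -lnXn//.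
(* For [rho] <= 0 the logarithm has its default value, which is not positive. *)
have [p0|p0] := leP rho 0; last by rewrite ler_ln// posrE exprn_gt0//; lra.
rewrite (le_trans (ln_le0 _)); [by []|lra|].
by rewrite lnXn ?mulrn_wge0 ?ln_ge0//; lra.
Qed.

Lemma logtau1 rho : rho <= r ^+ 2 -> logtau rho = 1.
Proof. by move=> h; apply: tau1 => //; exact: log_le1. Qed.

Lemma dlogtau1 rho : rho <= r ^+ 2 -> dlogtau rho = 0.
Proof. by move=> h; rewrite /dlogtau dtau1 ?mul0r//; exact: log_le1. Qed.

Lemma log_ge3 rho : r ^+ 6 <= rho -> 3 <= ln rho / (2 * ln r).
Proof.
have [r1' d0' r2'] := And3 r1 d0 r2.
move=> h; rewrite ler_pdivlMr// (_ : 3 * (2 * ln r) = ln r *+ 6); last by ring.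
rewrite -lnXn//.
by rewrite ler_ln// posrE; [|apply: lt_le_trans h]; rewrite exprn_gt0//; lra.
Qed.

Lemma logtau0 rho : d <= 1 -> r ^+ 6 <= rho -> logtau rho = 0.
Proof.
have [r1' d0' r2'] := And3 r1 d0 r2. by move=> d1 h; apply: tau0 => //; have := log_ge3 h; lra. Qed.

Lemma dlogtau0 rho : d <= 1 -> r ^+ 6 <= rho -> dlogtau rho = 0.
Proof.
have [r1' d0' r2'] := And3 r1 d0 r2.
by move=> d1 h; rewrite /dlogtau dtau0 ?mul0r//; have := log_ge3 h; lra.
Qed.

(** The singularity of the logarithm does no harm, since [logtau] is constant for [rho] < r^2. *)
Lemma is_derive_logtau (rho : R) : is_derive rho 1 logtau (dlogtau rho).
Proof.
have [r1' d0' r2'] := And3 r1 d0 r2.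
have [p1|p1] := ltP rho (r ^+ 2).
  rewrite dlogtau1; last exact: ltW.
  apply: near_eq_is_derive (is_derive_cst (1 : R) rho 1); near=> h.
  rewrite logtau1// ltW//; near: h; exact: (cvgr_lt rho cvg_id).
have p0 : 0 < rho by lra.
have := @is_derive1_comp R (tau d) (fun x => ln x * (2 * ln r)^-1) rho _ _
  (is_derive_tau _ d0) (is_deriveM (is_derive1_ln p0) (is_derive_cst (2 * ln r)^-1 rho 1)).
move/is_derive_eq; apply; rewrite /dlogtau /GRing.scale /=; field.
have l1 : ln r != 0 by rewrite lt0r_neq0// ln_gt0.
by rewrite l1 lt0r_neq0.
Unshelve. all: by end_near. Qed.

Lemma cdlogtau : continuous dlogtau.
Proof.
have [r1' d0' r2'] := And3 r1 d0 r2.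
move=> rho; have [p1|p1] := ltP rho (r ^+ 2).
  rewrite /continuous_at dlogtau1; last exact: ltW.
  apply: cvg_near_cst; near=> h.
  rewrite dlogtau1// ltW//; near: h; exact: (cvgr_lt rho cvg_id).
have p0 : 0 < rho by lra.
apply: cvgM; last first.
  apply: cvgV; first by rewrite mulf_neq0// lt0r_neq0.
  by apply: cvgM; [exact: cvg_cst|exact: cvg_id].
apply: (@continuous_comp _ _ _ (fun x => ln x / (2 * ln r)) (dtau d)); last exact: cdtau.
by apply: cvgM; [exact: continuous_ln|exact: cvg_cst].
Unshelve. all: by end_near. Qed.

Lemma logtau_bounds rho : 0 <= logtau rho <= 1.
Proof. exact: tau_bounds. Qed.

Lemma dlogtau_le rho : 0 < rho -> `|dlogtau rho| <= (2 * ln r * rho)^-1.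
Proof.
move=> p0; rewrite normrM -[leRHS]mul1r ler_pM// ?dtau_le1//.
by rewrite gtr0_norm// invr_gt0 mulr_gt0.
Qed.

Lemma logtau_approx (x : R * R) : `|logtau (x.1 ^+ 2 + x.2 ^+ 2) - cutoff_log r x| <= d.
Proof.
have [r1' d0' r2'] := And3 r1 d0 r2.
set rho := x.1 ^+ 2 + x.2 ^+ 2.
have p0 : 0 <= rho by rewrite addr_ge0// sqr_ge0.
have sq : (enorm x) ^+ 2 = rho by rewrite sqr_sqrtr.
have n0 : 0 <= enorm x by exact: sqrtr_ge0.
suff -> : cutoff_log r x = trap (ln rho / (2 * ln r)) by exact: tau_trap.
have lr : 0 < ln r by exact: ln_gt0.
rewrite trapE /cutoff_log.
have [nr|nr] := leP (enorm x) r.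
  rewrite ifT//; apply: log_le1; rewrite -sq; rewrite lerXn2r// nnegrE; lra.
have nx0 : 0 < enorm x by lra.
have lE : ln rho / (2 * ln r) = ln (enorm x) / ln r.
  by rewrite -sq lnXn// -mulr_natl; field; exact: lt0r_neq0.
rewrite lE ler_pdivrMr// mul1r ltr_pdivrMr//.
have -> : (ln (enorm x) <= ln r) = false.
  by apply/negbTE; rewrite -ltNge ltr_ln// posrE; lra.
have -> : (ln (enorm x) < 2 * ln r) = (enorm x < r ^+ 2).
  by rewrite mulr_natl -lnXn ?ltr_ln// ?posrE ?exprn_gt0//; lra.
by [].
Qed.

End log_profile.

Section cutoffs.
Context (R : realType).

Definition core (D : flow_domain) (r : R) : set (R * R) :=
  match D with
  | Strip => [set z | `|z.1| <= r]
  | HalfPlane => [set z | z.1 ^+ 2 + z.2 ^+ 2 <= r ^+ 2]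
  end.

(** The place where [tau] has reached 0: |x_1|/r = 3, or ln|x| / ln r = 3. *)
Definition cutM (D : flow_domain) (r : R) : R :=
  if D is Strip then 3 * r else r ^+ 3.

Lemma cutM_gt1 D (r : R) : 100 < r -> 1 < cutM D r.
Proof. by case: D => /= r1; [lra|rewrite exprn_egt1//; lra]. Qed.

(** What the estimates use of a smoothed cutoff, uniformly in d. In the half-plane |grad phi|^2 is
    at most 1/(ln r |x|)^2 and lives on |x| > r; adding r^2 to the denominator, at the price of a
    factor 2, removes the singularity at the origin. *)
Record cutoff_spec (D : flow_domain) (r d : R) (t : test_fun D (cutM D r)) : Prop := {
  cut_bounds : forall z, cdom D z -> 0 <= tf t z <= 1;
  cut_approx : forall z, cdom D z -> `|tf t z - cutoff D r z| <= d;
  cut_core : forall z, cdom D z -> core D r z -> [/\ tf t z = 1, tf1 t z = 0 & tf2 t z = 0];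
  cut_grad : forall z, dom R D z -> box D (cutM D r) z ->
    tf1 t z ^+ 2 + tf2 t z ^+ 2 <=
    if D is Strip then 4 / r ^+ 2 else 2 / (ln r ^+ 2 * (z.1 ^+ 2 + z.2 ^+ 2 + r ^+ 2))
}.

Lemma cfst : continuous (fun z : R * R => z.1).
Proof. by move=> z; exact: cvg_fst. Qed.

Lemma csnd : continuous (fun z : R * R => z.2).
Proof. by move=> z; exact: cvg_snd. Qed.

Lemma cutoff_strip (r d : R) : 100 < r -> 0 < d -> d <= 1 ->
  exists t : test_fun Strip (cutM Strip r), cutoff_spec d t.
Proof.
move=> r1 d0 d1; have r0 : 0 < r by lra.
(* A differentiable way to write tau(|x|/r): one of the two terms always equals 1. *)
pose g (x : R) := tau d (x / r) + tau d (- x / r) - 1.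
pose dg (x : R) := (dtau d (x / r) - dtau d (- x / r)) / r.
have dgP (x : R) : is_derive x 1 g (dg x).
  have H (c : R) := @is_derive1_comp R (tau d) (fun x => x * c) x _ _
    (is_derive_tau (x * c) d0) (is_deriveM (is_derive_id x 1) (is_derive_cst c x 1)).
  have := is_deriveB (is_deriveD (H r^-1) (H (- r^-1))) (is_derive_cst (1 : R) x 1).
  have -> : ((tau d \o *%R^~ r^-1) + (tau d \o *%R^~ (- r^-1)) - cst 1)%R = g.
    by apply/funext => y; rewrite /g !fctE /= mulrN mulNr.
  by move/is_derive_eq; apply; rewrite /dg /GRing.scale /= (_ : x * - r^-1 = - x / r); ring.
have cdg : continuous dg.
  have H (c : R) : continuous (fun x : R => dtau d (x * c)).
    move=> x; apply: (@continuous_comp R R R (fun x : R => x * c) (dtau d)); last exact: cdtau.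
    by apply: cvgM; [exact: cvg_id|exact: cvg_cst].
  suff Hm : continuous (fun x : R => dtau d (- x / r)).
    by move=> x; apply: cvgM; [apply: cvgB; [exact: H|exact: Hm]|exact: cvg_cst].
  have -> : (fun x : R => dtau d (- x / r)) = (fun x => dtau d (x * - r^-1)).
    by apply/funext => y; rewrite mulrN mulNr.
  exact: H.
have cg : continuous g by move=> x; exact: is_derive_cts (dgP x).
have even x : g x = tau d (`|x| / r) /\ `|dg x| = `|dtau d (`|x| / r)| / r.
  have [x0|x0] := leP 0 x.
    rewrite ger0_norm// /g /dg (@tau1 _ d (- x / r)) ?(@dtau1 _ d (- x / r))//.
    - by rewrite subr0 addrK normrM (@gtr0_norm _ r^-1)// invr_gt0.
    - by rewrite ler_pdivrMr//; lra.
    - by rewrite ler_pdivrMr//; lra.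
  rewrite ltr0_norm// /g /dg (@tau1 _ d (x / r)) ?(@dtau1 _ d (x / r))//.
  - by rewrite sub0r normrM normrN (@gtr0_norm _ r^-1) ?invr_gt0//; split=> //; ring.
  - by rewrite ler_pdivrMr//; lra.
  - by rewrite ler_pdivrMr//; lra.
have g_large x : 3 * r <= `|x| -> g x = 0 /\ dg x = 0.
  move=> h; have l3 : 2 + d <= `|x| / r by rewrite ler_pdivlMr//; nra.
  have [-> E] := even x; rewrite tau0//; split=> //.
  by apply/eqP; rewrite -normr_eq0 E dtau0// normr0 mul0r.
unshelve eexists; first unshelve refine (@TestFun R Strip _ (fun z => g z.1)
  (fun z => dg z.1) (fun=> 0) _ _ _ _ _ _ _ _).
- move=> z; apply: (@continuous_comp _ _ _ fst g); [exact: cfst|exact: cg].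
- move=> z; apply: (@continuous_comp _ _ _ fst dg); [exact: cfst|exact: cdg].
- by move=> z; exact: cvg_cst.
- by move=> x y _ /=; exact: is_derive_cst.
- by move=> z /= /andP[_ z2] [/g_large[]//|]; lra.
- by move=> z /= /andP[_ z2] [/g_large[]//|]; lra.
- by [].
split=> z /=.
- by move=> _; have [-> _] := even z.1; exact: tau_bounds.
- move=> _; have [-> _] := even z.1; rewrite (_ : cutoff_lin r z = trap (`|z.1| / r)).
    exact: tau_trap.
  by rewrite trapE /cutoff_lin ler_pdivrMr// mul1r ltr_pdivrMr.
- move=> _ h; have l1 : `|z.1| / r <= 1 by rewrite ler_pdivrMr// mul1r.
  have [-> E] := even z.1; rewrite tau1//; split=> //.
  by apply/eqP; rewrite -normr_eq0 E dtau1// normr0 mul0r.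
- move=> _ _; rewrite expr0n /= addr0 -real_normK ?num_real//.
  have [_ ->] := even z.1; rewrite exprMn exprVn ler_pM2r ?invr_gt0 ?exprn_gt0//.
  have := dtau_le1 (`|z.1| / r) d0; have := normr_ge0 (dtau d (`|z.1| / r)).
  by move: `|dtau d _| => X; nra.
Qed.

Lemma cutoff_half (r d : R) : 100 < r -> 0 < d -> d <= 1 ->
  exists t : test_fun HalfPlane (cutM HalfPlane r), cutoff_spec d t.
Proof.
move=> r1 d0 d1; have r0 : 1 < r by lra.
pose rho (z : R * R) := z.1 ^+ 2 + z.2 ^+ 2.
have crho : continuous rho.
  by move=> z; apply: cvgD; apply: continuous_sqr; [exact: cfst|exact: csnd].
have cl : continuous (logtau r d).
  by move=> x; exact: is_derive_cts (is_derive_logtau r0 d0 x).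
have cdl := cdlogtau r0 d0.
have cdlr : continuous (fun z => dlogtau r d (rho z)).
  by move=> z; apply: (@continuous_comp _ _ _ rho (dlogtau r d)); [exact: crho|exact: cdl].
have dsq (c x : R) : is_derive x 1 (fun x => x ^+ 2 + c) (2 * x).
  have := is_deriveD (is_deriveM (is_derive_id x 1) (is_derive_id x 1)) (is_derive_cst c x 1).
  have -> : (id * id + cst c)%R = (fun x : R => x ^+ 2 + c).
    by apply/funext => y; rewrite !fctE /= expr2.
  by move/is_derive_eq; apply; rewrite /GRing.scale /=; ring.
have rho_large z : r ^+ 3 <= `|z.1| \/ r ^+ 3 <= z.2 -> r ^+ 6 <= rho z.
  have r3 : 0 <= r ^+ 3 by rewrite exprn_ge0//; lra.
  have -> : r ^+ 6 = r ^+ 3 ^+ 2 by rewrite -exprM.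
  have := sqr_ge0 z.1; have := sqr_ge0 z.2; rewrite /rho -(real_normK (num_real z.1)).
  by move: (r ^+ 3) r3 => M M0 ? ? [h|h]; nra.
have s1 : supp_in HalfPlane (cutM HalfPlane r) (fun z => dlogtau r d (rho z)).
  by move=> z _ /= h; rewrite dlogtau0//; exact: rho_large.
unshelve eexists; first unshelve refine (@TestFun R HalfPlane _ (fun z => logtau r d (rho z))
  (fun z => dlogtau r d (rho z) * (2 * z.1)) (fun z => dlogtau r d (rho z) * (2 * z.2))
  _ _ _ _ _ _ _ _).
- by move=> z; apply: (@continuous_comp _ _ _ rho (logtau r d)); [exact: crho|exact: cl].
- move=> z; apply: cvgM; first exact: cdlr.
  by apply: cvgM; [exact: cvg_cst|exact: cfst].
- move=> z; apply: cvgM; first exact: cdlr.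
  by apply: cvgM; [exact: cvg_cst|exact: csnd].
- move=> x y _; exact: (@is_derive1_comp R (logtau r d) (fun x => x ^+ 2 + y ^+ 2) x _ _
    (is_derive_logtau r0 d0 _) (dsq (y ^+ 2) x)).
- move=> x y _ /=; have -> : (fun y => logtau r d (rho (x, y))) =
     logtau r d \o (fun y => y ^+ 2 + x ^+ 2) by apply/funext => u /=; rewrite /rho /= addrC.
  rewrite /rho /= addrC.
  exact: (@is_derive1_comp R (logtau r d) (fun y => y ^+ 2 + x ^+ 2) y _ _
    (is_derive_logtau r0 d0 _) (dsq (x ^+ 2) y)).
- by move=> z _ /= h; rewrite logtau0//; exact: rho_large.
- by move=> z Dz h; rewrite s1// mul0r.
- by move=> z Dz h; rewrite s1// mul0r.
split=> z /=.
- by move=> _; exact: logtau_bounds.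
- by move=> _; exact: logtau_approx.
- by move=> _ h; rewrite logtau1// dlogtau1// !mul0r.
- move=> z2 _; have p0 : 0 < rho z by rewrite /rho ltr_wpDl ?sqr_ge0// exprn_gt0.
  have l0 : 0 < ln r by exact: ln_gt0.
  rewrite -/(rho z) (_ : _ + _ = 4 * rho z * dlogtau r d (rho z) ^+ 2); last by rewrite /rho; ring.
  have [h|h] := leP (rho z) (r ^+ 2).
    rewrite dlogtau1// expr0n /= mulr0; apply: divr_ge0 => //.
    by apply: mulr_ge0; [exact: sqr_ge0|apply: addr_ge0; [exact: ltW|exact: sqr_ge0]].
  have D2 : dlogtau r d (rho z) ^+ 2 <= (2 * ln r * rho z) ^- 2.
    rewrite -(real_normK (num_real (dlogtau _ _ _))) -exprVn lerXn2r// ?nnegrE//.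
      by rewrite invr_ge0 !mulr_ge0// ltW.
    exact: dlogtau_le.
  apply: (@le_trans _ _ (4 * rho z * (2 * ln r * rho z) ^- 2)).
    by rewrite ler_wpM2l// mulr_ge0// ltW.
  have -> : 4 * rho z * (2 * ln r * rho z) ^- 2 = (ln r ^+ 2 * rho z)^-1.
    by field; rewrite !lt0r_neq0.
  (* In this case [rho] > r^2, so [rho] + r^2 is at most 2 [rho]. *)
  rewrite ler_pdivlMr; last by rewrite mulr_gt0 ?exprn_gt0// ltr_wpDr// sqr_ge0.
  rewrite mulrC ler_pdivrMr ?mulr_gt0 ?exprn_gt0//.
  rewrite (_ : 2 * (ln r ^+ 2 * rho z) = ln r ^+ 2 * (2 * rho z)); last by ring.
  by rewrite ler_wpM2l ?sqr_ge0//; lra.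
Qed.

Lemma cutoff_exists D (r d : R) : 100 < r -> 0 < d -> d <= 1 ->
  exists t : test_fun D (cutM D r), cutoff_spec d t.
Proof. by case: D; [exact: cutoff_strip|exact: cutoff_half]. Qed.

End cutoffs.

(** * Iterated integrals and the kernel of the logarithmic cutoff *)

Lemma box_Rfubini (R : realType) (a b c d : R) (g : R * R -> R) :
  a < b -> c < d -> continuous g ->
  \int[leb2 R]_(z in `[a, b] `*` `]c, d[) g z =
  \int[lebesgue_measure]_(y in `[c, d]) \int[lebesgue_measure]_(x in `[a, b]) g (x, y).
Proof.
move=> ab cd cg; rewrite {1}/Rintegral box_fubini//; [|exact: measurable_itv..|
  by apply: box_integrable => //; exact: ltW].
pose G y := \int[lebesgue_measure]_(x in `[a, b]) g (x, y).
have cG : continuous G by exact: continuous_slice_integral.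
have mG (A : set (measurableTypeR R)) : measurable_fun A (EFin \o G).
  by apply/measurable_EFinP; apply: measurable_funTS; exact: continuous_measurable_fun.
rewrite [RHS]/Rintegral -integral_itv_obnd_cbnd; last exact: mG.
rewrite -integral_itv_bndo_bndc; last exact: mG.
congr fine; apply: eq_integral => y _; rewrite /G /Rintegral fineK//.
apply: integrable_fin_num => //; apply: continuous_itv_integrable.
exact: (continuous_fst_slice cg).
Qed.

Lemma RFTC2 (R : realType) (f F : R -> R) (a b : R) : a < b -> continuous f ->
  (forall x : R, x \in `[a, b] -> is_derive x 1 F (f x)) ->
  \int[lebesgue_measure]_(x in `[a, b]) f x = F b - F a.
Proof.
move=> ab cf dF; have cF x : x \in `[a, b] -> {for x, continuous F}.
  by move=> xab; exact: is_derive_cts (dF x xab).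
rewrite /Rintegral (@continuous_FTC2 R f F a b ab)//.
- exact: continuous_subspaceT.
- split.
  + by move=> x xab; have [] := dF x (subset_itv_oo_cc xab).
  + by apply: cvg_at_right_filter; apply: cF; rewrite in_itv/= lexx ltW.
  + by apply: cvg_at_left_filter; apply: cF; rewrite in_itv/= lexx ltW.
- by move=> x xab; rewrite derive1E; have h := dF x (subset_itv_oo_cc xab); exact: derive_val.
Qed.

Lemma atan_kernel_integral (R : realType) (B M : R) : 0 < B -> 0 < M ->
  \int[lebesgue_measure]_(x in `[- M, M]) (x ^+ 2 + B ^+ 2)^-1 <= pi / B.
Proof.
move=> B0 M0; have p (x : R) : 0 < x ^+ 2 + B ^+ 2 by rewrite ltr_wpDl ?sqr_ge0// exprn_gt0.
have ck : continuous (fun x : R => (x ^+ 2 + B ^+ 2)^-1).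
  move=> x; apply: cvgV; first exact: lt0r_neq0.
  apply: cvgD; last exact: cvg_cst.
  by apply: (@continuous_sqr R R id) => ?; exact: cvg_id.
have dF (x : R) : x \in `[- M, M] ->
    is_derive x 1 (fun x => atan (x / B) / B) (x ^+ 2 + B ^+ 2)^-1.
  move=> _; have H := @is_derive1_comp R atan (fun x => x * B^-1) x _ _
    (is_derive1_atan (x * B^-1)) (is_deriveM (is_derive_id x 1) (is_derive_cst B^-1 x 1)).
  have := is_deriveM H (is_derive_cst B^-1 x 1).
  move/is_derive_eq; apply; rewrite /GRing.scale /=; field.
  by rewrite !lt0r_neq0// addrC.
rewrite (RFTC2 _ ck dF); last by lra.
rewrite -mulrBl ler_pM2r ?invr_gt0//.
by have := atan_ltpi2 (M / B); have := atan_gtNpi2 (- M / B); lra.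
Qed.

(** Since (y + r)^2 <= 2 (y^2 + r^2), the integral in x is at most 2 pi / (y + r) by the arctangent.
    Integrating in y up to r^3 gives 2 pi ln((r^3 + r)/r), and r^3 + r <= r^4. *)
Lemma half_kernel_integral (R : realType) (r : R) : 100 < r ->
  \int[leb2 R]_(z in box HalfPlane (cutM HalfPlane r)) (z.1 ^+ 2 + z.2 ^+ 2 + r ^+ 2)^-1
  <= 6 * pi * ln r.
Proof.
move=> r1; set M := cutM _ r.
have M0 : 0 < M by rewrite exprn_gt0//; lra.
have p (z : R * R) : 0 < z.1 ^+ 2 + z.2 ^+ 2 + r ^+ 2.
  by rewrite ltr_wpDl ?exprn_gt0 ?addr_ge0 ?sqr_ge0//; lra.
have cg : continuous (fun z : R * R => (z.1 ^+ 2 + z.2 ^+ 2 + r ^+ 2)^-1).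
  move=> z; apply: cvgV; first exact: lt0r_neq0.
  apply: cvgD; last exact: cvg_cst.
  by apply: cvgD; apply: continuous_sqr; [exact: cfst|exact: csnd].
rewrite /box box_Rfubini//=; [|lra].
have inv_c (y : R) : 0 <= y -> y + r != 0 by move=> y0; apply: lt0r_neq0; lra.
(* The absolute value keeps the function continuous on the whole line. *)
pose h (y : R) := 2 * pi / (`|y| + r).
have ch : continuous h.
  move=> y; apply: cvgM; first exact: cvg_cst.
  apply: cvgV; first by rewrite inv_c.
  by apply: cvgD; [apply: cvg_norm; exact: cvg_id|exact: cvg_cst].
apply: (@le_trans _ _ (\int[lebesgue_measure]_(y in `[0, M]) h y)).
  apply: le_Rintegral => //.
  - by apply: continuous_itv_integrable; exact: (@continuous_slice_integral R _ _ _ cg).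
  - exact: continuous_itv_integrable.
  move=> y /=; rewrite in_itv/= => /andP[y0 yM].
  have B0 : 0 < y + r by lra.
  rewrite /h (ger0_norm y0).
  have -> : 2 * pi / (y + r) = 2 * (pi / (y + r)) by ring.
  apply: (@le_trans _ _ (2 * \int[lebesgue_measure]_(x in `[- M, M]) (x ^+ 2 + (y + r) ^+ 2)^-1)); last first.
    by rewrite ler_wpM2l// atan_kernel_integral.
  have ck : continuous (fun x : R => (x ^+ 2 + (y + r) ^+ 2)^-1).
    move=> x; apply: cvgV; first by rewrite lt0r_neq0// ltr_wpDl ?sqr_ge0// exprn_gt0.
    apply: cvgD; last exact: cvg_cst.
    by apply: (@continuous_sqr R R id) => ?; exact: cvg_id.
  rewrite -RintegralZl//; last exact: continuous_itv_integrable.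
  apply: le_Rintegral => //.
  - by apply: continuous_itv_integrable; exact: (continuous_fst_slice cg).
  - by apply: continuous_itv_integrable => x; apply: cvgM; [exact: cvg_cst|exact: ck].
  move=> x _ /=; have q1 := p (x, y); have q2 : 0 < x ^+ 2 + (y + r) ^+ 2.
    by rewrite ltr_wpDl ?sqr_ge0// exprn_gt0.
  rewrite /= in q1 *; rewrite ler_pdivlMr// mulrC ler_pdivrMr//.
  by have := sqr_ge0 (y - r); have := sqr_ge0 x; nra.
have dF (y : R) : y \in `[0, M] -> is_derive y 1 (fun y => 2 * pi * ln (y + r)) (h y).
  rewrite in_itv/= => /andP[y0 _]; rewrite /h (ger0_norm y0).
  have yr : 0 < y + r by lra.
  have H := @is_derive1_comp R (@ln R) (fun y => y + r) y _ _ (is_derive1_ln yr)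
    (is_deriveD (is_derive_id y 1) (is_derive_cst r y 1)).
  have := is_deriveM (is_derive_cst (2 * pi : R) y 1) H.
  by move/is_derive_eq; apply; rewrite /GRing.scale /=; ring.
rewrite (RFTC2 M0 ch dF).
rewrite add0r -mulrBr (_ : 6 * pi * ln r = 2 * pi * (3 * ln r)); last by ring.
rewrite ler_wpM2l ?mulr_ge0 ?pi_ge0// lerBlDr.
have -> : 3 * ln r + ln r = ln (r ^+ 4) by rewrite lnXn; [ring|lra].
have r3 : 0 < r ^+ 3 by rewrite exprn_gt0//; lra.
rewrite ler_ln ?posrE ?exprn_gt0//; [|rewrite /M /=; lra|lra].
rewrite /M /= (exprS r 3) exprS; have : 1 <= r ^+ 2 by rewrite exprn_ege1//; lra.
move: (r ^+ 2) => X X1; rewrite -[X in _ + X <= _]mulr1 -mulrDr ler_wpM2l//; first by lra.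
by nra.
Qed.

(** * Passing to the limit in the cutoff *)

Section flux.
Context (R : realType) (D : flow_domain) (f : flow R D).
Notation mu := (@lebesgue_measure R).

(** The growth hypothesis squared; C is the square of the constant in [growth]. *)
Definition flow_growth (C : R) := forall r z, 100 < r -> dom R D z -> core D r z ->
  speed2 f z <= C * (if D is Strip then r else ln r).

Lemma integrable_energy (M : R) (t : test_fun D M) : 1 < M -> (leb2 R).-integrable
  (dom R D) (EFin \o (fun z => speed2 f z * (tf1 t z ^+ 2 + tf2 t z ^+ 2))).
Proof.
move=> M1; apply: (supp_cts_integrable M1) => z.
  by move=> Dz h; rewrite (tf1_supp _ Dz h) (tf2_supp _ Dz h) expr0n /= addr0 mulr0.
apply: cvgM; first exact: cspeed2.
by apply: cvgD; apply: continuous_sqr; [exact: ctf1|exact: ctf2].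
Qed.

(** Bounded uniformly in r and d. Strip: |v|^2 <= 3 C r on the support, |grad phi|^2 <= 4/r^2 and
    area 12 r give 144 C. Half-plane: on the box |x|^2 <= 2 r^6 <= r^8, so |v|^2 <= C ln(r^4) = 4 C
    ln r, and the kernel integral 6 pi ln r leads to 48 pi C. *)
Lemma energy_bound (C r d : R) (t : test_fun D (cutM D r)) : 0 <= C -> flow_growth C ->
  100 < r -> cutoff_spec d t ->
  \int[leb2 R]_(z in dom R D) (speed2 f z * (tf1 t z ^+ 2 + tf2 t z ^+ 2)) <=
  (144 + 48 * pi) * C.
Proof.
rewrite /flow_growth => C0 gC r1 st; have M1 := cutM_gt1 D r1.
have sE : supp_in D (cutM D r) (fun z => speed2 f z * (tf1 t z ^+ 2 + tf2 t z ^+ 2)).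
  by move=> z Dz h; rewrite (tf1_supp _ Dz h) (tf2_supp _ Dz h) expr0n /= addr0 mulr0.
have cE : continuous (fun z => speed2 f z * (tf1 t z ^+ 2 + tf2 t z ^+ 2)).
  move=> z; apply: cvgM; first exact: cspeed2.
  by apply: cvgD; apply: continuous_sqr; [exact: ctf1|exact: ctf2].
have boxi g : continuous g -> (leb2 R).-integrable (box D (cutM D r)) (EFin \o g).
  move=> cg; apply: box_integrable => //; first by lra.
  by apply: ltW; exact: floor_lt_ceil.
have gr := cut_grad st; have lr : 0 < ln r by rewrite ln_gt0//; lra.
rewrite (supp_Rintegral M1 sE) mulrDl.
have pC : 0 <= 48 * pi * C by rewrite !mulr_ge0// pi_ge0.
case: D f t st gr sE cE boxi M1 gC => f' t st gr sE cE boxi M1 gC.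
- apply: (@le_trans _ _ (144 * C)); last by lra.
  apply: (@le_trans _ _ (\int[leb2 R]_(z in box Strip (cutM Strip r)) (12 * C / r))).
    apply: le_Rintegral; [exact: measurable_box|exact: boxi| |].
      by apply: boxi => z; exact: cvg_cst.
    move=> z zB; have zD := box_dom zB.
    have s3 : speed2 f' z <= C * (3 * r).
      apply: (gC (3 * r) z) => //; first by lra.
      by move: zB => [/=]; rewrite in_itv/= ler_norml.
    have -> : 12 * C / r = C * (3 * r) * (4 / r ^+ 2) by field; lra.
    apply: ler_pM => //; [exact: speed2_ge0|by rewrite addr_ge0 ?sqr_ge0|exact: gr].
  rewrite Rintegral_cst; last exact: measurable_box.
  rewrite leb2_box /=; [|lra|lra].
  by rewrite le_eqVlt; apply/orP; left; apply/eqP; field; lra.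
- apply: (@le_trans _ _ (48 * pi * C)); last by rewrite lerDr mulr_ge0.
  have k0 (z : R * R) : 0 < z.1 ^+ 2 + z.2 ^+ 2 + r ^+ 2.
    by rewrite ltr_wpDl ?exprn_gt0 ?addr_ge0 ?sqr_ge0//; lra.
  have ck : continuous (fun z : R * R => (z.1 ^+ 2 + z.2 ^+ 2 + r ^+ 2)^-1).
    move=> z; apply: cvgV; first exact: lt0r_neq0.
    apply: cvgD; last exact: cvg_cst.
    by apply: cvgD; apply: continuous_sqr; [exact: cfst|exact: csnd].
  apply: (@le_trans _ _ (8 * C / ln r * \int[leb2 R]_(z in box HalfPlane (cutM HalfPlane r))
      (z.1 ^+ 2 + z.2 ^+ 2 + r ^+ 2)^-1)); last first.
    apply: (@le_trans _ _ (8 * C / ln r * (6 * pi * ln r))).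
      by rewrite ler_wpM2l ?half_kernel_integral// divr_ge0 ?mulr_ge0// ltW.
    by rewrite le_eqVlt; apply/orP; left; apply/eqP; field; exact: lt0r_neq0.
  rewrite -RintegralZl; [|exact: measurable_box|exact: boxi].
  apply: le_Rintegral; [exact: measurable_box|exact: boxi| |].
    by apply: boxi => z; apply: cvgM; [exact: cvg_cst|exact: ck].
  move=> z zB; have zD := box_dom zB.
  have s3 : speed2 f' z <= C * (4 * ln r).
    rewrite mulr_natl -lnXn; last by lra.
    apply: (gC (r ^+ 4) z) => //.
      by rewrite (lt_le_trans r1)// ler_eXnr//; lra.
    move: zB => [/=]; rewrite !in_itv/= => /andP[z1 z2] /andP[z3 z4].
    have r3 : 2 <= r ^+ 2 by rewrite expr2; nra.
    have -> : (r ^+ 4) ^+ 2 = r ^+ 2 * (r ^+ 3) ^+ 2 by ring.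
    have := sqr_ge0 (r ^+ 3); have M0 : 0 < r ^+ 3 by rewrite exprn_gt0//; lra.
    move: (r ^+ 3) M0 z1 z2 z4 => M M0 z1 z2 z4 ?.
    by apply: (@le_trans _ _ (2 * M ^+ 2)); [nra|rewrite ler_wpM2r].
  have -> : 8 * C / ln r * (z.1 ^+ 2 + z.2 ^+ 2 + r ^+ 2)^-1 =
      C * (4 * ln r) * (2 / (ln r ^+ 2 * (z.1 ^+ 2 + z.2 ^+ 2 + r ^+ 2))).
    by field; rewrite (lt0r_neq0 lr) (lt0r_neq0 (k0 z)).
  apply: ler_pM => //; [exact: speed2_ge0|by rewrite addr_ge0 ?sqr_ge0|exact: gr].
Qed.

(* Valid also where the speed vanishes, since F vanishes there. *)
Lemma FF_curv z : F1 f z ^+ 2 + F2 f z ^+ 2 = curv f z * speed2 f z.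
Proof.
have [m0|m0] := eqVneq (speed2 f z) 0; last by rewrite /curv divfK.
by have [-> ->] := F_speed2_eq0 m0; rewrite expr0n /= addr0 m0 mulr0.
Qed.

(** Cauchy-Schwarz in the form (F . p)^2 <= [curv] |v|^2 |p|^2, followed by Young's inequality with
    weight k. The factor w is placed on the curvature side, either to localize it or to absorb
    it. *)
Lemma F_dot_young z (p1 p2 w k : R) : 0 <= w -> 0 < k ->
  w * `|F1 f z * p1 + F2 f z * p2| <=
  k / 2 * (w ^+ 2 * curv f z) + (2 * k)^-1 * (speed2 f z * (p1 ^+ 2 + p2 ^+ 2)).
Proof.
move=> w0 k0; set X := F1 f z * p1 + F2 f z * p2; set pp := p1 ^+ 2 + p2 ^+ 2.
have c0 := curv_ge0 f z; have m0 := speed2_ge0 f z.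
have pp0 : 0 <= pp by rewrite addr_ge0 ?sqr_ge0.
have XX : X ^+ 2 <= curv f z * (speed2 f z * pp).
  rewrite mulrA -FF_curv -subr_ge0 (_ : _ - _ = (F1 f z * p2 - F2 f z * p1) ^+ 2) ?sqr_ge0//.
  by rewrite /X /pp; ring.
rewrite -[w in leLHS]ger0_norm// -normrM.
set A := k * (w ^+ 2 * curv f z); set B := k^-1 * (speed2 f z * pp).
have A0 : 0 <= A by apply: mulr_ge0; [exact: ltW|apply: mulr_ge0; [exact: sqr_ge0|]].
have B0 : 0 <= B by apply: mulr_ge0; [rewrite invr_ge0 ltW|exact: mulr_ge0].
have -> : k / 2 * (w ^+ 2 * curv f z) + (2 * k)^-1 * (speed2 f z * pp) = (A + B) / 2.
  by rewrite /A /B; field; exact: lt0r_neq0.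
have wXAB : (w * X) ^+ 2 <= A * B.
  rewrite exprMn (_ : A * B = w ^+ 2 * (curv f z * (speed2 f z * pp))).
    by rewrite ler_wpM2l ?sqr_ge0.
  by rewrite /A /B; field; exact: lt0r_neq0.
rewrite -(@ler_pXn2r _ 2) ?nnegrE//; last by rewrite divr_ge0// addr_ge0.
rewrite real_normK ?num_real// (le_trans wXAB)//.
by have := sqr_ge0 (A - B); nra.
Qed.

(** The quotient may be discontinuous at zeros of v, but it is a pointwise limit of continuous
    functions. *)
Lemma measurable_curv (A : set (measurableTypeR R * measurableTypeR R)) :
  measurable_fun A (curv f).
Proof.
apply: measurable_funTS.
pose e (n : nat) : R := n.+1%:R^-1.
have p n z : 0 < speed2 f z + e n ^+ 2 by rewrite ltr_wpDl ?speed2_ge0// exprn_gt0// eps_gt0.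
apply: (measurable_fun_cvg (h := fun n z => (F1 f z ^+ 2 + F2 f z ^+ 2) / (speed2 f z + e n ^+ 2))).
  move=> n; apply: continuous_measurable2 => z; apply: cvgM.
    by apply: cvgD; apply: continuous_sqr; [exact: cF1|exact: cF2].
  by apply: cvgV; [exact: lt0r_neq0|apply: cvgD; [exact: cspeed2|exact: cvg_cst]].
move=> z _; rewrite /curv; have [m0|m0] := eqVneq (speed2 f z) 0.
  have [-> ->] := F_speed2_eq0 m0; rewrite expr0n /= addr0 mul0r.
  by under eq_fun do rewrite mul0r; exact: cvg_cst.
apply: cvgM; first exact: cvg_cst.
apply: cvgV => //; rewrite -[X in _ --> X]addr0.
by apply: cvgD; [exact: cvg_cst|exact: eps2_cvg0].
Qed.

Definition off_core (r : R) (z : R * R) : R := if pselect (core D r z) then 0 else 1.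

Lemma off_core_ge0 r z : 0 <= off_core r z.
Proof. by rewrite /off_core; case: pselect. Qed.

Lemma off_core_le1 r z : off_core r z <= 1.
Proof. by rewrite /off_core; case: pselect. Qed.

Lemma off_core_sqr r z : off_core r z ^+ 2 = off_core r z.
Proof. by rewrite /off_core; case: pselect => _ /=; rewrite ?expr0n ?expr1n. Qed.

Lemma core_sub (r s : R) : 0 <= r -> r <= s -> core D r `<=` core D s.
Proof.
move=> r0 rs z; case: D => /= h; first exact: le_trans rs.
by apply: (le_trans h); rewrite lerXn2r// nnegrE; lra.
Qed.

Lemma off_core_anti (r s : R) z : 0 <= r -> r <= s -> off_core s z <= off_core r z.
Proof.
move=> r0 rs; rewrite /off_core; case: pselect => /= [_|ns].
  by case: pselect.
by case: pselect => //= h; exfalso; apply: ns; exact: (core_sub r0 rs).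
Qed.

Lemma off_core_near0 z : \forall n \near \oo, off_core (101 + n%:R) z = 0.
Proof.
have := @nbhs_infty_ger R (`|z.1| + z.1 ^+ 2 + z.2 ^+ 2 + 1); apply: filterS => n bn.
have := sqr_ge0 z.1; have := sqr_ge0 z.2; have := normr_ge0 z.1 => n1 s2 s1.
rewrite /off_core; case: pselect => //= nc; exfalso; apply: nc.
by case: (D) => /=; [lra|rewrite expr2; nra].
Qed.

Lemma measurable_off_core r (A : set (measurableTypeR R * measurableTypeR R)) :
  measurable_fun A (off_core r).
Proof.
pose g (z : R * R) := if D is Strip then `|z.1| - r else z.1 ^+ 2 + z.2 ^+ 2 - r ^+ 2.
have cg : continuous g.
  rewrite /g; case: D => z; apply: cvgB; try exact: cvg_cst.
    by apply: cvg_norm; exact: cfst.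
  by apply: cvgD; apply: continuous_sqr; [exact: cfst|exact: csnd].
have gE z : core D r z <-> g z <= 0 by rewrite /g; case: D => /=; rewrite subr_le0.
rewrite (_ : off_core r = fun z => if 0 < g z then 1 else 0); last first.
  apply/funext => z; rewrite /off_core; case: pselect => /= [/gE|/gE/negP].
    by case: ltP.
  by rewrite -ltNge => ->.
apply: measurable_funTS; apply: measurable_fun_ifT => //.
by apply: measurable_fun_ltr => //; exact: continuous_measurable2.
Qed.

End flux.

Section flux_limit.
Context (R : realType) (D : flow_domain) (f : flow R D).
Notation mu := (@lebesgue_measure R).

Definition bflux (M : R) (t : test_fun D M) (h : R * R -> R) : R :=
  \sum_(w <- walls R D) \int[mu]_x (tf t (x, w.1) * (w.2 * h (x, w.1))).

Definition bcut (r : R) (h : R * R -> R) : R :=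
  \sum_(w <- walls R D) \int[mu]_x (cutoff D r (x, w.1) * (w.2 * h (x, w.1))).

Lemma tf_wall0 (M : R) (t : test_fun D M) w x : w \in walls R D ->
  M <= `|x| -> tf t (x, w.1) = 0.
Proof. by move=> wD h; apply: tf_supp; [exact: wall_cdom|left]. Qed.

Lemma bfluxZ (M : R) (t : test_fun D M) (c : R) h : continuous h ->
  bflux t (fun z => c * h z) = c * bflux t h.
Proof.
move=> ch; rewrite /bflux mulr_sumr !big_seq; apply: eq_bigr => w wD.
rewrite !(@slice_setT R M); first last.
- by move=> x hx; rewrite (tf_wall0 t wD)// mul0r.
- by move=> x hx; rewrite (tf_wall0 t wD)// mul0r.
rewrite -RintegralZl//; first by apply: eq_Rintegral => x _; ring.
apply: continuous_itv_integrable.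
apply: (@continuous_fst_slice R (fun z => tf t z * (w.2 * h z))) => z.
by apply: cvgM; [exact: ctf|apply: cvgM; [exact: cvg_cst|exact: ch]].
Qed.

(* The cutoffs themselves are only Lipschitz; on the walls they are limits of C^1 ones. *)
Lemma cutoff_sequence (r : R) : 100 < r -> exists t : nat -> test_fun D (cutM D r),
  (forall n, cutoff_spec (n.+1%:R^-1) (t n)) /\
  forall (w : R * R) x, w \in walls R D ->
    tf (t n) (x, w.1) @[n --> \oo] --> cutoff D r (x, w.1).
Proof.
move=> r1.
have : forall n : nat, exists t : test_fun D (cutM D r), cutoff_spec (n.+1%:R^-1) t.
  by move=> n; apply: cutoff_exists; [exact: r1|exact: eps_gt0|rewrite invf_le1// ler1n].
move=> /choice[t Ht]; exists t; split=> // w x wD; apply/cvgrPdist_le => e e0.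
have [N _ HN] : \forall n \near \oo, n.+1%:R^-1 <= e :> R.
  have := @cvg_harmonic R => /cvgrPdist_le/(_ _ e0).
  apply: filterS => n; rewrite sub0r normrN; apply: le_trans; exact: ler_norm.
exists N => // n nN; rewrite distrC.
by apply: (le_trans (cut_approx (Ht n) (wall_cdom x wD))); exact: HN.
Qed.

(** Carries a bound that is uniform in the smoothing width d over to the Lipschitz cutoff. The
    affine form a + b x suits both [flux_bound] and [glue_bound]. *)
Lemma bcut_limit (r : R) (h : R * R -> R) (a b E : R) : 100 < r -> continuous h ->
  (forall d (t : test_fun D (cutM D r)), 0 < d -> d <= 1 -> cutoff_spec d t ->
    `|a + b * bflux t h| <= E) ->
  `|a + b * bcut r h| <= E.
Proof.
move=> r1 ch H; have [t [Ht tc]] := cutoff_sequence r1.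
have cv : bflux (t n) h @[n --> \oo] --> bcut r h.
  apply: cvg_sum_seq => w wD.
  have c0 x : cutM D r <= `|x| -> cutoff D r (x, w.1) = 0.
    move=> hx; rewrite -(cvg_lim (@Rhausdorff R) (tc w x wD)); apply: cvg_lim => //.
    by apply: cvg_near_cst; apply: nearW => n; exact: tf_wall0.
  rewrite [X in _ --> X](@slice_setT R (cutM D r)); last by move=> x hx; rewrite c0// mul0r.
  rewrite [X in X @ _](_ : _ = fun n => \int[mu]_(x in `[- cutM D r, cutM D r])
      (tf (t n) (x, w.1) * (w.2 * h (x, w.1)))); last first.
    by apply/funext => n; rewrite (@slice_setT R (cutM D r))// => x hx; rewrite (tf_wall0 _ wD)// mul0r.
  have cs := continuous_fst_slice.
  have [] := @Rdominated_convergence _ _ R mu `[- cutM D r, cutM D r]%classic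
    (fun n x => tf (t n) (x, w.1) * (w.2 * h (x, w.1)))
    (fun x => cutoff D r (x, w.1) * (w.2 * h (x, w.1)))
    (fun x => `|w.2 * h (x, w.1)|) => //.
  - move=> n; apply: measurable_funTS; apply: continuous_measurable_fun.
    apply: (cs _ (fun z => tf (t n) z * (w.2 * h z))) => z.
    by apply: cvgM; [exact: ctf|apply: cvgM; [exact: cvg_cst|exact: ch]].
  - by move=> x _; apply: cvgM; [exact: (tc w x wD)|exact: cvg_cst].
  - apply: continuous_itv_integrable; apply: (cs _ (fun z => `|w.2 * h z|)) => z.
    by apply: cvg_norm; apply: cvgM; [exact: cvg_cst|exact: ch].
  - move=> n x _; rewrite normrM -[leRHS]mul1r ler_wpM2r//.
    have /andP[t0 t1] := cut_bounds (Ht n) (wall_cdom x wD).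
    by rewrite ger0_norm.
have cvE : `|a + b * bflux (t n) h| @[n --> \oo] --> `|a + b * bcut r h|.
  by apply: cvg_norm; apply: cvgD; [exact: cvg_cst|apply: cvgM; [exact: cvg_cst|exact: cv]].
apply: (cvgr_to_le cvE); apply: nearW => n; apply: (H n.+1%:R^-1).
- exact: eps_gt0.
- by rewrite invf_le1// ler1n.
- exact: Ht.
Qed.

Hypothesis icurv : (leb2 R).-integrable (dom R D) (EFin \o curv f).
Variable C : R.
Hypothesis C0 : 0 <= C.
Hypothesis gC : flow_growth f C.

Definition tail (r : R) := \int[leb2 R]_(z in dom R D) (off_core D r z * curv f z).

Lemma off_curv_le r z : `|off_core D r z * curv f z| <= `|curv f z|.
Proof.
by rewrite normrM -[leRHS]mul1r ler_wpM2r// ger0_norm ?off_core_ge0// off_core_le1.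
Qed.

Lemma tail_integrable r :
  (leb2 R).-integrable (dom R D) (EFin \o (fun z => off_core D r z * curv f z)).
Proof.
apply: le_integrable icurv; first exact: measurable_dom.
  apply/measurable_EFinP; apply: measurable_funM; first exact: measurable_off_core.
  exact: measurable_curv.
by move=> z _; rewrite /= lee_fin off_curv_le.
Qed.

Lemma tail_ge0 r : 0 <= tail r.
Proof. by apply: Rintegral_ge0 => z _; rewrite mulr_ge0 ?off_core_ge0 ?curv_ge0. Qed.

Lemma tail_anti (r s : R) : 0 <= r -> r <= s -> tail s <= tail r.
Proof.
move=> r0 rs; apply: le_Rintegral.
- exact: measurable_dom.
- exact: tail_integrable.
- exact: tail_integrable.
by move=> z _; rewrite ler_wpM2r ?curv_ge0// off_core_anti.
Qed.

Lemma tail_small (e : R) : 0 < e -> exists2 r0 : R, 100 < r0 & forall r, r0 <= r -> tail r <= e.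
Proof.
move=> e0.
have [||||| _ cv] := @Rdominated_convergence _ _ R (leb2 R) (dom R D)
  (fun n z => off_core D (101 + n%:R) z * curv f z) (fun=> 0) (fun z => `|curv f z|).
- exact: measurable_dom.
- move=> n; apply: measurable_funM; first exact: measurable_off_core.
  exact: measurable_curv.
- move=> z _; apply: cvg_near_cst; move: (off_core_near0 D z).
  by apply: filterS => n ->; rewrite mul0r.
- have := integrable_norm icurv; apply: eq_integrable; first exact: measurable_dom.
  by [].
- by move=> n z _; exact: off_curv_le.
rewrite Rintegral_cst ?mul0r in cv; last exact: measurable_dom.
move/cvgrPdist_le: cv => /(_ _ e0)[N _ HN].
exists (101 + N%:R); first by have : 0 <= N%:R :> R by []; lra.
move=> r hr; apply: le_trans (HN N (leqnn N)).
rewrite sub0r normrN (le_trans _ (ler_norm _))//; exact: tail_anti.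
Qed.

(** The gradient of the cutoff vanishes on the core, so only the curvature beyond it enters. *)
Lemma young_bound (r d k : R) (t : test_fun D (cutM D r)) : 100 < r -> 0 < k ->
  cutoff_spec d t ->
  \int[leb2 R]_(z in dom R D) `|F1 f z * tf1 t z + F2 f z * tf2 t z| <=
  k / 2 * tail r + (2 * k)^-1 * ((144 + 48 * pi) * C).
Proof.
move=> r1 k0 st; have M1 := cutM_gt1 D r1.
have iE := integrable_energy f t M1.
have iT := tail_integrable r.
have mD := @measurable_dom R D.
apply: (@le_trans _ _ (k / 2 * tail r + (2 * k)^-1 *
   \int[leb2 R]_(z in dom R D) (speed2 f z * (tf1 t z ^+ 2 + tf2 t z ^+ 2)))); last first.
  by rewrite lerD2l ler_wpM2l ?(energy_bound C0 gC r1 st)// invr_ge0 mulr_ge0// ltW.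
rewrite -!RintegralZl// -RintegralD//; last 2 first.
- exact: (integrableZl mD (k / 2) iT).
- exact: (integrableZl mD (2 * k)^-1 iE).
apply: le_Rintegral => //.
- exact: integrable_dot.
- exact: (integrableD mD (integrableZl mD (k / 2) iT) (integrableZl mD (2 * k)^-1 iE)).
move=> z zD /=.
have -> : `|F1 f z * tf1 t z + F2 f z * tf2 t z| =
    off_core D r z * `|F1 f z * tf1 t z + F2 f z * tf2 t z|.
  rewrite /off_core; case: pselect => /= [zc|_]; last by rewrite mul1r.
  have [_ -> ->] := cut_core st (dom_cdom zD) zc.
  by rewrite !mulr0 addr0 normr0 mulr0.
by rewrite -[X in k / 2 * (X * _)]off_core_sqr F_dot_young// off_core_ge0.
Qed.

Definition signed_curv := \int[leb2 R]_(z in dom R D) (Num.sg (v2 f z) * curv f z).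

Lemma measurable_sg_curv (A : set (measurableTypeR R * measurableTypeR R)) :
  measurable_fun A (fun z => Num.sg (v2 f z) * curv f z).
Proof.
apply: measurable_funM; last exact: measurable_curv.
apply: measurable_funTS.
have mv : measurable_fun [set: measurableTypeR R * measurableTypeR R] (v2 f).
  by apply: continuous_measurable2; exact: cv2.
rewrite (_ : (fun _ => _) = fun z => if v2 f z < 0 then -1 else if 0 < v2 f z then 1 else 0).
  apply: measurable_fun_ifT => //; first exact: measurable_fun_ltr.
  by apply: measurable_fun_ifT => //; exact: measurable_fun_ltr.
by apply/funext => z; case: sgrP.
Qed.

Lemma sg_curv_le z : `|Num.sg (v2 f z) * curv f z| <= curv f z.
Proof.
rewrite normrM (ger0_norm (curv_ge0 f z)) -[leRHS]mul1r ler_wpM2r ?curv_ge0//.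
by rewrite normr_sg lern1 leq_b1.
Qed.

Lemma sg_curv_integrable :
  (leb2 R).-integrable (dom R D) (EFin \o (fun z => Num.sg (v2 f z) * curv f z)).
Proof.
apply: le_integrable icurv; first exact: measurable_dom.
  by apply/measurable_EFinP; exact: measurable_sg_curv.
by move=> z _; rewrite /= lee_fin (le_trans (sg_curv_le z)) ?ler_norm.
Qed.

Lemma continuous_wall_flux : continuous (fun z => `|v1 f z| * b2 f z).
Proof. by move=> z; apply: cvgM; [apply: cvg_norm; exact: cv1|exact: cb2]. Qed.

(** Two errors add up: replacing the cutoff by 1 in the curvature integral costs [tail r], and the
    gradient of the cutoff costs [young_bound] times pi/2. *)
Lemma flux_bound (r k : R) : 100 < r -> 0 < k ->
  `|signed_curv + pi / 2 * bcut r (fun z => `|v1 f z| * b2 f z)| <=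
  tail r + pi / 2 * (k / 2 * tail r + (2 * k)^-1 * ((144 + 48 * pi) * C)).
Proof.
move=> r1 k0; apply: bcut_limit => //; first exact: continuous_wall_flux.
move=> d t d0 d1 st; have M1 := cutM_gt1 D r1; have mD := @measurable_dom R D.
have [it H] := fold_estimate f t M1.
have iS := sg_curv_integrable; have iT := tail_integrable r.
set X := \int[leb2 R]_(z in dom R D) (tf t z * (Num.sg (v2 f z) * curv f z)) in H.
have SX : `|signed_curv - X| <= tail r.
  rewrite /X /signed_curv -RintegralB//.
  have iB := integrableB mD iS it.
  apply: (le_trans (le_normr_Rintegral mD iB)).
  apply: le_Rintegral => //; first exact: (integrable_norm iB).
  move=> z zD; have -> : Num.sg (v2 f z) * curv f z - tf t z * (Num.sg (v2 f z) * curv f z) =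
     (1 - tf t z) * (Num.sg (v2 f z) * curv f z) by ring.
  have /andP[t0 t1] := cut_bounds st (dom_cdom zD).
  rewrite normrM ger0_norm ?subr_ge0//.
  apply: ler_pM => //; [by rewrite subr_ge0| |exact: sg_curv_le].
  rewrite /off_core; case: pselect => /= [zc|_]; last by lra.
  by have [-> _ _] := cut_core st (dom_cdom zD) zc; rewrite subrr.
have := young_bound r1 k0 st.
set Y := \int[leb2 R]_(z in _) _ in H *; move=> Yk.
have E : bflux t (fun z => - (pi / 2) * (`|v1 f z| * b2 f z)) =
    - (pi / 2) * bflux t (fun z => `|v1 f z| * b2 f z).
  by apply: bfluxZ; exact: continuous_wall_flux.
rewrite -/(bflux t (fun z => - (pi / 2) * (`|v1 f z| * b2 f z))) E in H.
have -> : signed_curv + pi / 2 * bflux t (fun z => `|v1 f z| * b2 f z) =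
  (signed_curv - X) + (X - - (pi / 2) * bflux t (fun z => `|v1 f z| * b2 f z)) by ring.
apply: (le_trans (ler_normD _ _)); apply: lerD => //; apply: (le_trans H).
by rewrite ler_wpM2l// divr_ge0// pi_ge0.
Qed.

Lemma glue_bound (w0 : R * R -> R) (r k : R) : continuous w0 ->
  (forall z, w0 z = 0 -> speed2 f z = 0) -> 100 < r -> 0 < k ->
  `|0 + 1 * bcut r (fun z => if 0 < w0 z then F2 f z else 0)| <=
  k / 2 * tail r + (2 * k)^-1 * ((144 + 48 * pi) * C).
Proof.
move=> cw0 w0m r1 k0; apply: bcut_limit => //.
  apply: continuous_glue => //; first exact: cF2.
  by move=> z /w0m /F_speed2_eq0[].
move=> d t d0 d1 st; have M1 := cutM_gt1 D r1.
rewrite add0r mul1r; apply: le_trans (young_bound r1 k0 st).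
exact: glue_estimate.
Qed.

(** The energy [c3] is bounded but not small: k is taken large first, to beat it, and then r, to
    make the tail small against k. *)
Lemma bcut_cvg (a b c1 c2 c3 : R) (g : R -> R) : 0 <= c1 -> 0 <= c2 -> 0 <= c3 ->
  (forall r k, 100 < r -> 0 < k ->
    `|a + g r| <= c1 * tail r + c2 * (k * tail r + k^-1 * c3)) ->
  g r @[r --> +oo] --> - a.
Proof.
move=> c10 c20 c30 H; apply/cvgrPdist_le => e e0.
(* Makes c2 c3 / k at most e/2; the added 1 keeps k positive when c2 c3 = 0. *)
pose k := 2 * (c2 * c3 + 1) / e.
have cc : 0 <= c2 * c3 by exact: mulr_ge0.
have k0 : 0 < k by rewrite divr_gt0 ?mulr_gt0//; lra.
pose s := e / (2 * (c1 + c2 * k + 1)).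
have ck : 0 <= c2 * k by rewrite mulr_ge0// ltW.
have s0 : 0 < s by rewrite divr_gt0 ?mulr_gt0//; lra.
have [r0 r01 Hr] := tail_small s0.
exists r0; split; first exact: num_real.
move=> r rr; rewrite /= -opprD normrN (le_trans (H r k _ _))//; first by lra.
have ts := Hr r (ltW rr); have t0 := tail_ge0 r.
have A : (c1 + c2 * k) * tail r <= e / 2.
  apply: (@le_trans _ _ ((c1 + c2 * k + 1) * s)).
    by apply: ler_pM => //; lra.
  by rewrite /s le_eqVlt; apply/orP; left; apply/eqP; field; lra.
have B : c2 * (k^-1 * c3) <= e / 2.
  have -> : c2 * (k^-1 * c3) = e / 2 * (c2 * c3 / (c2 * c3 + 1)).
    by rewrite /k; field; lra.
  rewrite ler_piMr//; first by lra.
  by rewrite ler_pdivrMr; lra.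
by rewrite !mulrDr in B *; nra.
Qed.

Lemma flux_cvg : bcut r (fun z => `|v1 f z| * b2 f z) @[r --> +oo] --> - (2 / pi * signed_curv).
Proof.
have pi0 : pi != 0 :> R by rewrite lt0r_neq0// pi_gt0.
have p4 : 0 <= pi / 4 :> R by rewrite divr_ge0// pi_ge0.
have K0 : 0 <= (144 + 48 * pi) * C by rewrite mulr_ge0// addr_ge0// mulr_ge0// pi_ge0.
have := @bcut_cvg signed_curv 0 1 (pi / 4) ((144 + 48 * pi) * C)
  (fun r => pi / 2 * bcut r (fun z => `|v1 f z| * b2 f z)) ler01 p4 K0.
move=> H; have {}H : (pi / 2 * bcut r (fun z => `|v1 f z| * b2 f z)) @[r --> +oo] --> - signed_curv.
  apply: H => r k r1 k0; apply: (le_trans (flux_bound r1 k0)).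
  by rewrite le_eqVlt; apply/orP; left; apply/eqP; field; exact: lt0r_neq0.
rewrite -mulrN (_ : (fun r => _) = fun r => 2 / pi * (pi / 2 * bcut r (fun z => `|v1 f z| * b2 f z))).
  by apply: cvgM; [exact: cvg_cst|exact: H].
apply/funext => r; rewrite mulrA (_ : 2 / pi * (pi / 2) = 1) ?mul1r//.
by rewrite mulrA divfK// divff.
Qed.

Lemma glue_cvg (w0 : R * R -> R) : continuous w0 ->
  (forall z, w0 z = 0 -> speed2 f z = 0) ->
  bcut r (fun z => if 0 < w0 z then F2 f z else 0) @[r --> +oo] --> 0.
Proof.
move=> cw0 w0m; have p2 : 0 <= 2^-1 :> R by rewrite invr_ge0.
have K0 : 0 <= (144 + 48 * pi) * C by rewrite mulr_ge0// addr_ge0// mulr_ge0// pi_ge0.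
have := @bcut_cvg 0 0 0 2^-1 ((144 + 48 * pi) * C)
  (fun r => bcut r (fun z => if 0 < w0 z then F2 f z else 0)) (lexx 0) p2 K0.
rewrite oppr0; apply => r k r1 k0; have := glue_bound cw0 w0m r1 k0.
rewrite mul1r => h; apply: (le_trans h).
by rewrite le_eqVlt; apply/orP; left; apply/eqP; field; exact: lt0r_neq0.
Qed.

End flux_limit.

(** * Extension of the flow to the closed domain and beyond *)

Section clamp.
Context (R : realType) (D : flow_domain).

(** The vertical projection onto the closed domain; composing with it extends a function
    continuously to the plane without new values. *)
Definition clamp (z : R * R) : R * R :=
  (z.1, if D is Strip then posp (2 - posp (1 - z.2)) - 1 else posp z.2).

Lemma clamp_cdom z : cdom D (clamp z).
Proof.
rewrite /clamp; case: D => /=; last exact: posp_ge0.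
have p0 := posp_ge0 (1 - z.2); have [h|h] := leP (2 - posp (1 - z.2)) 0.
  by rewrite (posp_eq0 h); lra.
by rewrite (posp_id (ltW h)); lra.
Qed.

Lemma clamp_id z : cdom D z -> clamp z = z.
Proof.
case: z => x y; rewrite /clamp; case: D => /= [y1|y0]; congr pair; last exact: posp_id.
by rewrite (@posp_id _ (1 - y)) ?posp_id; lra.
Qed.

Lemma continuous_clamp : continuous clamp.
Proof.
suff c2 : continuous (fun z : R * R =>
    if D is Strip then posp (2 - posp (1 - z.2)) - 1 else posp z.2).
  by move=> z; exact: (cvg_pair (@cfst R z) (c2 z)).
have cp (g : R * R -> R) : continuous g -> continuous (fun z => posp (g z)).
  move=> cg z; apply: (@continuous_comp _ _ _ g (@posp R)); [exact: cg|exact: cposp].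
case: D; last exact: (cp _ (@csnd R)).
have c1 : continuous (fun z : R * R => posp (1 - z.2)).
  by apply: (cp (fun z => 1 - z.2)) => z; apply: cvgB; [exact: cvg_cst|exact: csnd].
have c3 : continuous (fun z : R * R => posp (2 - posp (1 - z.2))).
  by apply: (cp (fun z => 2 - posp (1 - z.2))) => z; apply: cvgB; [exact: cvg_cst|exact: c1].
by move=> z; apply: cvgB; [exact: c3|exact: cvg_cst].
Qed.

(** Interior points tending to z. They keep the first coordinate, and their height depends only on
    that of z, so a whole horizontal line is approached by horizontal lines. *)
Definition inner_pt (z : R * R) (n : nat) : R * R :=
  (z.1, if D is Strip then (1 - n.+1%:R^-1) * z.2 else z.2 + n.+1%:R^-1).

Lemma inner_dom z n : cdom D z -> dom R D (inner_pt z n).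
Proof.
have e0 := @eps_gt0 R n; have e1 : n.+1%:R^-1 <= 1 :> R by rewrite invf_le1// ler1n.
rewrite /inner_pt; move: (n.+1%:R^-1) e0 e1 => e e0 e1.
case: D => /=; last by lra.
move=> /andP[y1 y2].
have h1 : 0 <= (1 - e) * (1 - z.2) by apply: mulr_ge0; lra.
have h2 : 0 <= (1 - e) * (1 + z.2) by apply: mulr_ge0; lra.
by apply/andP; split; nra.
Qed.

Lemma inner_cvg z : inner_pt z @ \oo --> z.
Proof.
suff c2 : (inner_pt z n).2 @[n --> \oo] --> z.2.
  have c1 : (inner_pt z n).1 @[n --> \oo] --> z.1 by exact: cvg_cst.
  by case: z c1 c2 => x y c1 c2; exact: (cvg_pair c1 c2).
case: z => x y; rewrite /inner_pt /=.
have ce := @eps_cvg0 R; case: D => /=.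
  rewrite (_ : nbhs y = nbhs ((1 - 0) * y)); last by rewrite subr0 mul1r.
  by apply: cvgM; [apply: cvgB; [exact: cvg_cst|exact: ce]|exact: cvg_cst].
by rewrite -[X in _ --> X]addr0; apply: cvgD; [exact: cvg_cst|exact: ce].
Qed.

Lemma closed_cdom : closed (cdom D : set (R * R)).
Proof.
case: D => /=.
  rewrite (_ : mkset _ = (fun z => z.2) @^-1` `[-1, 1]%classic); last first.
    by apply/seteqP; split => z; rewrite /= in_itv.
  by apply: closed_comp; [move=> z _; exact: csnd|exact: interval_closed].
rewrite (_ : mkset _ = (fun z => z.2) @^-1` `[0, +oo[%classic); last first.
  by apply/seteqP; split => z; rewrite /= in_itv/= andbT.
by apply: closed_comp; [move=> z _; exact: csnd|exact: interval_closed].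
Qed.

Lemma closure_dom : closure (dom R D) = cdom D.
Proof.
apply/seteqP; split=> z.
  by move=> /(closure_subset (@dom_cdom R D)); exact: closed_cdom.
move=> Dz B /(@inner_cvg z) [N _ HN].
by exists (inner_pt z N); split; [exact: inner_dom|exact: (HN N (leqnn N))].
Qed.

Lemma continuous_comp_clamp (g : R * R -> R) :
  {within closure (dom R D), continuous g} -> continuous (g \o clamp).
Proof.
rewrite closure_dom => /subspace_continuousP cg z V nV.
have h : nbhs z (clamp @^-1` [set t | cdom D t -> V (g t)]).
  exact: (@continuous_clamp z _ (cg (clamp z) (clamp_cdom z) V nV)).
suff : nbhs z [set y | V (g (clamp y))] by [].
by apply: filterS h => y /= hy; apply: hy; exact: clamp_cdom.
Qed.

Lemma eq_cdom (g h : R * R -> R) : continuous g -> continuous h ->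
  (forall z, dom R D z -> g z = h z) -> forall z, cdom D z -> g z = h z.
Proof.
move=> cg ch gh z Dz.
have c1 : g (inner_pt z n) @[n --> \oo] --> g z.
  exact: (cvg_comp _ _ (@inner_cvg z) (cg z)).
have c2 : h (inner_pt z n) @[n --> \oo] --> h z.
  exact: (cvg_comp _ _ (@inner_cvg z) (ch z)).
rewrite -(cvg_lim (@Rhausdorff R) c1) -(cvg_lim (@Rhausdorff R) c2).
have -> : (fun n => g (inner_pt z n)) = (fun n => h (inner_pt z n)); last by [].
by apply/funext => n; rewrite gh//; exact: inner_dom.
Qed.

Lemma dom_nbhs_y (x y : R) : dom R D (x, y) -> \forall t \near y, dom R D (x, t).
Proof.
case: D => /= h; near=> t.
  apply/andP; split; near: t; [apply: (cvgr_gt y cvg_id)|apply: (cvgr_lt y cvg_id)]; lra.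
by near: t; exact: (cvgr_gt y cvg_id).
Unshelve. all: by end_near. Qed.

Lemma is_derive_pd (g : R * R -> R) (i : bool) z : differentiable g z ->
  is_derive (if i then z.2 else z.1) 1
    (fun t => g (if i then (z.1, t) else (t, z.2))) (pd i g z).
Proof.
move=> dg; apply/is_derive1P.
have := @diff_derivable _ _ _ g z (if i then (0, 1) else (1, 0)) dg.
rewrite /pd /derivable /derive.
set q := (fun h : R => h^-1 *: _); set q' := (fun h : R => _ / h).
suff -> : q = q' by [].
apply/funext => h; rewrite /q /q' mulrC /GRing.scale /=; congr (_ * (_ - _)).
  congr g; rewrite /scale_pair /GRing.scale {q q'}; case: z dg => x y _; case: i => /=;
  by rewrite mulr0 mulr1; congr pair; rewrite /= ?add0r// addrC.
by congr g; rewrite {q q'}; case: z dg => x y _; case: i.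
Qed.

End clamp.

(** * From the hypotheses to the record of extended functions *)

Section bridge.
Context (R : realType) (D : flow_domain) (v : R * R -> R * R) (P : R * R -> R).
Hypotheses (v1_C1 : C1_closure (dom R D) (comp1 v))
  (v2_C1 : C1_closure (dom R D) (comp2 v))
  (v_euler : euler (dom R D) v P) (v_slip : slip D v).

Lemma is_derive_ext (g : R * R -> R) (i : bool) (x y : R) : dom R D (x, y) ->
  differentiable g (x, y) ->
  is_derive (if i then y else x) 1
    (fun t => g (clamp D (if i then (x, t) else (t, y)))) (pd i g (x, y)).
Proof.
move=> xy dg; have := is_derive_pd i dg; case: i => /= H.
  apply: near_eq_is_derive H; have := dom_nbhs_y xy; apply: filterS => t xt.
  by rewrite clamp_id//; exact: dom_cdom.
apply: near_eq_is_derive H; near=> t.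
by rewrite clamp_id//; apply: dom_cdom; case: (D) xy.
Unshelve. all: by end_near. Qed.

(** Incompressibility, in the form [b2] = -[a1], turns -(v . grad) v into (F2, -F1), the gradient of
    the pressure. It holds on the closed domain by continuity, and then everywhere through the
    projection. *)
Lemma flow_exists : exists f : flow R D,
  [/\ forall z, cdom D z -> v1 f z = (v z).1 /\ v2 f z = (v z).2,
      forall z, dom R D z -> a1 f z = pd false (comp1 v) z /\ a2 f z = pd true (comp1 v) z &
      forall z, dom R D z -> b1 f z = pd false (comp2 v) z /\ b2 f z = pd true (comp2 v) z].
Proof.
have [c1 d1 e1] := v1_C1; have [c2 d2 e2] := v2_C1.
have [dP eu] := v_euler.
have [g1 [cg1 g1E]] := e1 false; have [g2 [cg2 g2E]] := e1 true.
have [k1 [ck1 k1E]] := e2 false; have [k2 [ck2 k2E]] := e2 true.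
have cl z : dom R D z -> clamp D z = z by move=> /dom_cdom; exact: clamp_id.
have divf z : cdom D z -> (k2 \o clamp D) z = - (g1 \o clamp D) z.
  apply: (@eq_cdom R D (k2 \o clamp D) (fun z => - (g1 \o clamp D) z)).
  - exact: continuous_comp_clamp.
  - by move=> y; apply: cvgN; exact: continuous_comp_clamp.
  - move=> y Dy /=; rewrite cl// -k2E// -g1E//; have [_ _ /eqP] := eu y Dy.
    by rewrite addrC addr_eq0 => /eqP.
have ext (g : R * R -> R) (g' : R * R -> R) (i : bool) (x y : R) :
    (forall z, dom R D z -> differentiable g z) ->
    (forall z, dom R D z -> pd i g z = g' z) -> dom R D (x, y) ->
    is_derive (if i then y else x) 1
      (fun t => g (clamp D (if i then (x, t) else (t, y)))) ((g' \o clamp D) (x, y)).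
  move=> dg gE xy; rewrite /= cl// -gE//; apply: is_derive_ext => //; exact: dg.
have dPi (i : bool) (x y : R) : dom R D (x, y) ->
   is_derive (if i then y else x) 1 (fun t => P (if i then (x, t) else (t, y))) (pd i P (x, y)).
  by move=> xy; have := is_derive_pd i (dP _ xy); case: i.
unshelve eexists; first unshelve refine (@Flow R D (comp1 v \o clamp D) (comp2 v \o clamp D)
  (g1 \o clamp D) (g2 \o clamp D) (k1 \o clamp D) (k2 \o clamp D) P
  _ _ _ _ _ _ _ _ _ _ _ _ _ _ _); try exact: continuous_comp_clamp.
- by move=> x y xy; exact: (ext _ _ false x y d1 g1E xy).
- by move=> x y xy; exact: (ext _ _ true x y d1 g2E xy).
- by move=> x y xy; exact: (ext _ _ false x y d2 k1E xy).
- by move=> x y xy; exact: (ext _ _ true x y d2 k2E xy).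
- move=> x y xy; apply: (is_derive_eq (dPi false x y xy)).
  have [/eqP E _ _] := eu _ xy; rewrite divf; last exact: dom_cdom.
  move: E; rewrite addrC addr_eq0 => /eqP ->; rewrite /= cl// g1E// g2E//.
  by rewrite /comp1 /comp2 mulrN; ring.
- move=> x y xy; apply: (is_derive_eq (dPi true x y xy)).
  have [_ /eqP E _] := eu _ xy.
  have := divf (x, y) (dom_cdom xy); rewrite /= cl// => divf'.
  move: E; rewrite addrC addr_eq0 => /eqP ->; rewrite k1E// k2E// divf'.
  by rewrite /comp1 /comp2 mulrN.
- move=> z; have := divf _ (clamp_cdom D z).
  by rewrite /= (clamp_id (clamp_cdom D z)).
- move=> w x wD; rewrite /= clamp_id; last exact: wall_cdom.
  exact: v_slip.
- by move=> z; exists (clamp D z); [exact: clamp_cdom|rewrite /= (clamp_id (clamp_cdom D z))].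
split=> z /= Dz; last 2 first.
- by rewrite cl// -g1E// -g2E.
- by rewrite cl// -k1E// -k2E.
by rewrite clamp_id.
Qed.

End bridge.

(** * Translation of curvature, growth, flux and angles *)

Section transfer.
Context (R : realType) (D : flow_domain) (v : R * R -> R * R) (f : flow R D).
Hypothesis vE : forall z, cdom D z -> v1 f z = (v z).1 /\ v2 f z = (v z).2.
Hypothesis aE : forall z, dom R D z ->
  a1 f z = pd false (comp1 v) z /\ a2 f z = pd true (comp1 v) z.
Hypothesis bE : forall z, dom R D z ->
  b1 f z = pd false (comp2 v) z /\ b2 f z = pd true (comp2 v) z.

Lemma enorm_sqr (z : R * R) : enorm z ^+ 2 = z.1 ^+ 2 + z.2 ^+ 2.
Proof. by rewrite sqr_sqrtr// addr_ge0 ?sqr_ge0. Qed.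

Lemma speed2_enorm z : cdom D z -> speed2 f z = enorm (v z) ^+ 2.
Proof. by move=> Dz; rewrite enorm_sqr /speed2; have [-> ->] := vE Dz. Qed.

Lemma total_curvatureE : total_curvature D v = (\int[leb2 R]_(z in dom R D) (curv f z)%:E)%E.
Proof.
apply: eq_integral => z /set_mem Dz; congr EFin.
rewrite /curvature_density -speed2_enorm; last exact: dom_cdom.
rewrite enorm_sqr /curv /F1 /F2 /=.
have [-> ->] := vE (dom_cdom Dz); have [-> ->] := aE Dz; have [-> ->] := bE Dz.
by [].
Qed.

Lemma flow_growth_of : growth D v -> exists2 C : R, 0 <= C & flow_growth f C.
Proof.
move=> [C C0 HC]; exists (C ^+ 2); first exact: sqr_ge0.
move=> r z r1 Dz zr; have [r0 r1'] : 0 < r /\ 1 < r by split; lra.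
have rz : growth_region D r z.
  case: (D) Dz zr => /= Dz zr.
    by split; rewrite /= in_itv/=; [rewrite -ler_norml|lra].
  split=> //; rewrite /= /enorm -(ger0_norm (ltW r0)) -sqrtr_sqr; exact: ler_wsqrtr.
have : (enorm (v z) <= C * growth_rate D r)%R.
  rewrite -lee_fin; apply: le_trans (HC r r1); apply: ereal_sup_ubound.
  by exists z.
rewrite speed2_enorm; last exact: dom_cdom.
have e0 : 0 <= enorm (v z) by exact: sqrtr_ge0.
move=> h; apply: (@le_trans _ _ ((C * growth_rate D r) ^+ 2)).
  by rewrite lerXn2r// nnegrE; exact: le_trans h.
rewrite exprMn /growth_rate; case: (D); rewrite sqr_sqrtr//; first exact: ltW.
by rewrite ltW// ln_gt0.
Qed.

Lemma inward_dom w x (h : R) : w \in walls R D -> 0 < h < 1 -> dom R D (x, w.1 - h * w.2).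
Proof.
by case: D => /=; rewrite !inE; [move=> /orP[]/eqP -> /=; lra|move=> /eqP -> /=; lra].
Qed.

Lemma wall_normal w : w \in walls R D -> w.2 = 1 \/ w.2 = -1.
Proof.
by case: D => /=; rewrite !inE; [move=> /orP[]/eqP -> /=; [right|left]|move=> /eqP -> /=; right].
Qed.

(** On the wall [b2] is only the limit of interior derivatives; the mean value theorem along the
    inner normal makes it the one-sided derivative. *)
Lemma wall_quotient_cvg w x : w \in walls R D ->
  (v2 f (x, w.1) - v2 f (x, w.1 - h * w.2)) / h @[h --> 0^'+] --> w.2 * b2 f (x, w.1).
Proof.
move=> wD; apply/cvgrPdist_le => e e0.
have : \forall y \near w.1, `|b2 f (x, w.1) - b2 f (x, y)| <= e.
  have := @continuous_snd_slice R _ x (@cb2 _ _ f) w.1.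
  by move=> /cvgrPdist_le; apply.
move=> /nbhs_ballP[d /= d0 Hd].
near=> h.
have h0 : 0 < h by near: h; exact: nbhs_right_gt.
have h1 : h < 1 by near: h; exact: nbhs_right_lt.
have hd : h < d by near: h; exact: nbhs_right_lt.
have n2 : w.2 ^+ 2 = 1 by have [->|->] := wall_normal wD; ring.
have nn : `|w.2| = 1 by have [->|->] := wall_normal wD; rewrite ?normrN normr1.
(* parametrize by the distance s to the wall *)
have dg (s : R) : s \in `]0, h[ -> is_derive s 1 (fun s => v2 f (x, w.1 - s * w.2))
    (- (w.2 * b2 f (x, w.1 - s * w.2))).
  rewrite in_itv/= => /andP[s0 sh].
  have Ds : dom R D (x, w.1 - s * w.2) by apply: inward_dom => //; lra.
  have := @is_derive1_comp R (fun y => v2 f (x, y)) (fun s => w.1 - s * w.2) s _ _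
    (dv22 f Ds) (is_deriveB (is_derive_cst w.1 s 1)
      (is_deriveM (is_derive_id s 1) (is_derive_cst w.2 s 1))).
  by move/is_derive_eq; apply; rewrite /GRing.scale /=; ring.
have [] := @MVT R (fun s => v2 f (x, w.1 - s * w.2)) _ 0 h h0 dg.
  apply: continuous_subspaceT => s.
  apply: (@continuous_comp R R R (fun s : R => w.1 - s * w.2) (fun y => v2 f (x, y))).
    by apply: cvgB; [exact: cvg_cst|apply: cvgM; [exact: cvg_id|exact: cvg_cst]].
  exact: (@continuous_snd_slice R _ x (@cv2 _ _ f)).
move=> s; rewrite in_itv/= => /andP[s0 sh]; rewrite mul0r subr0 => E.
have -> : (v2 f (x, w.1) - v2 f (x, w.1 - h * w.2)) / h = w.2 * b2 f (x, w.1 - s * w.2).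
  by rewrite -opprB E; field; exact: lt0r_neq0.
rewrite -mulrBr normrM nn mul1r; apply: Hd.
rewrite /ball /= opprB addrC subrK normrM nn mulr1 gtr0_norm//; lra.
Unshelve. all: by end_near. Qed.

Lemma dnormalE w x : w \in walls R D ->
  dnormal (0, w.2) (comp2 v) (x, w.1) = w.2 * b2 f (x, w.1).
Proof.
move=> wD; apply: cvg_lim => //; apply: cvg_trans (@wall_quotient_cvg w x wD).
apply: near_eq_cvg; near=> h.
have h0 : 0 < h by near: h; exact: nbhs_right_gt.
have h1 : h < 1 by near: h; exact: nbhs_right_lt.
have [_ ->] := vE (wall_cdom x wD).
have Dh : dom R D (x, w.1 - h * w.2) by apply: inward_dom => //; rewrite h0.
have [_ ->] := vE (dom_cdom Dh).
rewrite /comp2; congr (((v _).2 - (v _).2) / _).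
by transitivity (x - h * 0, w.1 - h * w.2); [rewrite mulr0 subr0|].
Unshelve. all: by end_near. Qed.

Lemma boundary_fluxE r : boundary_flux D v r = bcut D r (fun z => `|v1 f z| * b2 f z).
Proof.
rewrite /boundary_flux /bcut !big_seq; apply: eq_bigr => w wD.
apply: eq_Rintegral => x _; rewrite dnormalE//; have [-> _] := vE (wall_cdom x wD).
by ring.
Qed.

Lemma flow_anglesE : flow_angles v (closure (dom R D)) =
  [set (Num.sqrt (speed2 f z))^-1 *: (v1 f z, v2 f z) | z in
     cdom D `&` [set z | 0 < speed2 f z]].
Proof.
rewrite /flow_angles closure_dom; apply/seteqP; split=> u [z [Dz z0] <-].
  exists z.
    split=> //=; rewrite speed2_enorm// exprn_gt0//.
  rewrite speed2_enorm// sqrtr_sqr ger0_norm ?sqrtr_ge0//.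
  by have [-> ->] := vE Dz; rewrite -surjective_pairing.
exists z.
  split=> //=; rewrite /= speed2_enorm// in z0.
  by rewrite lt0r sqrtr_ge0 andbT; apply: contraL z0 => /eqP E; rewrite E expr0n ltxx.
rewrite speed2_enorm// sqrtr_sqr ger0_norm ?sqrtr_ge0//.
by have [-> ->] := vE Dz; rewrite -surjective_pairing.
Qed.

End transfer.

(** * Mean values and derivatives along lines *)

Lemma MVT_unordered (R : realType) (g dg : R -> R) (a b : R) :
  (forall x : R, `|x - a| <= `|b - a| -> is_derive x 1 g (dg x)) ->
  exists2 x : R, `|x - a| <= `|b - a| & g b - g a = dg x * (b - a).
Proof.
move=> H; have cg (x : R) : `|x - a| <= `|b - a| -> {for x, continuous g}.
  by move=> h; exact: is_derive_cts (H x h).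
have ct (c d : R) : (forall x : R, x \in `[c, d] -> {for x, continuous g}) ->
    {within `[c, d], continuous g}.
  by move=> h; apply: continuous_in_subspaceT => x /set_mem; exact: h.
have [ab|ab|->] := ltgtP a b; last first.
- by exists b; rewrite ?subrr ?normr0 ?mulr0.
- have near_a (x : R) : b <= x <= a -> `|x - a| <= `|b - a|.
    by move=> ?; rewrite !ler0_norm; lra.
  have [||x xI E] := @MVT R g dg b a ab.
  + by move=> x; rewrite in_itv/= => ?; apply: H; apply: near_a; lra.
  + by apply: ct => x; rewrite in_itv/= => ?; apply: cg; exact: near_a.
  exists x; first by apply: near_a; move: xI; rewrite in_itv/=; lra.
  by rewrite -opprB E; ring.
- have near_a (x : R) : a <= x <= b -> `|x - a| <= `|b - a|.
    by move=> ?; rewrite !ger0_norm; lra.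
  have [||x xI E] := @MVT R g dg a b ab.
  + by move=> x; rewrite in_itv/= => ?; apply: H; apply: near_a; lra.
  + by apply: ct => x; rewrite in_itv/= => ?; apply: cg; exact: near_a.
  by exists x => //; apply: near_a; move: xI; rewrite in_itv/=; lra.
Qed.

(** The chain rule from continuous partial derivatives: the increment is split into a horizontal and
    a vertical one, and the mean value theorem is applied to each. *)
Lemma is_derive_line (R : realType) (D : flow_domain) (g g1 g2 : R * R -> R) :
  continuous g1 -> continuous g2 ->
  (forall x y : R, dom R D (x, y) -> is_derive x 1 (fun x => g (x, y)) (g1 (x, y))) ->
  (forall x y : R, dom R D (x, y) -> is_derive y 1 (fun y => g (x, y)) (g2 (x, y))) ->
  forall x y c t : R, dom R D (x + c * t, y + t) ->
  is_derive t 1 (fun t => g (x + c * t, y + t))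
    (c * g1 (x + c * t, y + t) + g2 (x + c * t, y + t)).
Proof.
move=> c1 c2 dg1 dg2 x y c t; set X := x + c * t; set Y := y + t => XY.
apply/is_derive1P/cvgrPdist_le => e e0.
have c0 : 0 < `|c| + 1 by rewrite ltr_wpDl.
pose e' := e / (`|c| + 1); have e'0 : 0 < e' by exact: divr_gt0.
have box_near (h : R * R -> R) : continuous h -> exists2 d : R, 0 < d &
    forall u w, `|u - X| < d -> `|w - Y| < d -> `|h (u, w) - h (X, Y)| <= e'.
  move=> ch; have /cvgrPdist_le/(_ _ e'0) := ch (X, Y).
  move=> [[U V] [/= /nbhs_ballP[d1 /= d10 hU] /nbhs_ballP[d2 /= d20 hV]] hUV].
  exists (Num.min d1 d2); first by rewrite lt_min d10.
  move=> u w; rewrite !lt_min => /andP[u1 u2] /andP[w1 w2]; rewrite distrC.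
  by apply: (hUV (u, w)); split; [apply: hU|apply: hV]; rewrite /ball /= distrC.
have [d1 d10 H1] := box_near g1 c1; have [d2 d20 H2] := box_near g2 c2.
have [d3 d30 H3] : exists2 d : R, 0 < d & forall w u, `|w - Y| < d -> dom R D (u, w).
  have /nbhs_ballP[d /= d0 Hd] := dom_nbhs_y XY; exists d => // w u wd.
  have := Hd w; rewrite /ball /= distrC => /(_ wd); by case: (D).
have small (d : R) : 0 < d -> \forall h \near (0 : R)^', `|h| < d / (`|c| + 1).
  move=> d0; apply: nbhs_dnbhs; have dc : 0 < d / (`|c| + 1) by exact: divr_gt0.
  apply/nbhs_ballP; exists (d / (`|c| + 1)) => // u.
  by rewrite -ball_normE /= sub0r normrN.
near=> h.
have h0 : h != 0 by near: h; exact: nbhs_dnbhs_neq.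
have step (d : R) : `|h| < d / (`|c| + 1) -> `|h| < d /\ `|c * h| < d.
  rewrite ltr_pdivlMr// mulrDr mulr1 normrM mulrC => hd.
  have := normr_ge0 h; have : 0 <= `|c| * `|h| by rewrite mulr_ge0.
  by lra.
have [h1 ch1] : `|h| < d1 /\ `|c * h| < d1 by apply: step; near: h; exact: small.
have [h2 ch2] : `|h| < d2 /\ `|c * h| < d2 by apply: step; near: h; exact: small.
have [h3 ch3] : `|h| < d3 /\ `|c * h| < d3 by apply: step; near: h; exact: small.
have XE : x + c * (t + h) = X + c * h by rewrite /X; ring.
have YE : y + (t + h) = Y + h by rewrite /Y; ring.
rewrite XE YE.
have [u uX Eu] := @MVT_unordered R (fun u => g (u, Y + h)) (fun u => g1 (u, Y + h)) X (X + c * h)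
  (fun u _ => dg1 u (Y + h) (H3 (Y + h) u ltac:(by rewrite addrC addKr))).
have Dw (w : R) : `|w - Y| <= `|Y + h - Y| -> is_derive w 1 (fun w => g (X, w)) (g2 (X, w)).
  move=> wY; apply: dg2; apply: H3; apply: (le_lt_trans wY).
  by rewrite addrC addKr.
have [w wY Ew] := MVT_unordered Dw.
have -> : (g (X + c * h, Y + h) - g (X, Y)) / h = c * g1 (u, Y + h) + g2 (X, w).
  have -> : g (X + c * h, Y + h) - g (X, Y) =
    (g (X + c * h, Y + h) - g (X, Y + h)) + (g (X, Y + h) - g (X, Y)) by ring.
  by rewrite Eu Ew; field.
rewrite distrC (_ : _ - _ = c * (g1 (u, Y + h) - g1 (X, Y)) + (g2 (X, w) - g2 (X, Y))); last by ring.
apply: (le_trans (ler_normD _ _)).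
have A : `|g1 (u, Y + h) - g1 (X, Y)| <= e'.
  apply: H1; last by rewrite addrC addKr.
  by apply: (le_lt_trans uX); rewrite addrC addKr.
have B : `|g2 (X, w) - g2 (X, Y)| <= e'.
  apply: H2; first by rewrite subrr normr0.
  by apply: (le_lt_trans wY); rewrite addrC addKr.
have -> : e = `|c| * e' + e' by rewrite /e'; field; exact: lt0r_neq0.
by rewrite normrM lerD// ler_wpM2l.
Unshelve. all: by end_near. Qed.

(** * The equality case *)

Section characteristics.
Context (R : realType) (D : flow_domain) (f : flow R D).

(* Where F = 0 and v_2 < 0, v is constant along the line in direction v, which
   runs into the lower wall, where v_2 = 0. *)
Lemma v2_ge0_of_F_eq0 :
  (forall z, dom R D z -> v2 f z < 0 -> F1 f z = 0 /\ F2 f z = 0) ->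
  forall z, dom R D z -> 0 <= v2 f z.
Proof.
move=> F0 [x0 y0] D0; rewrite leNgt; apply/negP => v20.
(* The direction (c, 1) is parallel to v at the starting point, so c is also the ratio v_1 / v_2 to
   be propagated. *)
set c := v1 f (x0, y0) / v2 f (x0, y0).
pose pt t : R * R := (x0 + c * t, y0 + t).
pose u t := v1 f (pt t); pose p t := v2 f (pt t).
have cpt : continuous pt.
  have cp1 : continuous (fun t : R => x0 + c * t).
    move=> t; apply: cvgD; first exact: cvg_cst.
    by apply: cvgM; [exact: cvg_cst|exact: cvg_id].
  have cp2 : continuous (fun t : R => y0 + t).
    by move=> t; apply: cvgD; [exact: cvg_cst|exact: cvg_id].
  by move=> t; exact: (cvg_pair (cp1 t) (cp2 t)).
have cu : continuous u by move=> t; exact: (continuous_comp (@cpt t) (@cv1 _ _ f (pt t))).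
have cp : continuous p by move=> t; exact: (continuous_comp (@cpt t) (@cv2 _ _ f (pt t))).
pose t1 := floor_of R D - y0.
have t10 : t1 < 0 by rewrite /t1; move: D0; case: (D) => /=; lra.
have Dt t : t1 < t -> t <= 0 -> dom R D (pt t).
  by rewrite /t1 /pt; move: D0; case: (D) => /=; lra.
have pt1 : p t1 = 0.
  rewrite /p /pt /t1 (_ : y0 + (floor_of R D - y0) = floor_of R D); last by ring.
  have wD : (floor_of R D, -1) \in walls R D by case: (D); rewrite /= !inE eqxx.
  exact: (v2_wall f _ wD).
have p0 : p 0 < 0 by rewrite /p /pt mulr0 !addr0.
have u0 : u 0 = c * p 0.
  by rewrite /u /p /pt mulr0 !addr0 /c divfK// lt_eqF.
(* Its supremum s is the last time before 0 at which v_2 >= 0; the wall time [t1] belongs to it. The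
   contradiction is sought on the interval from s to 0. *)
pose Z := [set t : R | t1 <= t <= 0 /\ 0 <= p t].
have Zt1 : Z t1 by split; [rewrite lexx ltW|rewrite pt1].
have Zub : ubound Z 0 by move=> t [/andP[]].
have supZ : has_sup Z by split; [exists t1|exists 0].
pose s := sup Z.
have clZ : closed Z.
  rewrite (_ : Z = `[t1, 0]%classic `&` (p @^-1` `[0, +oo[%classic)); last first.
    by apply/seteqP; split=> t; rewrite /Z /= !in_itv/= andbT.
  apply: closedI; first exact: interval_closed.
  by apply: closed_comp; [move=> t _; exact: cp|exact: interval_closed].
have [/andP[st1 s0] ps] : Z s.
  by apply: clZ; apply: closure_sup; [exists t1|exists 0].
have s_lt0 : s < 0.
  by rewrite lt_neqAle s0 andbT; apply/eqP => sE; move: ps; rewrite sE leNgt p0.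
have neg t : s < t -> t <= 0 -> p t < 0.
  move=> st t0; rewrite ltNge; apply/negP => pt0.
  have : t <= s by apply: (ub_le_sup (proj2 supZ)); split=> //; lra.
  lra.
have du t : s < t -> t <= 0 -> is_derive t 1 u (c * a1 f (pt t) + a2 f (pt t)).
  move=> st t0; apply: (is_derive_line (@ca1 _ _ f) (@ca2 _ _ f) (dv11 f) (dv12 f)).
  by apply: Dt => //; lra.
have dp t : s < t -> t <= 0 -> is_derive t 1 p (c * b1 f (pt t) + b2 f (pt t)).
  move=> st t0; apply: (is_derive_line (@cb1 _ _ f) (@cb2 _ _ f) (dv21 f) (dv22 f)).
  by apply: Dt => //; lra.
have FF t : s < t -> t <= 0 -> F1 f (pt t) = 0 /\ F2 f (pt t) = 0.
  by move=> st t0; apply: F0; [apply: Dt => //; lra|exact: neg].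
(* Along the line the derivative of v_1 / v_2 is -(c F1 + F2) / v_2^2 = 0. *)
have ratio t : s < t -> t < 0 -> u t = c * p t.
  move=> st t0.
  have dr x : x \in `]t, 0[ -> is_derive x 1 (fun t => u t * (p t)^-1) 0.
    rewrite in_itv/= => /andP[x1 x2]; have px : p x < 0 by apply: neg; lra.
    have [|F10 F20] := FF x _ (ltW x2); first by lra.
    have := is_deriveM (du x ltac:(lra) (ltW x2))
      (@is_deriveV R p x _ _ (ltr0_neq0 px) (dp x ltac:(lra) (ltW x2))).
    move/is_derive_eq; apply; rewrite /GRing.scale /=.
    have -> : u x * (- p x ^- 2 * (c * b1 f (pt x) + b2 f (pt x))) +
        (p x)^-1 * (c * a1 f (pt x) + a2 f (pt x)) =
        - (c * F1 f (pt x) + F2 f (pt x)) / p x ^+ 2.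
      by rewrite /F1 /F2 -/(u x) -/(p x); field; exact: ltr0_neq0.
    by rewrite F10 F20 mulr0 addr0 oppr0 mul0r.
  have [|x _] := MVT t0 dr.
    apply: continuous_in_subspaceT => x /set_mem; rewrite /= in_itv/= => /andP[x1 x2].
    have px : p x < 0 by apply: neg; lra.
    by apply: cvgM; [exact: cu|apply: cvgV; [exact: ltr0_neq0|exact: cp]].
  rewrite mul0r => /eqP; rewrite subr_eq0 => /eqP E.
  have pt' : p t < 0 by apply: neg; lra.
  have : u t / p t = c by rewrite -E u0 mulfK// ltr0_neq0.
  by move=> <-; rewrite divfK// ltr0_neq0.
(* With v_1 = c v_2 and [b2] = -[a1], F1 equals v_2 times the derivative of v_2 along the line. *)
have dp0 t : t \in `]s, 0[ -> is_derive t 1 p 0.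
  rewrite in_itv/= => /andP[st t0]; apply: (is_derive_eq (dp t st (ltW t0))).
  have [F10 _] := FF t st (ltW t0); have pt' : p t < 0 by apply: neg => //; lra.
  apply: (mulfI (ltr0_neq0 pt')); rewrite mulr0 -F10 /F1 -/(u t) -/(p t) (ratio t st t0).
  by rewrite (divfree f); ring.
have [|x _] := MVT s_lt0 dp0; first exact: continuous_subspaceT.
by rewrite mul0r => /eqP; rewrite subr_eq0 => /eqP E; move: ps; rewrite -E leNgt p0.
Qed.

Lemma Rintegral_gt0 (g : R * R -> R) (z0 : R * R) (e : R) :
  (leb2 R).-integrable (dom R D) (EFin \o g) -> (forall z, dom R D z -> 0 <= g z) ->
  dom R D z0 -> 0 < e -> (\forall z \near z0, e <= g z) ->
  0 < \int[leb2 R]_(z in dom R D) g z.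
Proof.
move=> ig g0 D0 e0.
move=> [[U V] [/= /nbhs_ballP[d1 /= d10 hU] /nbhs_ballP[d2 /= d20 hV]] hUV].
case: z0 D0 hU hV => x0 y0 D0 /= hU hV.
have /nbhs_ballP[d3 /= d30 Hd] := dom_nbhs_y D0.
pose d := Num.min d1 (Num.min d2 d3).
have d0 : 0 < d by rewrite !lt_min d10 d20.
have [dd1 dd2 dd3] : [/\ d <= d1, d <= d2 & d <= d3].
  by rewrite /d !ge_min !lexx !orbT.
pose B := (`]x0 - d, x0 + d[%classic `*` `]y0 - d, y0 + d[%classic) : set (R * R).
have BD : B `<=` dom R D.
  move=> [x y] [/=]; rewrite !in_itv/= => xI yI.
  have : dom R D (x0, y).
    by apply: Hd; rewrite /ball /= ltr_norml; lra.
  by case: (D).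
have Bg z : B z -> e <= g z.
  case: z => x y [/=]; rewrite !in_itv/= => xI yI.
  by apply: (hUV (x, y)); split; [apply: hU|apply: hV]; rewrite /ball /= ltr_norml; lra.
have mB : measurable (B : set (measurableTypeR R * measurableTypeR R)).
  exact: measurable_itvX.
have iB : (leb2 R).-integrable B (EFin \o g).
  by apply: integrableS ig => //; exact: measurable_dom.
apply: (@lt_le_trans _ _ (\int[leb2 R]_(z in B) e)).
  rewrite Rintegral_cst// /B leb2_box /=; [|lra|lra].
  by apply: mulr_gt0 => //; apply: mulr_gt0; lra.
apply: (@le_trans _ _ (\int[leb2 R]_(z in B) g z)).
  apply: le_Rintegral => //.
  by apply: box_integrable; [lra|lra|move=> z; exact: cvg_cst].
rewrite -lee_fin /Rintegral !fineK; last 2 first.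
- exact: (integrable_fin_num (@measurable_dom R D) ig).
- exact: (integrable_fin_num mB iB).
apply: ge0_subset_integral => //; first exact: measurable_dom.
by apply/measurable_EFinP; have /integrableP[/measurable_EFinP] := ig.
Qed.

Lemma curv_near z : dom R D z -> (F1 f z, F2 f z) != (0, 0) ->
  exists2 e : R, 0 < e & \forall y \near z, e <= curv f y.
Proof.
move=> Dz Fz; have m0 : speed2 f z != 0.
  by apply: contra Fz => /eqP /F_speed2_eq0[-> ->].
have mp : 0 < speed2 f z by rewrite lt0r m0 speed2_ge0.
have cz : curv f y @[y --> z] --> curv f z.
  apply: cvgM; first by apply: cvgD; apply: continuous_sqr; [exact: cF1|exact: cF2].
  by apply: cvgV => //; exact: cspeed2.
have c0 : 0 < curv f z.
  apply: divr_gt0 => //; rewrite lt0r addr_ge0 ?sqr_ge0// andbT.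
  by rewrite paddr_eq0 ?sqr_ge0// !sqrf_eq0; apply: contra Fz => /andP[/eqP-> /eqP->].
exists (curv f z / 2); first by rewrite divr_gt0.
by apply: (cvgr_ge (curv f z) cz); lra.
Qed.

End characteristics.

Lemma is_derive_unique (R : realType) (g : R -> R) (x a b : R) :
  is_derive x 1 g a -> is_derive x 1 g b -> a = b.
Proof. by move=> [_ <-] [_ <-]. Qed.

(** * Reversal of the flow *)

Section reversal.
Context (R : realType) (D : flow_domain) (f : flow R D).

(** The Euler equations are quadratic in v, so -v is a solution with the same pressure; this
    exchanges the two signs of v_2. *)
Lemma reversal_exists : exists g : flow R D,
  [/\ forall z, v1 g z = - v1 f z, forall z, v2 g z = - v2 f z,
      forall z, F1 g z = F1 f z & forall z, F2 g z = F2 f z].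
Proof.
have cN (h : R * R -> R) : continuous h -> continuous (fun z => - h z).
  by move=> ch z; apply: cvgN; exact: ch.
unshelve eexists; first unshelve refine (@Flow R D (fun z => - v1 f z) (fun z => - v2 f z)
  (fun z => - a1 f z) (fun z => - a2 f z) (fun z => - b1 f z) (fun z => - b2 f z) (pr f)
  _ _ _ _ _ _ _ _ _ _ _ _ _ _ _).
- exact: (cN _ (@cv1 _ _ f)).
- exact: (cN _ (@cv2 _ _ f)).
- exact: (cN _ (@ca1 _ _ f)).
- exact: (cN _ (@ca2 _ _ f)).
- exact: (cN _ (@cb1 _ _ f)).
- exact: (cN _ (@cb2 _ _ f)).
- by move=> x y xy; apply: is_deriveN; exact: dv11.
- by move=> x y xy; apply: is_deriveN; exact: dv12.
- by move=> x y xy; apply: is_deriveN; exact: dv21.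
- by move=> x y xy; apply: is_deriveN; exact: dv22.
- by move=> x y xy; rewrite !mulrNN; exact: dpr1.
- by move=> x y xy; rewrite !mulrNN; exact: dpr2.
- by move=> z; rewrite (divfree f).
- by move=> w x wD; rewrite (v2_wall f x wD) oppr0.
- by move=> z; have [z' Dz' [-> ->]] := v_cdom f z; exists z'.
by split=> z //=; rewrite /F1 /F2 /= !mulrNN.
Qed.

End reversal.

(** * Flows with v_2 nonnegative *)

Section walls.
Context (R : realType) (D : flow_domain) (f : flow R D).
Notation mu := (@lebesgue_measure R).

(** Derivatives are known only inside. The quotients on nearby horizontal lines are mean values of
    [a1], close to its wall value, and they tend to the quotient on the wall. *)
Lemma wall_derive w (x : R) : w \in walls R D ->
  is_derive x 1 (fun x => v1 f (x, w.1)) (a1 f (x, w.1)).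
Proof.
move=> wD; apply/is_derive1P/cvgrPdist_le => e e0.
have /cvgrPdist_le/(_ _ e0) := @ca1 _ _ f (x, w.1).
move=> [[U V] [/= /nbhs_ballP[d1 /= d10 hU] /nbhs_ballP[d2 /= d20 hV]] hUV].
have small : \forall h \near (0 : R)^', `|h| < d1.
  apply: nbhs_dnbhs; apply/nbhs_ballP; exists d1 => // u.
  by rewrite -ball_normE /= sub0r normrN.
near=> h.
have h0 : h != 0 by near: h; exact: nbhs_dnbhs_neq.
have hd : `|h| < d1 by near: h.
pose yn n : R := (inner_pt D (x, w.1) n).2.
have cyn (u : R) : (u, yn n) @[n --> \oo] --> (u, w.1) by exact: (@inner_cvg R D (u, w.1)).
have Dn (u : R) n : dom R D (u, yn n) by exact: (@inner_dom R D (u, w.1) n (wall_cdom u wD)).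
have cv (u : R) : v1 f (u, yn n) @[n --> \oo] --> v1 f (u, w.1).
  exact: (cvg_comp _ _ (cyn u) (@cv1 _ _ f (u, w.1))).
have cq : `|a1 f (x, w.1) - (v1 f (x + h, yn n) - v1 f (x, yn n)) / h| @[n --> \oo] -->
    `|a1 f (x, w.1) - (v1 f (x + h, w.1) - v1 f (x, w.1)) / h|.
  apply: cvg_norm; apply: cvgB; first exact: cvg_cst.
  by apply: cvgM; [apply: cvgB; exact: cv|exact: cvg_cst].
apply: (cvgr_to_le cq).
have cy : yn n @[n --> \oo] --> w.1 by exact: (cvg_comp _ _ (cyn x) (@csnd R (x, w.1))).
have : \forall n \near \oo, V (yn n) by apply: cy; apply/nbhs_ballP; exists d2.
apply: filterS => n Vn.
have [u uI ->] := @MVT_unordered R (fun u => v1 f (u, yn n)) (fun u => a1 f (u, yn n)) x (x + h)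
  (fun u _ => dv11 f (Dn u n)).
have -> : a1 f (u, yn n) * (x + h - x) / h = a1 f (u, yn n) by field.
apply: (hUV (u, yn n)); split=> //; apply: hU; rewrite -ball_normE /= distrC.
by apply: (le_lt_trans uI); rewrite addrC addKr.
Unshelve. all: by end_near. Qed.

Hypothesis v2_ge0 : forall z, dom R D z -> 0 <= v2 f z.

(** On the wall v_2 attains its minimum 0, so its outer normal derivative is at most 0, and by
    incompressibility this derivative is minus the quantity in question. *)
Lemma wall_sign w x : w \in walls R D -> 0 <= w.2 * a1 f (x, w.1).
Proof.
move=> wD; have := @wall_quotient_cvg R D f w x wD; rewrite (divfree f) mulrN => H.
rewrite -oppr_le0; apply: (cvgr_to_le H); near=> h.
have h0 : 0 < h by near: h; exact: nbhs_right_gt.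
have h1 : h < 1 by near: h; exact: nbhs_right_lt.
have Dh : dom R D (x, w.1 - h * w.2) by apply: inward_dom => //; rewrite h0.
rewrite (v2_wall f x wD) sub0r mulNr oppr_le0 divr_ge0 ?v2_ge0//; exact: ltW.
Unshelve. all: by end_near. Qed.

Lemma wall_monotone w (x y : R) : w \in walls R D -> x <= y ->
  w.2 * v1 f (x, w.1) <= w.2 * v1 f (y, w.1).
Proof.
move=> wD xy; have [u _ E] := @MVT_unordered R (fun u => v1 f (u, w.1))
  (fun u => a1 f (u, w.1)) x y (fun u _ => @wall_derive w u wD).
rewrite -subr_ge0 -mulrBr E mulrA mulr_ge0 ?wall_sign//; lra.
Qed.

Lemma v2_ge0_cdom z : cdom D z -> 0 <= v2 f z.
Proof.
move=> Dz; have c1 : v2 f (inner_pt D z n) @[n --> \oo] --> v2 f z.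
  exact: (cvg_comp _ _ (@inner_cvg R D z) (@cv2 _ _ f z)).
by apply: (cvgr_to_ge c1); apply: nearW => n; apply: v2_ge0; exact: inner_dom.
Qed.

(** An interior zero of v_2 is a minimum, so both v_2 and its gradient vanish there. Hence sgn(v_2)
    may be dropped from the curvature integral. *)
Lemma F_eq0_of_v2_eq0 z : dom R D z -> v2 f z = 0 -> F1 f z = 0 /\ F2 f z = 0.
Proof.
case: z => x y xy v20; have Dx u : dom R D (u, y) by move: xy; case: (D).
have b10 : b1 f (x, y) = 0.
  have H : is_derive x 1 (fun x => v2 f (x, y)) 0.
    apply: (@derive1_at_min R _ (x - 1) (x + 1)); first by lra.
    - by move=> t _; have [] := dv21 f (Dx t).
    - by rewrite in_itv/=; lra.
    - by move=> t _; rewrite v20; exact: v2_ge0.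
  exact: (is_derive_unique (dv21 f xy) H).
have b20 : b2 f (x, y) = 0.
  have /nbhs_ballP[d /= d0 Hd] := dom_nbhs_y xy.
  have Dy t : t \in `](y - d), (y + d)[ -> dom R D (x, t).
    by rewrite in_itv/= => tI; apply: Hd; rewrite -ball_normE /= ltr_norml; lra.
  have H : is_derive y 1 (fun y => v2 f (x, y)) 0.
    apply: (@derive1_at_min R _ (y - d) (y + d)); first by lra.
    - by move=> t tI; have [] := dv22 f (Dy t tI).
    - by rewrite in_itv/=; lra.
    - by move=> t tI; rewrite v20; apply: v2_ge0; exact: Dy.
  exact: (is_derive_unique (dv22 f xy) H).
by rewrite /F1 /F2 v20 b10 b20 !mulr0 !mul0r subrr.
Qed.

Lemma sg_curvE z : dom R D z -> Num.sg (v2 f z) * curv f z = curv f z.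
Proof.
move=> Dz; have := v2_ge0 Dz; rewrite le_eqVlt => /orP[/eqP/esym v20|v20].
  have [F10 F20] := F_eq0_of_v2_eq0 Dz v20.
  by rewrite /curv F10 F20 expr0n /= addr0 mul0r mulr0.
by rewrite gtr0_sg// mul1r.
Qed.

Lemma is_derive_half_sq_abs (x : R) : is_derive x 1 (fun x => x * `|x| / 2) `|x|.
Proof.
have E (y : R) : y * `|y| / 2 = (posp y ^+ 2 - posp (- y) ^+ 2) / 2.
  have [y0|y0] := leP 0 y.
    rewrite ger0_norm// posp_id// posp_eq0; [by rewrite expr0n /= subr0 expr2|lra].
  by rewrite ltr0_norm// posp_eq0 ?posp_id; [rewrite expr0n /=; ring|lra|lra].
rewrite (_ : (fun x => _) = fun y : R => (posp y ^+ 2 - posp (- y) ^+ 2) / 2); last exact/funext.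
have H := @is_derive1_comp R (fun y => posp y ^+ 2) (fun y => - y) x _ _
  (is_derive_posp2 (- x)) (is_deriveN (is_derive_id x 1)).
have := is_deriveM (is_deriveB (is_derive_posp2 x) H) (is_derive_cst (2^-1 : R) x 1).
move/is_derive_eq; apply; rewrite /GRing.scale /=.
have [x0|x0] := leP 0 x.
  by rewrite ger0_norm// posp_id// (@posp_eq0 _ (- x)); [field|lra].
by rewrite ltr0_norm// (@posp_eq0 _ x) ?posp_id; [field|lra|lra].
Qed.

(** The gradient of a square keeps one factor of the cutoff, which the absorption in
    [curv_integrable] needs. *)
Lemma test_fun_sqr (M : R) (t : test_fun D M) : exists u : test_fun D M,
  [/\ forall z, tf u z = tf t z ^+ 2, forall z, tf1 u z = 2 * tf t z * tf1 t z &
      forall z, tf2 u z = 2 * tf t z * tf2 t z].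
Proof.
have dsq (g : R -> R) (x dg : R) : is_derive x 1 g dg ->
    is_derive x 1 (fun x => g x ^+ 2) (2 * g x * dg).
  move=> H; have := is_deriveM H H.
  have -> : (g * g)%R = (fun x => g x ^+ 2) by apply/funext => y; rewrite !fctE expr2.
  by move/is_derive_eq; apply; rewrite /GRing.scale /=; ring.
have cM (g : R * R -> R) : continuous g -> continuous (fun z => 2 * tf t z * g z).
  move=> cg z; apply: cvgM; last exact: cg.
  by apply: cvgM; [exact: cvg_cst|exact: ctf].
unshelve eexists; first unshelve refine (@TestFun R D M (fun z => tf t z ^+ 2)
  (fun z => 2 * tf t z * tf1 t z) (fun z => 2 * tf t z * tf2 t z) _ _ _ _ _ _ _ _).
- by apply: continuous_sqr; exact: ctf.
- by apply: cM; exact: ctf1.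
- by apply: cM; exact: ctf2.
- by move=> x y xy; exact: (dsq (fun x => tf t (x, y)) x _ (dtf1 t xy)).
- by move=> x y xy; exact: (dsq (fun y => tf t (x, y)) y _ (dtf2 t xy)).
- by move=> z Dz h; rewrite (tf_supp _ Dz h) expr0n.
- by move=> z Dz h; rewrite (tf_supp _ Dz h) mulr0 mul0r.
- by move=> z Dz h; rewrite (tf_supp _ Dz h) mulr0 mul0r.
by split.
Qed.

Lemma size_walls : \sum_(w <- walls R D) (1 : R) <= 2.
Proof. by case: (D) => /=; rewrite ?big_cons !big_nil; lra. Qed.

(** By [wall_sign] the integrand is nonnegative, so the cutoff can be replaced by 1. What remains is
    the derivative of v_1 |v_1| / 2, whose increments are at most B^2; there are at most two walls,
    each with the factor pi/2. *)
Lemma wall_flux_le (B r d : R) (t : test_fun D (cutM D r)) : 100 < r ->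
  (forall w x, w \in walls R D -> `|v1 f (x, w.1)| <= B) -> cutoff_spec d t ->
  \sum_(w <- walls R D) \int[mu]_x
    (tf t (x, w.1) ^+ 2 * (w.2 * (- (pi / 2) * (`|v1 f (x, w.1)| * b2 f (x, w.1)))))
  <= pi * B ^+ 2.
Proof.
move=> r1 HB st; have M1 := cutM_gt1 D r1; set M := cutM D r in t st M1 *.
have p0 : 0 <= pi / 2 :> R by rewrite divr_ge0// pi_ge0.
apply: (@le_trans _ _ (\sum_(w <- walls R D) (pi / 2 * B ^+ 2) * 1)); last first.
  rewrite -mulr_sumr; have := size_walls.
  have : 0 <= pi / 2 * B ^+ 2 by rewrite mulr_ge0 ?sqr_ge0.
  by have := pi_ge0 R; move: (\sum_(w <- _) _) => S; nra.
rewrite !big_seq; apply: ler_sum => w wD; rewrite mulr1.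
rewrite (@slice_setT R M); last first.
  by move=> x hx; rewrite (tf_wall0 t wD)// expr0n /= mul0r.
have cs := continuous_fst_slice.
pose g z := `|v1 f z| * (w.2 * a1 f z).
have cg : continuous g.
  move=> z; apply: cvgM; first by apply: cvg_norm; exact: cv1.
  by apply: cvgM; [exact: cvg_cst|exact: ca1].
apply: (@le_trans _ _ (\int[mu]_(x in `[- M, M]) (pi / 2 * g (x, w.1)))).
  apply: le_Rintegral => //.
  - apply: continuous_itv_integrable.
    apply: (cs _ (fun z => tf t z ^+ 2 * (w.2 * (- (pi / 2) * (`|v1 f z| * b2 f z))))) => z.
    apply: cvgM; first by apply: continuous_sqr; exact: ctf.
    apply: cvgM; first exact: cvg_cst.
    by apply: cvgM; [exact: cvg_cst|exact: continuous_wall_flux].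
  - apply: continuous_itv_integrable; apply: (cs _ (fun z => pi / 2 * g z)) => z.
    by apply: cvgM; [exact: cvg_cst|exact: cg].
  move=> x _; have /andP[t0 t1] := cut_bounds st (wall_cdom x wD).
  have -> : tf t (x, w.1) ^+ 2 * (w.2 * (- (pi / 2) * (`|v1 f (x, w.1)| * b2 f (x, w.1)))) =
      tf t (x, w.1) ^+ 2 * (pi / 2 * g (x, w.1)) by rewrite /g (divfree f); ring.
  rewrite ler_piMl ?exprn_ile1// mulr_ge0// /g mulr_ge0//; exact: wall_sign.
rewrite RintegralZl//; last first.
  by apply: continuous_itv_integrable; exact: (cs _ g).
rewrite ler_wpM2l//.
have dG (x : R) : x \in `[- M, M] -> is_derive x 1
    (fun x => w.2 * (v1 f (x, w.1) * `|v1 f (x, w.1)| / 2)) (g (x, w.1)).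
  move=> _; have H := @is_derive1_comp R (fun y => y * `|y| / 2) (fun x => v1 f (x, w.1)) x _ _
    (is_derive_half_sq_abs _) (@wall_derive w x wD).
  have := is_deriveM (is_derive_cst (w.2 : R) x 1) H.
  by move/is_derive_eq; apply; rewrite /g /GRing.scale /=; ring.
rewrite (RFTC2 _ (cs _ g _ cg) dG); last by lra.
have Q x : `|v1 f (x, w.1) * `|v1 f (x, w.1)| / 2| <= B ^+ 2 / 2.
  rewrite normrM (@ger0_norm _ 2^-1)// ler_pM2r ?invr_gt0// normrM normr_id expr2.
  by apply: ler_pM => //; exact: HB.
have := Q M; have := Q (- M); rewrite !ler_norml.
by have [->|->] := wall_normal wD; lra.
Qed.

(* Caccioppoli: testing with phi^2 absorbs the error term, so the bound on the
   wall flux controls the curvature without assuming it finite. *)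
Lemma curv_integrable (B C : R) : 0 <= C -> flow_growth f C ->
  (forall w x, w \in walls R D -> `|v1 f (x, w.1)| <= B) ->
  (leb2 R).-integrable (dom R D) (EFin \o curv f).
Proof.
(* With X the curvature weighted by phi^2 and E the energy bound, the test yields X <= pi B^2 + X/2
   + (pi^2/2) E; K is what results for X. *)
move=> C0 gC HB; pose K := 2 * (pi * B ^+ 2) + pi ^+ 2 * ((144 + 48 * pi) * C).
have pi0 : 0 < pi :> R by exact: pi_gt0.
have mD := @measurable_dom R D.
have est (n : nat) : (\int[leb2 R]_(z in dom R D) ((1 - off_core D (101 + n%:R) z) * curv f z)%:E <= K%:E)%E.
  set r : R := 101 + n%:R; have r1 : 100 < r by rewrite /r; have : 0 <= n%:R :> R by []; lra.
  have [t st] := cutoff_exists D r1 (@ltr01 R) (lexx 1).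
  have M1 := cutM_gt1 D r1.
  have [u [u0 u1 u2]] := test_fun_sqr t.
  have [iu H] := fold_estimate f u M1.
  have iu' : (leb2 R).-integrable (dom R D) (EFin \o (fun z => tf t z ^+ 2 * curv f z)).
    apply: eq_integrable iu => // z /set_mem Dz /=.
    by rewrite u0 sg_curvE.
  set X := \int[leb2 R]_(z in dom R D) (tf t z ^+ 2 * curv f z).
  have XE : \int[leb2 R]_(z in dom R D) (tf u z * (Num.sg (v2 f z) * curv f z)) = X.
    by apply: eq_Rintegral => z /set_mem Dz; rewrite u0 sg_curvE.
  rewrite XE in H.
  have W := wall_flux_le r1 HB st.
  have WE : \sum_(w <- walls R D) \int[mu]_x
        (tf u (x, w.1) * (w.2 * (- (pi / 2) * (`|v1 f (x, w.1)| * b2 f (x, w.1))))) =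
     \sum_(w <- walls R D) \int[mu]_x
    (tf t (x, w.1) ^+ 2 * (w.2 * (- (pi / 2) * (`|v1 f (x, w.1)| * b2 f (x, w.1))))).
    by apply: eq_bigr => w _; apply: eq_Rintegral => x _; rewrite u0.
  rewrite WE in H; move: W H; set W := \sum_(w <- _) _ => WB H.
  have iE := integrable_energy f t M1.
  set Y := \int[leb2 R]_(z in dom R D) (speed2 f z * (tf1 t z ^+ 2 + tf2 t z ^+ 2)).
  have YB : Y <= (144 + 48 * pi) * C by exact: (energy_bound C0 gC r1 st).
  (* Young's inequality with weight 1/pi: after multiplication by pi/2 the curvature term becomes
     X/2, which can be absorbed. *)
  have ZB : \int[leb2 R]_(z in dom R D) `|F1 f z * tf1 u z + F2 f z * tf2 u z| <=
      pi^-1 * X + pi * Y.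
    rewrite /X /Y -!RintegralZl// -RintegralD//; last 2 first.
    - exact: (integrableZl mD pi^-1 iu').
    - exact: (integrableZl mD pi iE).
    apply: le_Rintegral => //.
    - exact: integrable_dot.
    - exact: (integrableD mD (integrableZl mD pi^-1 iu') (integrableZl mD pi iE)).
    move=> z Dz; rewrite u1 u2; have /andP[t0 t1] := cut_bounds st (dom_cdom Dz).
    have -> : F1 f z * (2 * tf t z * tf1 t z) + F2 f z * (2 * tf t z * tf2 t z) =
        2 * (tf t z * (F1 f z * tf1 t z + F2 f z * tf2 t z)) by ring.
    rewrite normrM (@ger0_norm _ 2)// normrM (ger0_norm t0).
    have ip : 0 < pi^-1 :> R by rewrite invr_gt0.
    have := F_dot_young f z (tf1 t z) (tf2 t z) t0 ip.
    rewrite invfM invrK; lra.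
  have XK : X <= K.
    move: H; rewrite ler_norml => /andP[_ H].
    have : pi / 2 * \int[leb2 R]_(z in dom R D) `|F1 f z * tf1 u z + F2 f z * tf2 u z| <=
        X / 2 + pi ^+ 2 / 2 * ((144 + 48 * pi) * C).
      apply: (@le_trans _ _ (pi / 2 * (pi^-1 * X + pi * Y))).
        by rewrite ler_wpM2l// divr_ge0// ltW.
      have -> : pi / 2 * (pi^-1 * X + pi * Y) = X / 2 + pi ^+ 2 / 2 * Y.
        have G (p : R) : 0 < p -> p / 2 * (p^-1 * X + p * Y) = X / 2 + p ^+ 2 / 2 * Y.
          by move=> p0; field; exact: lt0r_neq0.
        exact: G.
      by rewrite lerD2l ler_wpM2l// divr_ge0// sqr_ge0.
    by rewrite /K; move: H WB; lra.
  have : ((\int[leb2 R]_(z in dom R D) (tf t z ^+ 2 * curv f z)%:E) <= K%:E)%E.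
    rewrite -(@fineK _ (\int[leb2 R]_(z in dom R D) _)%E) ?lee_fin//.
    exact: (integrable_fin_num mD iu').
  apply: le_trans; apply: ge0_le_integral => //.
  - move=> z _; rewrite lee_fin mulr_ge0 ?curv_ge0// subr_ge0; exact: off_core_le1.
  - apply/measurable_EFinP; apply: measurable_funM; last exact: measurable_curv.
    by apply: measurable_funB; [exact: measurable_cst|exact: measurable_off_core].
  - by have /integrableP[] := iu'.
  move=> z Dz; rewrite lee_fin ler_wpM2r ?curv_ge0// /off_core.
  case: pselect => /= [zc|_]; last by rewrite subrr sqr_ge0.
  by have [-> _ _] := cut_core st (dom_cdom Dz) zc; rewrite subr0 expr1n.
apply/integrableP; split; first by apply/measurable_EFinP; exact: measurable_curv.
apply: (@le_lt_trans _ _ K%:E); last exact: ltry.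
pose g n z := ((1 - off_core D (101 + n%:R) z) * curv f z)%:E : \bar R.
have gcv z : dom R D z -> g n z @[n --> \oo] --> (curv f z)%:E.
  move=> Dz; apply: cvg_near_cst; move: (off_core_near0 D z).
  by apply: filterS => n; rewrite /g => ->; rewrite subr0 mul1r.
have -> : (\int[leb2 R]_(z in dom R D) `|(EFin \o curv f) z| =
    \int[leb2 R]_(z in dom R D) limn (g^~ z))%E.
  apply: eq_integral => z /set_mem Dz; rewrite /= ger0_norm ?curv_ge0//.
  by apply/esym/cvg_lim => //; exact: gcv.
have mg n : measurable_fun (dom R D) (g n).
  apply/measurable_EFinP; apply: measurable_funM; last exact: measurable_curv.
  by apply: measurable_funB; [exact: measurable_cst|exact: measurable_off_core].
have g0 n z : dom R D z -> (0 <= g n z)%E.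
  by move=> _; rewrite lee_fin mulr_ge0 ?curv_ge0// subr_ge0; exact: off_core_le1.
have gnd z : dom R D z -> {homo g ^~ z : m n / (m <= n)%N >-> (m <= n)%E}.
  move=> _ m n mn; rewrite lee_fin ler_wpM2r ?curv_ge0// lerD2l lerN2.
  by apply: off_core_anti; [have : 0 <= m%:R :> R by []; lra|rewrite lerD2l ler_nat].
have cv := @cvg_monotone_convergence _ _ R (leb2 R) _ mD g mg g0 gnd.
rewrite -(cvg_lim _ cv)//; apply: lime_le; first by apply/cvg_ex; eexists; exact: cv.
by apply: nearW => n; exact: est.
Qed.

End walls.

(** * Limits on the walls *)

Section wall_cutoffs.
Context (R : realType) (D : flow_domain).
Notation mu := (@lebesgue_measure R).

Lemma wall_core (w : R * R) r x : 0 <= r -> w \in walls R D -> `|x| <= r -> core D r (x, w.1).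
Proof.
move=> r0 wD xr; move: wD; case: (D); first by [].
rewrite inE => /eqP -> /=; rewrite expr0n /= addr0 -real_normK ?num_real//.
by rewrite ler_pXn2r// nnegrE.
Qed.

(** All four properties are read off from the smooth approximations, which treats both cutoffs at
    once. *)
Lemma wall_cutoff (w : R * R) (r : R) : w \in walls R D -> 100 < r ->
  [/\ measurable_fun [set: measurableTypeR R] (fun x : R => cutoff D r (x, w.1)),
      forall x, 0 <= cutoff D r (x, w.1) <= 1,
      forall x, `|x| <= r -> cutoff D r (x, w.1) = 1 &
      forall x, cutM D r <= `|x| -> cutoff D r (x, w.1) = 0].
Proof.
move=> wD r1; have [t [Ht tcw]] := cutoff_sequence D r1; have tc x := tcw w x wD.
split.
- apply: (@measurable_fun_cvg _ _ _ _ (fun n x => tf (t n) (x, w.1))) => [n|x _]; last exact: tc.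
  apply: continuous_measurable_fun; apply: (@continuous_fst_slice R (tf (t n))); exact: ctf.
- move=> x; apply/andP; split.
    apply: (cvgr_to_ge (tc x)); apply: nearW => n.
    by have /andP[] := cut_bounds (Ht n) (wall_cdom x wD).
  apply: (cvgr_to_le (tc x)); apply: nearW => n.
  by have /andP[] := cut_bounds (Ht n) (wall_cdom x wD).
- move=> x xr; rewrite -(cvg_lim (@Rhausdorff R) (tc x)); apply: cvg_lim => //.
  apply: cvg_near_cst; apply: nearW => n.
  have [] // := cut_core (Ht n) (wall_cdom x wD).
  by apply: wall_core => //; lra.
- move=> x xr; rewrite -(cvg_lim (@Rhausdorff R) (tc x)); apply: cvg_lim => //.
  by apply: cvg_near_cst; apply: nearW => n; exact: tf_wall0.
Qed.

Lemma wall_cutoff_integrable (w : R * R) (r : R) (h : R -> R) : w \in walls R D ->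
  100 < r -> continuous h ->
  mu.-integrable setT (EFin \o (fun x => cutoff D r (x, w.1) * h x)).
Proof.
move=> wD r1 ch; have [m b _ z] := wall_cutoff wD r1.
pose M := cutM D r; have mI : measurable (`[- M, M] : set R) by [].
have i : mu.-integrable `[- M, M] (EFin \o (fun x => cutoff D r (x, w.1) * h x)).
  apply: (@le_integrable _ _ R mu _ mI _ (EFin \o h)); last exact: continuous_itv_integrable.
    apply/measurable_EFinP; apply: measurable_funM; first exact: measurable_funTS m.
    by apply: measurable_funTS; exact: continuous_measurable_fun.
  move=> x _; rewrite /= lee_fin normrM -[leRHS]mul1r ler_wpM2r//.
  by have /andP[c0 c1] := b x; rewrite ger0_norm.
have := proj1 (@integrable_mkcond _ _ R mu `[- M, M]%classic _ mI) i; congr (integrable _ _ _).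
apply/funext => x; rewrite patchE; case: ifPn => // xM.
rewrite /= z ?mul0r// /M leNgt; apply: contra xM => xM.
by rewrite inE /= in_itv /=; move: xM; rewrite -/M ltr_norml => /andP[a b']; rewrite !ltW.
Qed.

Lemma bcutB (r : R) (h k : R * R -> R) : 100 < r -> continuous h -> continuous k ->
  bcut D r (fun z => h z - k z) = bcut D r h - bcut D r k.
Proof.
move=> r1 ch ck; rewrite /bcut -sumrB !big_seq; apply: eq_bigr => w wD.
have c (l : R * R -> R) : continuous l -> continuous (fun x : R => w.2 * l (x, w.1)).
  move=> cl; apply: (@continuous_fst_slice R (fun z => w.2 * l z)) => z.
  by apply: cvgM; [exact: cvg_cst|exact: cl].
rewrite -RintegralB//; last 2 first.
- exact: (wall_cutoff_integrable wD r1 (c _ ch)).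
- exact: (wall_cutoff_integrable wD r1 (c _ ck)).
by apply: eq_Rintegral => x _; rewrite mulrBr mulrBr.
Qed.

Lemma eq_bcut (r : R) (h k : R * R -> R) :
  (forall w x, w \in walls R D -> h (x, w.1) = k (x, w.1)) -> bcut D r h = bcut D r k.
Proof.
move=> E; rewrite /bcut !big_seq; apply: eq_bigr => w wD.
by apply: eq_Rintegral => x _; rewrite E.
Qed.

(** As g >= 0, the integral is squeezed between G(r) - G(-r), the part where the cutoff is 1, and m
    - l, the total increment of the monotone G. *)
Lemma wall_cutoff_cvg (w : R * R) (G g : R -> R) (l m : R) : w \in walls R D ->
  continuous g -> (forall x, 0 <= g x) -> (forall x : R, is_derive x 1 G (g x)) ->
  G x @[x --> -oo] --> l -> G x @[x --> +oo] --> m ->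
  \int[mu]_x (cutoff D r (x, w.1) * g x) @[r --> +oo] --> m - l.
Proof.
move=> wD cg g0 dG Gl Gm.
have mono : {homo G : x y / x <= y}.
  move=> x y xy; have [u _ E] := @MVT_unordered R G g x y (fun u _ => dG u).
  by rewrite -subr_ge0 E mulr_ge0// subr_ge0.
have FT a b (ab : a < b) : \int[mu]_(x in `[a, b]) g x = G b - G a.
  exact: (RFTC2 ab cg (fun x _ => dG x)).
have Gle x : G x <= m.
  apply: (cvgr_to_ge Gm); near=> y; apply: mono.
  by near: y; apply: nbhs_pinfty_ge; exact: num_real.
have Gge x : l <= G x.
  apply: (cvgr_to_le Gl); near=> y; apply: mono.
  by near: y; apply: nbhs_ninfty_le; exact: num_real.
have cNr : (- r : R) @[r --> +oo] --> -oo by apply/cvgNry; rewrite opprK.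
have cG : G r - G (- r) @[r --> +oo] --> m - l.
  by apply: cvgB; [exact: Gm|exact: (cvg_comp _ _ cNr Gl)].
have cc : (fun _ : R => m - l) r @[r --> +oo] --> m - l by exact: cvg_cst.
apply: (squeeze_cvgr _ cG cc).
near=> r.
have r1 : 100 < r by near: r; apply: nbhs_pinfty_gt; exact: num_real.
have [ms b one z] := wall_cutoff wD r1; have M1 := cutM_gt1 D r1.
have iw := wall_cutoff_integrable wD r1 cg.
have iS (a c : R) : mu.-integrable `[a, c] (EFin \o (fun x => cutoff D r (x, w.1) * g x)).
  by apply: integrableS iw.
have p x : 0 <= cutoff D r (x, w.1) * g x by rewrite mulr_ge0//; have /andP[] := b x.
apply/andP; split.
  have -> : G r - G (- r) = \int[mu]_(x in `[- r, r]) (cutoff D r (x, w.1) * g x).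
    rewrite -FT; last by lra.
    apply: eq_Rintegral => x /set_mem /=; rewrite in_itv/= -ler_norml => xr.
    by rewrite one// mul1r.
  have mI : measurable (`[- r, r]%classic : set (measurableTypeR R)) by [].
  rewrite -lee_fin !fineK; last 2 first.
  - by apply: (integrable_fin_num _ iw).
  - apply: (integrable_fin_num mI); exact: (iS (- r) r).
  apply: ge0_subset_integral => //; first by have /integrableP[] := iw.
  by move=> x _; rewrite lee_fin.
rewrite (@slice_setT R (cutM D r)); last by move=> x xM; rewrite z// mul0r.
apply: (@le_trans _ _ (\int[mu]_(x in `[- cutM D r, cutM D r]) g x)).
  apply: le_Rintegral => //.
  - exact: continuous_itv_integrable.
  by move=> x _; rewrite ler_piMl//; have /andP[] := b x.
rewrite FT; last by lra.
by apply: lerB.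
Unshelve. all: by end_near. Qed.

End wall_cutoffs.

Section wall_limits.
Context (R : realType) (D : flow_domain) (f : flow R D).
Notation mu := (@lebesgue_measure R).

Lemma monotone_limits (g : R -> R) (B : R) : {homo g : x y / x <= y} ->
  (forall x, `|g x| <= B) ->
  exists l m : R, g x @[x --> -oo] --> l /\ g x @[x --> +oo] --> m.
Proof.
move=> mono gB; exists (- sup (range (fun x => - g (- x)))), (sup (range g)); split.
  apply/cvgNy_compNP; rewrite (_ : g \o -%R = fun x => - (- g (- x))); last first.
    by apply/funext => x; rewrite opprK.
  apply: cvgN; apply: (@nondecreasing_cvgr R (fun x => - g (- x))).
    by move=> x y xy; rewrite lerN2; apply: mono; rewrite lerN2.
  by exists B => _ [x _ <-]; have := gB (- x); rewrite ler_norml; lra.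
apply: nondecreasing_cvgr => //.
by exists B => _ [x _ <-]; have := gB x; rewrite ler_norml; lra.
Qed.

(** If the essential bound were exceeded at a point, it would be exceeded on a ball, which has
    positive measure. *)
Lemma continuous_Linfty_bounded (g : R -> R) : continuous g ->
  g \in Lfun mu +oo%E -> exists B, forall x, `|g x| <= B.
Proof.
move=> cg /sub_Lfun_finLfun; rewrite inE /= /finite_norm unlock /=.
have mT : (0 < mu [set: R])%E by rewrite -set_itvNyy lebesgue_measure_itv ltry.
rewrite ifT;[|exact: mT].
move=> /(@ess_sup_inf.ess_supr_bounded _ _ R mu (fun x => `|g x|))[B [A [mA A0 sA]]].
exists B => x; rewrite leNgt; apply/negP => xB.
have cx : `|g y| @[y --> x] --> `|g x| by apply: cvg_norm; exact: cg.
have /nbhs_ballP[d /= d0 Hd] : \forall y \near x, B < `|g y| by exact: (cvgr_gt _ cx).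
have bA : ball x d `<=` A.
  by move=> y /Hd By; apply: sA => /=; apply/negP; rewrite -ltNge.
have : (mu (ball x d) <= mu A)%E by apply: le_measure; rewrite ?inE//; exact: measurable_ball.
have -> : mu (ball x d) = (d *+ 2)%:E by apply: lebesgue_measure_ball; exact: ltW.
by rewrite A0 lee_fin leNgt pmulrn_lgt0 ?d0.
Qed.

Hypothesis v2_ge0 : forall z, dom R D z -> 0 <= v2 f z.

Lemma wall_limits (w : R * R) (B : R) : w \in walls R D ->
  (forall x, `|v1 f (x, w.1)| <= B) ->
  exists l m : R, v1 f (x, w.1) @[x --> -oo] --> l /\ v1 f (x, w.1) @[x --> +oo] --> m.
Proof.
move=> wD vB; have H x y := wall_monotone v2_ge0 wD (x := x) (y := y).
have [l [m [Hl Hm]]] : exists l m : R, w.2 * v1 f (x, w.1) @[x --> -oo] --> l /\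
    w.2 * v1 f (x, w.1) @[x --> +oo] --> m.
  apply: (@monotone_limits _ B) => [x y|x]; first exact: H.
  by rewrite normrM; have [->|->] := wall_normal wD; rewrite ?normrN normr1 mul1r.
have E : (fun x => v1 f (x, w.1)) = fun x => w.2 * (w.2 * v1 f (x, w.1)).
  by apply/funext => x; have [->|->] := wall_normal wD; rewrite ?mul1r// !mulN1r opprK.
by exists (w.2 * l), (w.2 * m); rewrite E; split; apply: cvgM => //; exact: cvg_cst.
Qed.

(** Since [b2] = -[a1], the integrand is minus a derivative of Th(v_1) along the wall; th >= 0 and
    [wall_sign] give it the sign that [wall_cutoff_cvg] requires. *)
Lemma wall_flux_cvg (w : R * R) (th Th : R -> R) (l m : R) : w \in walls R D ->
  continuous th -> (forall x, 0 <= th x) -> (forall x : R, is_derive x 1 Th (th x)) ->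
  v1 f (x, w.1) @[x --> -oo] --> l -> v1 f (x, w.1) @[x --> +oo] --> m ->
  \int[mu]_x (cutoff D r (x, w.1) * (w.2 * (th (v1 f (x, w.1)) * b2 f (x, w.1))))
    @[r --> +oo] --> w.2 * (Th l - Th m).
Proof.
move=> wD cth th0 dTh Hl Hm.
pose g x := th (v1 f (x, w.1)) * (w.2 * a1 f (x, w.1)).
have cg : continuous g.
  apply: (@continuous_fst_slice R (fun z => th (v1 f z) * (w.2 * a1 f z))) => z.
  apply: cvgM; first exact: (continuous_comp (@cv1 _ _ f z) (cth _)).
  by apply: cvgM; [exact: cvg_cst|exact: ca1].
have cTh : continuous Th by move=> x; exact: (is_derive_cts (dTh x)).
have dG (x : R) : is_derive x 1 (fun x => w.2 * Th (v1 f (x, w.1))) (g x).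
  have H := @is_derive1_comp R Th (fun x => v1 f (x, w.1)) x _ _
    (dTh _) (@wall_derive _ _ f w x wD).
  have := is_deriveM (is_derive_cst (w.2 : R) x 1) H.
  by move/is_derive_eq; apply; rewrite /g /GRing.scale /=; ring.
have cvT (F : set_system R) (k : R) : Filter F -> v1 f (x, w.1) @[x --> F] --> k ->
    w.2 * Th (v1 f (x, w.1)) @[x --> F] --> w.2 * Th k.
  move=> FF Hk; apply: cvgM; first exact: cvg_cst.
  exact: (cvg_comp _ _ Hk (cTh k)).
have G0 x : 0 <= g x by rewrite /g mulr_ge0// wall_sign.
have := wall_cutoff_cvg wD cg G0 dG (cvT _ _ _ Hl) (cvT _ _ _ Hm) => H.
rewrite (_ : w.2 * (Th l - Th m) = - (w.2 * Th m - w.2 * Th l)); last by ring.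
apply: cvg_trans (cvgN (H _ _)); apply: near_eq_cvg; near=> r.
have r1 : 100 < r by near: r; apply: nbhs_pinfty_gt; exact: num_real.
rewrite fctE -mulN1r -RintegralZl//; last exact: (wall_cutoff_integrable wD r1 cg).
by apply: eq_Rintegral => x _; rewrite /g (divfree f); ring.
Unshelve. all: by end_near. Qed.

End wall_limits.

(** * Flow angles *)

Section angles.
Context (R : realType) (D : flow_domain).
Implicit Type f : flow R D.

Lemma bcutZ (r c : R) (h : R * R -> R) : 100 < r -> continuous h ->
  bcut D r (fun z => c * h z) = c * bcut D r h.
Proof.
move=> r1 ch; rewrite /bcut mulr_sumr !big_seq; apply: eq_bigr => w wD.
have cl : continuous (fun x : R => w.2 * h (x, w.1)).
  apply: (@continuous_fst_slice R (fun z => w.2 * h z)) => z.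
  by apply: cvgM; [exact: cvg_cst|exact: ch].
rewrite -RintegralZl//; last exact: (wall_cutoff_integrable wD r1 cl).
by apply: eq_Rintegral => x _; ring.
Qed.

Lemma F2_wall f w x : w \in walls R D -> F2 f (x, w.1) = v1 f (x, w.1) * b2 f (x, w.1).
Proof. by move=> wD; rewrite /F2 (v2_wall f x wD) mul0r subr0. Qed.

Lemma cvg_bcutB (h k : R * R -> R) (l m : R) : continuous h -> continuous k ->
  bcut D r h @[r --> +oo] --> l -> bcut D r k @[r --> +oo] --> m ->
  bcut D r (fun z => h z - k z) @[r --> +oo] --> l - m.
Proof.
move=> ch ck Hl Hm; apply: cvg_trans (cvgB Hl Hm).
apply: near_eq_cvg; near=> r.
have r1 : 100 < r by near: r; apply: nbhs_pinfty_gt; exact: num_real.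
by rewrite bcutB.
Unshelve. all: by end_near. Qed.

Lemma cvg_bcutZ (c : R) (h : R * R -> R) (l : R) : continuous h ->
  bcut D r h @[r --> +oo] --> l ->
  bcut D r (fun z => c * h z) @[r --> +oo] --> c * l.
Proof.
move=> ch Hl; have cc : (fun _ : R => c) r @[r --> +oo] --> c by exact: cvg_cst.
apply: cvg_trans (cvgM cc Hl).
apply: near_eq_cvg; near=> r.
have r1 : 100 < r by near: r; apply: nbhs_pinfty_gt; exact: num_real.
by rewrite bcutZ.
Unshelve. all: by end_near. Qed.

(** The case [w0] = 1 of [glue_cvg], where nothing is cut off. *)
Lemma F2_flux_cvg0 f (C : R) : (leb2 R).-integrable (dom R D) (EFin \o curv f) ->
  0 <= C -> flow_growth f C -> bcut D r (F2 f) @[r --> +oo] --> 0.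
Proof.
move=> ic C0 gC; have c1 : continuous (fun _ : R * R => 1 : R) by move=> z; exact: cvg_cst.
have := glue_cvg ic C0 gC c1; rewrite (_ : (fun r => _) = fun r => bcut D r (F2 f)).
  by apply=> z /eqP; rewrite oner_eq0.
by apply/funext => r; congr bcut; apply/funext => z; rewrite ltr01.
Qed.

(** In the orthonormal frame (c, s), (-s, c) the vector (u, v) has second coordinate 0 and a
    nonnegative first one. *)
Lemma polar_of_dot0 (u v c s : R) : c ^+ 2 + s ^+ 2 = 1 -> - s * u + c * v = 0 ->
  0 <= c * u + s * v ->
  u = Num.sqrt (u ^+ 2 + v ^+ 2) * c /\ v = Num.sqrt (u ^+ 2 + v ^+ 2) * s.
Proof.
move=> cs E k0.
have -> : u ^+ 2 + v ^+ 2 = (c * u + s * v) ^+ 2.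
  have -> : u ^+ 2 + v ^+ 2 = (c ^+ 2 + s ^+ 2) * (u ^+ 2 + v ^+ 2) - (- s * u + c * v) ^+ 2.
    by rewrite cs E; ring.
  ring.
rewrite sqrtr_sqr ger0_norm//; split.
  rewrite [LHS](_ : _ = (c ^+ 2 + s ^+ 2) * u + s * (- s * u + c * v)); last by rewrite cs E; ring.
  ring.
rewrite [LHS](_ : _ = (c ^+ 2 + s ^+ 2) * v - c * (- s * u + c * v)); last by rewrite cs E; ring.
ring.
Qed.

(* If the direction t were missed, the part of the flow on one side of it could
   be glued to zero, which forces the flux of |v1| through the walls to vanish. *)
Lemma angle_attained f (C t : R) : (forall z, dom R D z -> 0 <= v2 f z) ->
  (leb2 R).-integrable (dom R D) (EFin \o curv f) -> 0 <= C -> flow_growth f C ->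
  signed_curv f != 0 -> 0 <= t <= pi ->
  exists z, [/\ cdom D z, 0 < speed2 f z,
    v1 f z = Num.sqrt (speed2 f z) * cos t & v2 f z = Num.sqrt (speed2 f z) * sin t].
Proof.
move=> v0 ic C0 gC S0 tpi; apply: contrapT => H; move/eqP: S0; apply.
have s0 := sin_ge0_pi tpi; have cs := cos2Dsin2 t.
set c := cos t in cs H *; set s := sin t in s0 cs H *.
have Hz z : cdom D z -> - s * v1 f z + c * v2 f z = 0 -> 0 <= c * v1 f z + s * v2 f z ->
    speed2 f z = 0.
  move=> Dz E k; apply/eqP; rewrite eq_sym eq_le speed2_ge0/= leNgt; apply/negP => n0.
  by have [e1 e2] := polar_of_dot0 cs E k; apply: H; exists z; split.
suff cv : bcut D r (fun z => `|v1 f z| * b2 f z) @[r --> +oo] --> 0.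
  have : - (2 / pi * signed_curv f) = 0.
    by rewrite -(cvg_lim (@Rhausdorff R) (flux_cvg ic C0 gC)); exact: cvg_lim cv.
  move/eqP; rewrite oppr_eq0 mulf_eq0 => /orP[|/eqP//].
  by rewrite mulf_eq0 pnatr_eq0 invr_eq0 (negbTE (lt0r_neq0 (pi_gt0 R))).
have cvF := F2_flux_cvg0 ic C0 gC.
(* For t = 0 or pi the missed direction is parallel to the walls. Then v_1 has one sign on them, so
   |v_1| d_2 v_2 is a constant multiple of F2, whose flux tends to 0. *)
move: s0; rewrite le_eqVlt => /orP[/eqP s0|s0].
  have c1 : c ^+ 2 = 1 by rewrite -cs -s0 expr0n addr0.
  have W w x : w \in walls R D -> `|v1 f (x, w.1)| = - c * v1 f (x, w.1).
    move=> wD; have v20 := v2_wall f x wD.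
    have [k0|k0] := leP 0 (c * v1 f (x, w.1)).
      have := @Hz (x, w.1) (wall_cdom x wD); rewrite v20 -s0 !mulr0 oppr0 mul0r !addr0.
      by move=> /(_ erefl k0) /speed2_eq0[-> _]; rewrite normr0 mulr0.
    have : (c - 1) * (c + 1) = 0 by rewrite -subr_sqr expr1n c1 subrr.
    move=> /eqP; rewrite mulf_eq0 subr_eq0 addr_eq0 => /orP[] /eqP E; move: k0; rewrite E.
      by rewrite mul1r mulN1r => k0; rewrite ltr0_norm.
    by rewrite mulN1r opprK mul1r oppr_lt0 => k0; rewrite gtr0_norm.
  have := @cvg_bcutZ (- c) _ _ (@cF2 _ _ f) cvF; rewrite mulr0.
  rewrite (_ : (fun r => _) = fun r => bcut D r (fun z => `|v1 f z| * b2 f z))//.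
  apply/funext => r; apply: eq_bcut => w x wD.
  by rewrite W// F2_wall// mulrA.
pose w0 z := - s * v1 f z + c * v2 f z.
have cw0 : continuous w0.
  by move=> z; apply: cvgD; apply: cvgM; [exact: cvg_cst|exact: cv1|exact: cvg_cst|exact: cv2].
(* Where [w0] = 0, v lies on the line at angle t; as v_2 >= 0 and s > 0 it lies on the missed ray
   itself, not on the opposite one, so it is 0. [v_cdom] covers points outside the closed domain. *)
have w00 z : w0 z = 0 -> speed2 f z = 0.
  have [z' Dz' [E1 E2]] := v_cdom f z; rewrite /w0 /speed2 E1 E2 => E.
  apply: (Hz z') => //; have v2' := v2_ge0_cdom v0 Dz'.
  have -> : c * v1 f z' + s * v2 f z' = s^-1 * v2 f z'.
    apply: (mulfI (lt0r_neq0 s0)); rewrite mulrA mulfV ?lt0r_neq0// mul1r.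
    rewrite [RHS](_ : _ = (c ^+ 2 + s ^+ 2) * v2 f z' - c * (- s * v1 f z' + c * v2 f z')).
      ring.
    by rewrite cs E; ring.
  by rewrite mulr_ge0// invr_ge0 ltW.
have cNw : continuous (fun z => - w0 z) by move=> z; apply: cvgN; exact: cw0.
have Nw0 z : - w0 z = 0 -> speed2 f z = 0 by move=> /eqP; rewrite oppr_eq0 => /eqP/w00.
have cg := continuous_glue.
have F0 z : speed2 f z = 0 -> F2 f z = 0 by move=> /F_speed2_eq0[].
(* On a wall [w0] = -s v_1, so -[w0] and [w0] select v_1 > 0 and v_1 < 0; the difference of the two
   glued fluxes is that of |v_1| d_2 v_2. *)
have := cvg_bcutB (cg _ _ _ _ cNw (@cF2 _ _ f) (fun z e => F0 z (Nw0 z e)))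
  (cg _ _ _ _ cw0 (@cF2 _ _ f) (fun z e => F0 z (w00 z e)))
  (glue_cvg ic C0 gC cNw Nw0) (glue_cvg ic C0 gC cw0 w00).
rewrite subr0.
rewrite (_ : (fun r => _) = fun r => bcut D r (fun z => `|v1 f z| * b2 f z))//.
apply/funext => r; apply: eq_bcut => w x wD.
rewrite /w0 F2_wall// (v2_wall f x wD) mulr0 addr0 mulNr opprK oppr_gt0.
rewrite pmulr_rgt0// pmulr_rlt0//.
case: ltgtP => [v|v|<-].
- by rewrite subr0 gtr0_norm.
- by rewrite sub0r ltr0_norm// mulNr.
- by rewrite normr0 mul0r subrr.
Qed.

End angles.

Section flow_angles.
Context (R : realType) (D : flow_domain).
Implicit Type f g : flow R D.

Definition angles f : set (R * R) :=
  [set (Num.sqrt (speed2 f z))^-1 *: (v1 f z, v2 f z) | z in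
     cdom D `&` [set z | 0 < speed2 f z]].

Lemma scale_pairE (k a b : R) : k *: (a, b) = (k * a, k * b) :> R * R.
Proof. by []. Qed.

Lemma angles_upper f (C : R) : (forall z, dom R D z -> 0 <= v2 f z) ->
  (leb2 R).-integrable (dom R D) (EFin \o curv f) -> 0 <= C -> flow_growth f C ->
  signed_curv f != 0 -> angles f = upper_semicircle R.
Proof.
move=> v0 ic C0 gC S0; apply/seteqP; split=> p.
  move=> [z [Dz /= z0] <-]; have s0 : 0 < Num.sqrt (speed2 f z) by rewrite sqrtr_gt0.
  rewrite scale_pairE; set k := (Num.sqrt _)^-1.
  have k0 : 0 < k by rewrite invr_gt0.
  have k1 : (k * v1 f z) ^+ 2 + (k * v2 f z) ^+ 2 = 1.
    by rewrite !exprMn -mulrDr -/(speed2 f z) exprVn sqr_sqrtr ?ltW// mulVf ?lt0r_neq0.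
  have q0 : 0 <= k * v2 f z by rewrite mulr_ge0 ?(v2_ge0_cdom v0)// ltW.
  have p1 : -1 <= k * v1 f z <= 1.
    by rewrite -ler_norml -sqrtr_sqr -[leRHS]sqrtr1 ler_sqrt// -k1 lerDl sqr_ge0.
  have [a0 a1] := acos_def p1; exists (acos (k * v1 f z)); first by rewrite /= in_itv.
  rewrite a1 sin_acos//; congr pair.
  by rewrite -k1 addrC addKr sqrtr_sqr ger0_norm.
move=> [t /=]; rewrite in_itv/= => tpi <-.
have [z [Dz z0 E1 E2]] := angle_attained v0 ic C0 gC S0 tpi.
exists z => //=; have s0 : Num.sqrt (speed2 f z) != 0 by rewrite lt0r_neq0// sqrtr_gt0.
by rewrite scale_pairE E1 E2 !mulKf.
Qed.

Lemma v2_ge0_of_angles f : angles f `<=` upper_semicircle R ->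
  forall z, cdom D z -> 0 <= v2 f z.
Proof.
move=> H z Dz; have [->//|z0] := eqVneq (v2 f z) 0.
have s0 : 0 < speed2 f z by rewrite /speed2 ltr_wpDl ?sqr_ge0// exprn_even_gt0.
have /H : angles f ((Num.sqrt (speed2 f z))^-1 *: (v1 f z, v2 f z)) by exists z.
move=> [t /=]; rewrite in_itv/= => tpi; rewrite scale_pairE => -[_ E].
have k0 : 0 < (Num.sqrt (speed2 f z))^-1 by rewrite invr_gt0 sqrtr_gt0.
by rewrite -(pmulr_rge0 _ k0) -E sin_ge0_pi.
Qed.

Lemma v2_gt0_of_angles f : angles f = upper_semicircle R ->
  exists2 z, cdom D z & 0 < v2 f z.
Proof.
move=> H; have : upper_semicircle R (cos (pi / 2), sin (pi / 2)).
  by exists (pi / 2) => //=; rewrite in_itv/=; have := pi_gt0 R; lra.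
rewrite -H sin_pihalf => -[z [Dz /= z0]]; rewrite scale_pairE => -[_ E].
have k0 : 0 < (Num.sqrt (speed2 f z))^-1 by rewrite invr_gt0 sqrtr_gt0.
by exists z => //; rewrite -(pmulr_rgt0 _ k0) E.
Qed.

Section reversal.
Variables f g : flow R D.
Hypothesis g1 : forall z, v1 g z = - v1 f z.
Hypothesis g2 : forall z, v2 g z = - v2 f z.
Hypothesis gF1 : forall z, F1 g z = F1 f z.
Hypothesis gF2 : forall z, F2 g z = F2 f z.

Lemma speed2_reversal z : speed2 g z = speed2 f z.
Proof. by rewrite /speed2 g1 g2 !sqrrN. Qed.

Lemma curv_reversal : curv g = curv f.
Proof. by apply/funext => z; rewrite /curv gF1 gF2 speed2_reversal. Qed.

Lemma flow_growth_reversal (C : R) : flow_growth f C -> flow_growth g C.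
Proof. by move=> gC r z r1 Dz; rewrite speed2_reversal; exact: gC. Qed.

Lemma signed_curv_reversal : (leb2 R).-integrable (dom R D) (EFin \o curv f) ->
  signed_curv g = - signed_curv f.
Proof.
move=> ic; rewrite /signed_curv -mulN1r -RintegralZl//; last 2 first.
- exact: measurable_dom.
- exact: sg_curv_integrable ic.
by apply: eq_Rintegral => z _; rewrite g2 curv_reversal sgrN mulN1r mulNr.
Qed.

Lemma lower_semicircleE : lower_semicircle R = [set - p | p in upper_semicircle R].
Proof.
have E (t : R) : (cos t, sin t) = - (cos (t + pi), sin (t + pi)) :> R * R.
  by rewrite sinDpi cosDpi /=; congr pair; rewrite opprK.
apply/seteqP; split=> p.
  move=> [t /=]; rewrite in_itv/= => tpi <-; rewrite E; eexists; last by [].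
  by exists (t + pi) => //=; rewrite in_itv/=; lra.
move=> [_ [t /= tpi <-] <-]; exists (t - pi); last by rewrite E subrK.
by move: tpi; rewrite /= !in_itv/=; lra.
Qed.

Lemma angles_reversal : angles g = [set - p | p in angles f].
Proof.
apply/seteqP; split=> p.
  move=> [z [Dz /= z0] <-]; rewrite speed2_reversal in z0 *.
  exists ((Num.sqrt (speed2 f z))^-1 *: (v1 f z, v2 f z)); first by exists z.
  by rewrite g1 g2 !scale_pairE; congr pair; rewrite /= mulrN.
move=> [_ [z [Dz /= z0] <-] <-]; exists z; first by rewrite /= speed2_reversal.
by rewrite speed2_reversal g1 g2 !scale_pairE; congr pair; rewrite /= mulrN.
Qed.

Lemma angles_lower : angles f = lower_semicircle R <-> angles g = upper_semicircle R.
Proof.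
have NN (A : set (R * R)) : [set - p | p in [set - p | p in A]] = A.
  apply/seteqP; split=> [p [_ [q Aq <-] <-]|p Ap]; first by rewrite opprK.
  by exists (- p); [exists p|rewrite opprK].
rewrite lower_semicircleE angles_reversal; split=> [->|<-]; rewrite NN//.
Qed.

End reversal.

End flow_angles.

(** * Equality of signed and total curvature *)

Section rigidity.
Context (R : realType) (D : flow_domain) (f : flow R D).
Hypothesis ic : (leb2 R).-integrable (dom R D) (EFin \o curv f).

Definition total := \int[leb2 R]_(z in dom R D) curv f z.

Lemma total_ge0 : 0 <= total.
Proof. by apply: Rintegral_ge0 => z _; exact: curv_ge0. Qed.

Lemma signed_curv_le : `|signed_curv f| <= total.
Proof.
have mD := @measurable_dom R D; have iS := sg_curv_integrable ic.
apply: (le_trans (le_normr_Rintegral mD iS)); apply: le_Rintegral => //.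
  exact: (integrable_norm iS).
by move=> z _; exact: sg_curv_le.
Qed.

Lemma signed_curvE : (forall z, dom R D z -> 0 <= v2 f z) -> signed_curv f = total.
Proof. by move=> v0; apply: eq_Rintegral => z /set_mem; exact: sg_curvE. Qed.

(** The nonnegative function (1 - sgn(v_2)) [curv] has integral 0. A point with v_2 < 0 and F
    nonzero would make it bounded below on a neighbourhood; hence F = 0 wherever v_2 < 0. *)
Lemma v2_ge0_of_signed_curv : signed_curv f = total -> forall z, dom R D z -> 0 <= v2 f z.
Proof.
move=> E; apply: v2_ge0_of_F_eq0 => z Dz z0.
suff : (F1 f z, F2 f z) = (0, 0) by case.
apply: contrapT => /eqP/(curv_near Dz)[e e0 He].
have mD := @measurable_dom R D; have iS := sg_curv_integrable ic.
have ib := integrableB mD ic iS.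
have : 0 < \int[leb2 R]_(y in dom R D) (curv f y - Num.sg (v2 f y) * curv f y).
  apply: (@Rintegral_gt0 R D _ z e) => //.
    by move=> y _; rewrite subr_ge0 (le_trans (ler_norm _)) ?sg_curv_le.
  have : \forall y \near z, v2 f y < 0 by exact: (cvgr_lt _ (@cv2 _ _ f z)).
  move: He; apply: filterS2 => y ye y0.
  by rewrite ltr0_sg// mulN1r opprK (le_trans ye)// lerDl curv_ge0.
by rewrite RintegralB// -/(signed_curv f) -/total E subrr ltxx.
Qed.

Lemma F_eq0_of_total : total = 0 -> forall z, dom R D z -> F1 f z = 0 /\ F2 f z = 0.
Proof.
move=> T0 z Dz; suff : (F1 f z, F2 f z) = (0, 0) by case.
apply: contrapT => /eqP/(curv_near Dz)[e e0 He].
have : 0 < total by apply: (@Rintegral_gt0 R D _ z e) => // y _; exact: curv_ge0.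
by rewrite T0 ltxx.
Qed.

End rigidity.

Section shear.
Context (R : realType) (D : flow_domain) (f : flow R D).

(** The argument along lines, applied to v and to -v, gives v_2 = 0; incompressibility then makes
    v_1 independent of x_1. *)
Lemma shear_of_F_eq0 : (forall z, dom R D z -> F1 f z = 0 /\ F2 f z = 0) ->
  (forall z, cdom D z -> v2 f z = 0) /\
  (forall x y, cdom D (x, y) -> v1 f (x, y) = v1 f (0, y)).
Proof.
move=> F0; have v20 z : dom R D z -> v2 f z = 0.
  have [g [g1 g2 gF1 gF2]] := reversal_exists f.
  move=> Dz; apply/eqP; rewrite eq_le; apply/andP; split.
    rewrite -oppr_ge0 -g2; apply: v2_ge0_of_F_eq0 => // y Dy _.
    by rewrite gF1 gF2; exact: F0.
  by apply: v2_ge0_of_F_eq0 => // y Dy _; exact: F0.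
have a0 x y : dom R D (x, y) -> a1 f (x, y) = 0.
  move=> xy; apply/eqP; rewrite -oppr_eq0 -divfree; apply/eqP.
  apply: (is_derive_unique (dv22 f xy)).
  apply: near_eq_is_derive (is_derive_cst (0 : R) y 1).
  by move: (dom_nbhs_y xy); apply: filterS => t /v20 ->.
split=> [|x y].
  by apply: eq_cdom; [exact: cv2|by move=> z; exact: cvg_cst|].
move=> Dz; apply: (@eq_cdom R D (v1 f) (fun z => v1 f (0, z.2)) _ _ _ (x, y)) => //.
- exact: cv1.
- move=> z; have c0 : (fun _ : R * R => 0 : R) y @[y --> z] --> (0 : R) by exact: cvg_cst.
  exact: (cvg_comp _ _ (cvg_pair c0 (@csnd R z)) (@cv1 _ _ f (0, z.2))).
move=> [u t] ut /=; have Dx s : dom R D (s, t) by move: ut; case: (D).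
have [s _ E] := @MVT_unordered R (fun s => v1 f (s, t)) (fun s => a1 f (s, t)) 0 u
  (fun s _ => dv11 f (Dx s)).
by apply/eqP; rewrite -subr_eq0 E a0// mul0r.
Qed.

End shear.

(** * Curvature in terms of the limits on the walls *)

Section wall_identities.
Context (R : realType) (D : flow_domain) (f : flow R D).
Hypothesis v0 : forall z, dom R D z -> 0 <= v2 f z.
Hypothesis ic : (leb2 R).-integrable (dom R D) (EFin \o curv f).
Variable C : R.
Hypothesis C0 : 0 <= C.
Hypothesis gC : flow_growth f C.
Variables l m : R * R -> R.
Hypothesis Hl : forall w, w \in walls R D -> v1 f (x, w.1) @[x --> -oo] --> l w.
Hypothesis Hm : forall w, w \in walls R D -> v1 f (x, w.1) @[x --> +oo] --> m w.

Lemma bcut_walls_cvg (th Th : R -> R) : continuous th -> (forall x, 0 <= th x) ->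
  (forall x : R, is_derive x 1 Th (th x)) ->
  bcut D r (fun z => th (v1 f z) * b2 f z) @[r --> +oo] -->
    \sum_(w <- walls R D) w.2 * (Th (l w) - Th (m w)).
Proof.
move=> cth th0 dTh; apply: cvg_sum_seq => w wD.
by apply: wall_flux_cvg => //; [exact: Hl|exact: Hm].
Qed.

Lemma continuous_abs : continuous (fun x : R => `|x|).
Proof. by move=> x; apply: cvg_norm; exact: cvg_id. Qed.

(** Two evaluations of one limit: the flux of |v_1| d_2 v_2 tends to -(2/pi) times the curvature,
    and to wall values of the primitive x|x|/2. *)
Lemma total_walls : total f =
  pi / 4 * \sum_(w <- walls R D) w.2 * (m w * `|m w| - l w * `|l w|).
Proof.
have H1 := bcut_walls_cvg continuous_abs (fun x => normr_ge0 x) (@is_derive_half_sq_abs R).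
have H2 := flux_cvg ic C0 gC.
have : - (2 / pi * total f) = \sum_(w <- walls R D) w.2 * (l w * `|l w| / 2 - m w * `|m w| / 2).
  by rewrite -signed_curvE// -(cvg_lim (@Rhausdorff R) H2); exact: cvg_lim H1.
have -> : \sum_(w <- walls R D) w.2 * (m w * `|m w| - l w * `|l w|) =
   - 2 * \sum_(w <- walls R D) w.2 * (l w * `|l w| / 2 - m w * `|m w| / 2).
  by rewrite mulr_sumr; apply: eq_bigr => w _; field.
move=> <-; have p0 : pi != 0 :> R by rewrite lt0r_neq0// pi_gt0.
by move: p0; generalize (@pi R) => p p0; field.
Qed.

(** The flux of F2 = v_1 d_2 v_2 tends to 0, and x^2/2 is the primitive of x. As [wall_flux_cvg]
    needs a nonnegative weight, x is written as (|x| + x) - |x|. *)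
Lemma wall_squares : \sum_(w <- walls R D) w.2 * (l w ^+ 2 - m w ^+ 2) = 0.
Proof.
have H1 := bcut_walls_cvg continuous_abs (fun x => normr_ge0 x) (@is_derive_half_sq_abs R).
pose th (x : R) := `|x| + x; pose Th (x : R) := x * `|x| / 2 + x ^+ 2 / 2.
have cth : continuous th by move=> x; apply: cvgD; [exact: continuous_abs|exact: cvg_id].
have th0 x : 0 <= th x by rewrite /th -lerBlDr sub0r (le_trans (ler_norm _)) ?normrN.
have dTh (x : R) : is_derive x 1 Th (th x).
  have dx := is_derive_id x (1 : R).
  have H := is_deriveM (is_deriveM dx dx) (is_derive_cst (2^-1 : R) x 1).
  have := is_deriveD (is_derive_half_sq_abs x) H.
  have -> : (fun x : R => x * `|x| / 2) + (id * id * cst 2^-1) = Th.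
    by apply/funext => y; rewrite !fctE /Th expr2.
  by move/is_derive_eq; apply; rewrite /th /GRing.scale /=; field.
have H2 := bcut_walls_cvg cth th0 dTh.
have cv : continuous (fun z => th (v1 f z) * b2 f z).
  move=> z; apply: cvgM; last exact: cb2.
  exact: (continuous_comp (@cv1 _ _ f z) (cth _)).
have H3 := cvg_bcutB cv (@continuous_wall_flux _ _ f) H2 H1.
have H4 := F2_flux_cvg0 ic C0 gC.
have E : (fun r => bcut D r (F2 f)) =
   fun r => bcut D r (fun z => th (v1 f z) * b2 f z - `|v1 f z| * b2 f z).
  by apply/funext => r; apply: eq_bcut => w x wD; rewrite F2_wall// /th; ring.
rewrite E in H4.
have H0 : \sum_(w <- walls R D) w.2 * (Th (l w) - Th (m w)) -
    \sum_(w <- walls R D) w.2 * (l w * `|l w| / 2 - m w * `|m w| / 2) = 0.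
  by rewrite -(cvg_lim (@Rhausdorff R) H3); exact: cvg_lim H4.
have := congr1 (fun x => 2 * x) H0; rewrite mulr0 -sumrB mulr_sumr => H5.
by rewrite -[RHS]H5; apply: eq_bigr => w _; rewrite /Th; field.
Qed.

End wall_identities.

Section conclusions.
Context (R : realType) (D : flow_domain).
Implicit Type f : flow R D.

Lemma wall_bound f : (forall w, w \in walls R D ->
    (fun x => v1 f (x, w.1)) \in Lfun lebesgue_measure +oo%E) ->
  exists B, forall w x, w \in walls R D -> `|v1 f (x, w.1)| <= B.
Proof.
elim: (walls R D) => [_|w s IH H]; first by exists 0.
have [B HB] : exists B, forall w x, w \in s -> `|v1 f (x, w.1)| <= B.
  by apply: IH => u us; apply: H; rewrite inE us orbT.
have [B' HB'] := continuous_Linfty_bounded (@continuous_fst_slice R (v1 f) w.1 (@cv1 _ _ f))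
  (H w (mem_head _ _)).
exists (Num.max B B') => u x; rewrite inE le_max => /orP[/eqP ->|us].
  by rewrite HB' orbT.
by rewrite HB.
Qed.

Lemma upper_or_shear f (C : R) : (leb2 R).-integrable (dom R D) (EFin \o curv f) ->
  0 <= C -> flow_growth f C -> signed_curv f = total f ->
  angles f = upper_semicircle R \/
  (forall z, cdom D z -> v2 f z = 0) /\
  (forall x y, cdom D (x, y) -> v1 f (x, y) = v1 f (0, y)).
Proof.
move=> ic C0 gC E; have v0 := v2_ge0_of_signed_curv ic E.
have [T0|T0] := eqVneq (total f) 0; last by left; apply: (angles_upper v0 ic C0 gC); rewrite E.
by right; apply: shear_of_F_eq0; exact: F_eq0_of_total.
Qed.

Lemma integrable_curvP f : (leb2 R).-integrable (dom R D) (EFin \o curv f) <->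
  (\int[leb2 R]_(z in dom R D) (curv f z)%:E < +oo)%E.
Proof.
have E : (\int[leb2 R]_(z in dom R D) `|(EFin \o curv f) z| =
    \int[leb2 R]_(z in dom R D) (curv f z)%:E)%E.
  by apply: eq_integral => z _; rewrite /= ger0_norm ?curv_ge0.
split=> [/integrableP[_]|H]; first by rewrite E.
by apply/integrableP; split; [apply/measurable_EFinP; exact: measurable_curv|rewrite E].
Qed.

Lemma integral_curvE f : (leb2 R).-integrable (dom R D) (EFin \o curv f) ->
  (\int[leb2 R]_(z in dom R D) (curv f z)%:E = (total f)%:E)%E.
Proof. by move=> ic; rewrite fineK//; apply: integrable_fin_num ic; exact: measurable_dom. Qed.

Lemma total_gt0_of_angles f : (leb2 R).-integrable (dom R D) (EFin \o curv f) ->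
  angles f = upper_semicircle R -> 0 < total f.
Proof.
move=> ic H; rewrite lt_neqAle total_ge0 andbT eq_sym; apply/eqP => T0.
have [v20 _] := shear_of_F_eq0 (F_eq0_of_total ic T0).
by have [z /v20 ->] := v2_gt0_of_angles H; rewrite ltxx.
Qed.

Lemma wall_limit_functions f (B : R) : (forall z, dom R D z -> 0 <= v2 f z) ->
  (forall w x, w \in walls R D -> `|v1 f (x, w.1)| <= B) ->
  exists l m : R * R -> R, forall w, w \in walls R D ->
    v1 f (x, w.1) @[x --> -oo] --> l w /\ v1 f (x, w.1) @[x --> +oo] --> m w.
Proof.
move=> v0 HB; have : forall w : R * R, exists lm : R * R, w \in walls R D ->
    v1 f (x, w.1) @[x --> -oo] --> lm.1 /\ v1 f (x, w.1) @[x --> +oo] --> lm.2.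
  move=> w; have [wD|nw] := boolP (w \in walls R D); last by exists 0.
  have [l [m Hlm]] := wall_limits v0 wD (fun x => HB w x wD).
  by exists (l, m).
by move=> /choice[h Hh]; exists (fun w => (h w).1), (fun w => (h w).2).
Qed.

End conclusions.

(** * The flux limit, the equality cases and the wall formulas for the given velocity *)

Unset Implicit Arguments.

Theorem proposition4p4 (R : realType) (D : flow_domain)
    (v : R * R -> R * R) (P : R * R -> R)
    (v1_C1 : C1_closure (dom R D) (comp1 v))
    (v2_C1 : C1_closure (dom R D) (comp2 v))
    (v_euler : euler (dom R D) v P)
    (v_slip : slip D v)
    (v_growth : growth D v) :
  ((total_curvature D v < +oo)%E ->
     cvg (boundary_flux D v r @[r --> +oo]) /\
     (`|J_infty D v|%:E <= (2 / pi)%:E * total_curvature D v)%E)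
  /\
  (W21_loc (dom R D) v -> bounded_trace D v ->
    [/\ ((total_curvature D v < +oo)%E /\
         `|J_infty D v|%:E = ((2 / pi)%:E * total_curvature D v)%E)
        <->
        [\/ flow_angles v (closure (dom R D)) = upper_semicircle R,
            flow_angles v (closure (dom R D)) = lower_semicircle R |
            shear_flow (closure (dom R D)) v],
        D = HalfPlane ->
        flow_angles v (closure (dom R D)) = upper_semicircle R ->
        nonincreasing_fun (fun x1 : R => (v (x1, 0)).1) /\
        exists um up : R,
          [/\ (v (x1, 0)).1 @[x1 --> -oo] --> um,
              (v (x1, 0)).1 @[x1 --> +oo] --> up,
              um = - up,
              0 < um &
              total_curvature D v = (pi / 2 * up ^+ 2)%:E] &
        D = Strip ->
        flow_angles v (closure (dom R D)) = upper_semicircle R ->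
        [/\ nondecreasing_fun (fun x1 : R => (v (x1, 1)).1),
            nonincreasing_fun (fun x1 : R => (v (x1, -1)).1) &
            exists um up bm bp : R,
              [/\ (v (x1, -1)).1 @[x1 --> -oo] --> um /\
                  (v (x1, -1)).1 @[x1 --> +oo] --> up,
                  (v (x1, 1)).1 @[x1 --> -oo] --> bm /\
                  (v (x1, 1)).1 @[x1 --> +oo] --> bp,
                  bp ^+ 2 - bm ^+ 2 = up ^+ 2 - um ^+ 2 &
                  total_curvature D v =
                    (pi / 4 * (bp * `|bp| - bm * `|bm|
                               + um * `|um| - up * `|up|))%:E]]]).
Proof.
have [f [vE aE bE]] := flow_exists v1_C1 v2_C1 v_euler v_slip.
have [C C0 gC] := flow_growth_of vE v_growth.
have TE := total_curvatureE vE aE bE.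
have fluxE : boundary_flux D v = fun r => bcut D r (fun z => `|v1 f z| * b2 f z).
  by apply/funext => r; exact: (boundary_fluxE vE).
have JE : (leb2 R).-integrable (dom R D) (EFin \o curv f) ->
    J_infty D v = 2 / pi * signed_curv f.
  move=> ic; rewrite /J_infty fluxE -[RHS]opprK; congr (- _).
  exact: (cvg_lim (@Rhausdorff R) (flux_cvg ic C0 gC)).
have p0 : 0 < 2 / pi :> R by rewrite divr_gt0// pi_gt0.
have JN : (leb2 R).-integrable (dom R D) (EFin \o curv f) ->
    `|J_infty D v| = 2 / pi * `|signed_curv f|.
  by move=> ic; rewrite JE// normrM (gtr0_norm p0).
rewrite TE; split=> [/integrable_curvP ic|_ bt].
  split; first by rewrite fluxE; apply/cvg_ex; eexists; exact: (flux_cvg ic C0 gC).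
  rewrite integral_curvE// -EFinM lee_fin JN// ler_pM2l//; exact: signed_curv_le.
have wallE (w : R * R) : w \in walls R D -> (fun x => (v (x, w.1)).1) = fun x => v1 f (x, w.1).
  by move=> wD; apply/funext => x; have [->] := vE _ (wall_cdom x wD).
have [B HB] : exists B, forall w x, w \in walls R D -> `|v1 f (x, w.1)| <= B.
  by apply: wall_bound => w wD; have := bt w wD; rewrite wallE.
have [g [g1 g2 gF1 gF2]] := reversal_exists f.
have gE := curv_reversal g1 g2 gF1 gF2.
have SgE := signed_curv_reversal g1 g2 gF1 gF2.
have anglesE : flow_angles v (closure (dom R D)) = angles f := flow_anglesE vE.
have lowerE := angles_lower g1 g2.
have icf : (forall z, dom R D z -> 0 <= v2 f z) -> _ := fun v0 => curv_integrable v0 C0 gC HB.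
have dom_ge0 (h : flow R D) : angles h = upper_semicircle R -> forall z, dom R D z -> 0 <= v2 h z.
  by move=> H z /dom_cdom; apply: v2_ge0_of_angles; rewrite H.
rewrite anglesE; split.
- split.
    move=> [/integrable_curvP ic]; rewrite integral_curvE// -EFinM JN// => -[].
    move=> /(mulfI (lt0r_neq0 p0)) E.
    (* Stated with a factor k so as to serve the flow itself (k = 1) and its reversal (k = -1),
       according to the sign of the signed curvature. *)
    have shearE (h : flow R D) (k : R) : (forall z, v1 f z = k * v1 h z) ->
        (forall z, v2 f z = k * v2 h z) ->
        (forall z, cdom D z -> v2 h z = 0) /\
        (forall x y, cdom D (x, y) -> v1 h (x, y) = v1 h (0, y)) ->
        shear_flow (closure (dom R D)) v.
      move=> f1 f2 [h2 h1]; exists (fun y => v1 f (0, y)) => -[x y]; rewrite closure_dom => xy.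
      have [e1 e2] := vE _ xy; rewrite [LHS]surjective_pairing -e1 -e2.
      by rewrite f1 f2 h2// mulr0 h1// f1.
    have [S0|S0] := leP 0 (signed_curv f).
      rewrite ger0_norm// in E.
      have [|sh] := upper_or_shear ic C0 gC E; first by constructor 1.
      by constructor 3; apply: (shearE f 1) sh => z; rewrite mul1r.
    have ig : (leb2 R).-integrable (dom R D) (EFin \o curv g) by rewrite gE.
    have gg := flow_growth_reversal g1 g2 gC.
    have E' : signed_curv g = total g by rewrite SgE// /total gE -/(total f) -E ltr0_norm.
    have [H|sh] := upper_or_shear ig C0 gg E'; first by constructor 2; apply/lowerE.
    by constructor 3; apply: (shearE g (-1)) sh => z; rewrite mulN1r ?g1 ?g2 opprK.
  have fin (ic : (leb2 R).-integrable (dom R D) (EFin \o curv f)) : `|signed_curv f| = total f -> 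
      (\int[leb2 R]_(z in dom R D) (curv f z)%:E < +oo)%E /\
      `|J_infty D v|%:E = ((2 / pi)%:E * (\int[leb2 R]_(z in dom R D) (curv f z)%:E))%E.
    move=> E; split; first exact/integrable_curvP.
    by rewrite integral_curvE// -EFinM JN// E.
  have pos : (forall z, dom R D z -> 0 <= v2 f z) -> 
      (\int[leb2 R]_(z in dom R D) (curv f z)%:E < +oo)%E /\
      `|J_infty D v|%:E = ((2 / pi)%:E * (\int[leb2 R]_(z in dom R D) (curv f z)%:E))%E.
    by move=> v0; apply: fin; [exact: icf|rewrite signed_curvE// ger0_norm// total_ge0].
  case=> [H|/lowerE H|[h H]].
  + by apply: pos; exact: dom_ge0.
  + have v0 := dom_ge0 _ H; have gg := flow_growth_reversal g1 g2 gC.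
    have ig := curv_integrable v0 C0 gg (B := B); rewrite gE in ig.
    have ic : (leb2 R).-integrable (dom R D) (EFin \o curv f).
      by apply: ig => w x wD; rewrite g1 normrN; exact: HB.
    apply: fin => //; rewrite -normrN -SgE// signed_curvE// /total gE.
    by rewrite ger0_norm// total_ge0.
  + apply: pos => z Dz; have [_ ->] := vE z (dom_cdom Dz).
    by rewrite H//; apply: subset_closure.
- move=> DH H; subst D; have v0 := dom_ge0 _ H; have ic := icf v0.
  have wD : (0, -1) \in walls R HalfPlane by rewrite inE.
  have [l [m Hlm]] := wall_limit_functions v0 HB.
  have W := total_walls v0 ic C0 gC (fun w wD => (Hlm w wD).1) (fun w wD => (Hlm w wD).2).
  have Q := wall_squares v0 ic C0 gC (fun w wD => (Hlm w wD).1) (fun w wD => (Hlm w wD).2).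
  have T0 := total_gt0_of_angles ic H; rewrite integral_curvE//.
  rewrite (wallE _ wD) /=; split.
    move=> x y xy; have := wall_monotone v0 wD xy; rewrite /= !mulN1r; lra.
  exists (l (0, -1)), (m (0, -1)); have [Hl Hm] := Hlm _ wD.
  rewrite /= in Hl Hm; rewrite /= big_seq1 /= in W; rewrite /= big_seq1 /= in Q; set um := l _ in W Q Hl *; set up := m _ in W Q Hm *.
  rewrite W in T0 *; have p4 : 0 < pi / 4 :> R by rewrite divr_gt0// pi_gt0.
  move: T0; rewrite pmulr_rgt0// => T0.
  (* [wall_squares] with a single wall. The alternative um = up would give zero curvature, hence v_2
     = 0, although the upper semicircle contains the vertical direction. *)
  have : (um - up) * (um + up) = 0 by lra.
  move/eqP; rewrite mulf_eq0 subr_eq0 addr_eq0 => /orP[/eqP E|/eqP E].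
    by rewrite E subrr mulr0 ltxx in T0.
  rewrite E normrN in T0 *.
  (* With um = -up the positive curvature is -(pi/2) up |up|, which fixes the sign of up. *)
  have up0 : up < 0.
    by rewrite ltNge; apply/negP => up0; rewrite ger0_norm// in T0; nra.
  split=> //; [by rewrite -E|lra|].
  by congr EFin; rewrite ltr0_norm//; field.
- move=> DS H; subst D; have v0 := dom_ge0 _ H; have ic := icf v0.
  have wD : (-1, -1) \in walls R Strip by rewrite !inE eqxx.
  have wU : (1, 1) \in walls R Strip by rewrite !inE eqxx orbT.
  have [l [m Hlm]] := wall_limit_functions v0 HB.
  have W := total_walls v0 ic C0 gC (fun w wD => (Hlm w wD).1) (fun w wD => (Hlm w wD).2).
  have Q := wall_squares v0 ic C0 gC (fun w wD => (Hlm w wD).1) (fun w wD => (Hlm w wD).2).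
  rewrite integral_curvE// (wallE _ wD) (wallE _ wU) /=; split.
  + move=> x y xy; have := wall_monotone v0 wU xy; rewrite /= !mul1r; lra.
  + move=> x y xy; have := wall_monotone v0 wD xy; rewrite /= !mulN1r; lra.
  exists (l (-1, -1)), (m (-1, -1)), (l (1, 1)), (m (1, 1)).
  rewrite /= !big_cons big_nil /= in W; rewrite /= !big_cons big_nil /= in Q.
  split; [exact: Hlm|exact: Hlm|lra|].
  by rewrite W; congr (_ * _)%:E; ring.
Qed.
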